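(* There exist absolute constants $C',C_1,C_2>0$ such that the following holds. Suppose $\|f_0\|_\infty<\infty$, and that $g_a$ is a probability density on $\mathbb R$ that is symmetric, non-increasing on $(0,\infty)$, has full support, and for which there exists a sequence $\{R_n\}$ with $\log R_n\lesssim\log n$ and $$\int_{|x|>R_n}g_a(x)\,dx\le n^{-C'}.$$ Then there exists some $c>0$ in the model selection prior $\lambda_n(m)\propto\exp(-c\,m\log(en))$, $m\in\mathbb N$, such that for $n$ large enough (depending only on $f_0$ and the prior $g_a$), $$P_{f_0}^{(n)}\Pi_n\big(f\ge f_0:\bar L_1(f,f_0)>C_1(\epsilon_{n,m}^{\mathrm{int}})^2\,\big|\,N\big)\le C_2e^{-m\log(en)/C_2},$$ where $$(\epsilon_{n,m}^{\mathrm{int}})^2\equiv\max\Big\{\inf_{g\in\mathcal F_m}\bar L_1(f_0,g),\ \frac{m\log(en)}{n}\Big\}.$$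
   Context: One observes the points $\{(X_i,Y_i)\}\subset[0,1]\times\mathbb R$ of a Poisson point process $N$ on $[0,1]\times\mathbb R$ with intensity $\lambda_f(x,y)=n\mathbf 1_{\{f(x)\le y\}}$, where $f:[0,1]\to\mathbb R$; $P_f^{(n)}$ is its law (and expectation), $f_0$ the true boundary. For $f_1\le f_0$ one has $dP_{f_0}^{(n)}/dP_{f_1}^{(n)}=e^{n\|f_0-f_1\|_1}\mathbf 1\{\forall i:f_0(X_i)\le Y_i\}$. The one-sided loss (the Kullback–Leibler divergence up to the factor $n$) is $\bar L_1(f,g)=\|f-g\|_1=\int_0^1|f-g|$ if $g\le f$, and $\bar L_1(f,g)=\infty$ otherwise. Minimizers of $g\mapsto\bar L_1(f_0,g)$ over $\mathcal F_m$ are assumed to exist. Models: $\mathcal F_m=\{f=\sum_{j=1}^ma_j\mathbf 1_{[t_{j-1},t_j)}:0=t_0<t_1<\dots<t_{m-1}<t_m=1,\ a_j\in\mathbb R\}$ and $\mathcal F=\bigcup_{m\ge1}\mathcal F_m$. Prior: draw $m$ from $\lambda_n$; given $m$, draw $(t_1,\dots,t_{m-1})\in[0,1]^{m-1}$ with density $(m-1)!\,\mathbf 1_{\{t_1<\dots<t_{m-1}\}}$ and, independently, $(a_1,\dots,a_m)$ with density $g_a^{\otimes m}$. This gives the overall prior $\Pi_n$ on $\mathcal F$, and the posterior is the one determined by the likelihood ratios above, i.e. $\Pi_n(B\mid N)=\int_Be^{n\int_0^1f}\mathbf 1\{\forall i:f(X_i)\le Y_i\}\,d\Pi_n(f)\big/\int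 e^{n\int_0^1f}\mathbf 1\{\forall i:f(X_i)\le Y_i\}\,d\Pi_n(f)$. *)

(* Defs.v *)
From HB Require Import structures.
From mathcomp Require Export all_boot all_order all_algebra.
From mathcomp Require Export all_classical all_reals all_analysis.
Export Order.TTheory GRing.Theory Num.Theory.
Export numFieldNormedType.Exports.

Set Implicit Arguments.
Unset Strict Implicit.
Unset Printing Implicit Defensive.

Local Open Scope classical_set_scope.
Local Open Scope ring_scope.
Local Open Scope ereal_scope.

Section SupportBoundary.
Context {R : realType}.
Local Notation leb := (@lebesgue_measure R).

(* A function [0,1] -> R is represented by a function R -> R of which only the
   values on [0,1] matter. *)

(* The intensity lambda_f is insensitive to Lebesgue-null modifications of f,
   so boundary functions are compared almost everywhere on [0,1]. *)
Definition le01 (f g : R -> R) : Prop :=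
  {ae leb, forall x, x \in `[0%R, 1%R] -> (f x <= g x)%R}.

Definition Lbar1 (f g : R -> R) : \bar R :=
  if `[< le01 g f >] then \int[leb]_(x in `[0%R, 1%R]) `|f x - g x|%R%:E
  else +oo.

(* For t = [:: t_1; ...; t_(m-1)] and a = [:: a_1; ...; a_m] this is the sum of
   the a_j 1_[t_(j-1), t_j[ with t_0 = 0 and t_m = 1 (indices shifted by 1). *)
Definition step_fun (t a : seq R) (x : R) : R :=
  \sum_(j < size a) (a`_j * \1_(`[(0%R :: t)`_j, (rcons t 1%R)`_j[) x)%R.

Definition model (m : nat) : set (R -> R) :=
  [set f | exists t a : seq R,
    [/\ size t = m.-1, size a = m, path <%R 0%R (rcons t 1%R) &
        f = step_fun t a]].

(* The integral over R^k of a nonnegative function of k real variables, as an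
   iterated Lebesgue integral (Tonelli). *)
Fixpoint integral_seq (k : nat) (F : seq R -> \bar R) : \bar R :=
  if k is k'.+1 then \int[leb]_x integral_seq k' (fun s => F (x :: s))
  else F [::].

Definition dens_t (t : seq R) : R :=
  ((size t)`!%:R *
   (all (fun x => x \in `[0%R, 1%R]) t && sorted <%R t)%:R)%R.

Definition dens_a (ga : R -> R) (a : seq R) : R := (\prod_(x <- a) ga x)%R.

Definition log_en (n : nat) : R := ln (expR 1 * n%:R).

Definition model_weight (c : R) (n m : nat) : R :=
  expR (- (c * m%:R * log_en n)).

Definition model_prior (c : R) (n m : nat) : R :=
  (model_weight c n m / fine (\sum_(1 <= k <oo) (model_weight c n k)%:E))%R.

(* The integral of a nonnegative h against the overall prior Pi_n. *)
Definition prior_integral (c : R) (ga : R -> R) (n : nat)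
    (h : (R -> R) -> \bar R) : \bar R :=
  \sum_(1 <= m <oo)
    (model_prior c n m)%:E *
    integral_seq m.-1 (fun t => (dens_t t)%:E *
      integral_seq m (fun a => (dens_a ga a)%:E * h (step_fun t a))).

Definition likelihood (n : nat) (pts : nat -> R * R) (f : R -> R) : \bar R :=
  (expR (n%:R * \int[leb]_(x in `[0%R, 1%R]) f x) *
   `[< forall i, (f (pts i).1 <= (pts i).2)%R >]%:R)%R%:E.

Definition posterior (c : R) (ga : R -> R) (n : nat) (pts : nat -> R * R)
    (B : set (R -> R)) : \bar R :=
  prior_integral c ga n (fun f => (\1_B f)%:E * likelihood n pts f) /
  prior_integral c ga n (likelihood n pts).

Definition intensity (n : nat) (f : R -> R) (B : set (R * R)) : \bar R :=
  \int[leb \x leb]_(z in B)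
    (n%:R * \1_[set z : R * R | z.1 \in `[0%R, 1%R] /\ (f z.1 <= z.2)%R] z)%R%:E.

Section PoissonProcess.
Context d (Omega : measurableType d) (P : probability Omega R).

Definition npoints (Z : nat -> Omega -> R * R) (B : set (R * R)) (w : Omega) :
    \bar R :=
  \sum_(0 <= i <oo) (\1_B (Z i w))%:E.

(* [poisson_prob rate _], unlike [poisson_pmf rate], is right at rate 0; its
   second argument is a dummy.  The counts take values in the natural numbers
   extended by +oo, so the last clause is their mutual independence. *)
Definition poisson_process (Lambda : set (R * R) -> \bar R)
    (Z : nat -> Omega -> R * R) : Prop :=
  [/\ forall i, measurable_fun [set: Omega] (Z i),
      forall B, measurable B -> Lambda B < +oo -> forall k : nat,
        P [set w | npoints Z B w = k%:R%:E] =
        poisson_prob (fine (Lambda B)) k [set k] &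
      forall (r : nat) (B : 'I_r -> set (R * R)),
        (forall i, measurable (B i)) -> trivIset [set: 'I_r] B ->
        forall k : 'I_r -> \bar R,
          P (\bigcap_i [set w | npoints Z (B i) w = k i]) =
          \big[mule/1]_(i < r) P [set w | npoints Z (B i) w = k i]].

(* The points of a Poisson process on [0,1] x R with intensity lambda_f,
   enumerated; for bounded f there are almost surely infinitely many. *)
Definition observation (n : nat) (f : R -> R) (Z : nat -> Omega -> R * R) :
    Prop :=
  poisson_process (intensity n f) Z /\
  forall i w, (Z i w).1 \in `[0%R, 1%R].

End PoissonProcess.

Definition minimizers_exist (f0 : R -> R) : Prop :=
  forall m : nat, (0 < m)%N ->
    exists2 g, model m g & forall h, model m h -> Lbar1 f0 g <= Lbar1 f0 h.

Definition eps_int2 (f0 : R -> R) (n m : nat) : \bar R :=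
  maxe (ereal_inf [set Lbar1 f0 g | g in model m])
       (m%:R * log_en n / n%:R)%R%:E.

Definition probability_density (g : R -> R) : Prop :=
  [/\ measurable_fun [set: R] g, forall x, (0 <= g x)%R &
      \int[leb]_x (g x)%:E = 1].

Definition height_density (ga : R -> R) : Prop :=
  [/\ probability_density ga,
      forall x, ga (- x)%R = ga x,
      forall x y, (0 < x)%R -> (x <= y)%R -> (ga y <= ga x)%R &
      closure [set x | ga x != 0%R] = [set: R]].

Definition tail_condition (C' : R) (ga : R -> R) : Prop :=
  exists Rn : nat -> R,
    [/\ forall n, (0 < n)%N -> (0 < Rn n)%R,
        exists K : R, forall n, (2 <= n)%N -> (ln (Rn n) <= K * ln n%:R)%R &
        forall n, (0 < n)%N ->
          \int[leb]_(x in [set x | (Rn n < `|x|)%R]) (ga x)%:E <=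
          (n%:R `^ (- C'))%:E].

End SupportBoundary.

(* Main.v *)
Require Import Defs.
From mathcomp Require Import measurable_realfun ess_sup_inf.
From mathcomp Require Import ring lra zify.

Set Implicit Arguments.
Unset Strict Implicit.
Unset Printing Implicit Defensive.

Local Open Scope classical_set_scope.
Local Open Scope ring_scope.

(** The posterior mass of the candidates [f] above [f0] at distance more than
    [640 * eps ^ 2] is a ratio, which is at most 1.  Below, [h0] is a version of
    [f0] bounded by [M], and likelihoods are compared with
    [expR (n * intI h0 0 1)].

    Denominator.  Let [g] be a minimizer with its heights clamped to [-M, M].
    Almost surely no point lies below [g], so every [f <= g] has likelihood
    [expR (n * intI f 0 1)].  Of the cells of the grid of mesh [1 / n], mark
    those next to a break point of [g], at most [3 * (m - 1)] of them.  If each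
    marked cell has exactly one break point of [f], in its middle third, and
    each height of [f] lies within [1 / n] below the value of [g] on that piece
    (below [-M], if the piece may meet a break point of [g]), then [f <= g] and
    [n * intI f 0 1] falls short of [n * intI g 0 1] by [O(m)] only.  These are
    [O(m)] constraints on one coordinate each, satisfied with probability at
    least [(e n)^-2] each, and the denominator is at least
    [expR (n * intI h0 0 1 - 40 * n * eps ^ 2)]: see [denominator_ge] and
    [prior_integral_ge].

    Numerator.  If all [f] in a set lie above a function [l], then the
    likelihood of each is zero unless no point lies below [l], an event of
    probability [expR (- n * intI (max 0 (l - h0)) 0 1)]: see [prob_above].  So
    the candidates are covered by countably many such sets, indexed by codes,
    which are lists of natural numbers.  A code records the scale of the length
    of each piece, the position of each break point on a grid much finer than
    the two pieces that meet there, and each height rounded down to a multiple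
    of [1 / (n * length)].  The function [l] decoded from it is below [f], and
    its gain [G], a lower bound for [n * intI (max 0 (l - h0)) 0 1], satisfies
    [n * (intI f 0 1 - intI h0 0 1) <= 8/7 * G + (M + 2) * pieces]: see
    [area_bound] and [total_gain_excess].

    The expected contribution of a code to the posterior is then at most
    [min 1 y * expR (- G)], where [y] is [expR (8/7 * G)] times the
    prior probability of the cells of its break points, the prior weight of the
    model and [expR (40 * n * eps ^ 2 + (M + 2) * pieces)].  As [8/7] exceeds 1, the bound
    [y * expR (- G)] would not be summable over the heights; but
    [min 1 y <= y ^ (3/4)], and [3/4 * 8/7 = 6/7] is less than 1.  Half of the
    remaining [expR (- G / 7)] gives, as [8/7 * G] is at least about
    [640 * n * eps ^ 2], the factor [expR (- 40 * n * eps ^ 2)] that beats the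
    denominator, and the other half makes the sum over the heights converge: see
    [code_weight].  The probabilities of the cells to the power [3/4] are still
    summable over the scales, since the number of positions of a break point is limited by the
    ratio of two adjacent scales: see [total_weight_sum].  The sum over all codes
    with [k] pieces is [n ^ (4 * k)] at most, which the prior weight
    [expR (- 8 * k * log_en n)], even to the power [3/4], dominates.

    The sum over codes bounds the ratio for every realisation of the points
    outside a null set, and it is only the sum that is integrated. *)

Local Open Scope ereal_scope.
Import HBNNSimple.

(** * Integrals of functions that need not be measurable *)

(** The integral of a nonnegative function is a supremum over the simple
    functions below it, whether or not the function is measurable; a simple
    function can be set to 0 on a null set. *)
Lemma ge0_le_integral_ae {d} {T : measurableType d} {R : realType}
    (mu : {measure set T -> \bar R}) (N : set T) (f g : T -> \bar R) :
  measurable N -> mu N = 0 -> (forall x, 0 <= f x) -> (forall x, 0 <= g x) ->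
  (forall x, ~ N x -> f x <= g x) -> \int[mu]_x f x <= \int[mu]_x g x.
Proof.
move=> mN N0 f0 g0 fg; rewrite (ge0_integralTE _ f0) (ge0_integralTE _ g0).
apply: ge_ereal_sup => _ [h /= hf <-].
have mNC : measurable (~` N) by exact: measurableC.
pose h' := proj_nnsfun h mNC.
have hh' : sintegral mu h = sintegral mu h'.
  rewrite -!integralT_nnsfun; apply: ge0_ae_eq_integral => //.
  - by apply/measurable_EFinP; exact: measurable_funP.
  - by apply/measurable_EFinP; exact: measurable_funP.
  - by move=> x _; rewrite lee_fin.
  - by move=> x _; rewrite lee_fin.
  exists N; split=> // x; apply: contraPP => Nx.
  by apply; rewrite /h' /= mindicE mem_set// mulr1.
rewrite hh'; apply: ereal_sup_ubound; exists h' => //= x.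
rewrite mindicE; have [/set_mem|/negP] := boolP (x \in ~` N).
  by move=> Nx; rewrite mulr1; exact: le_trans (hf x) (fg _ Nx).
by rewrite mulr0 g0.
Qed.

Section IntegralSeq.
Context {R : realType}.
Local Notation leb := (@lebesgue_measure R).
Implicit Types (k : nat) (F G : seq R -> \bar R).

Lemma integral_seq_ge0 k F : (forall s, size s = k -> 0 <= F s) ->
  0 <= integral_seq k F.
Proof.
elim: k F => [|k ih] F F0 /=; first exact: F0.
by apply: integral_ge0 => x _; apply: ih => s sk; apply: F0; rewrite /= sk.
Qed.

(** An exceptional point of [R^k] has a coordinate in [N], so the integral over
    that coordinate does not see it. *)
Lemma le_integral_seq_ae k (N : set R) F G : measurable N -> leb N = 0 ->
  (forall s, size s = k -> 0 <= F s) -> (forall s, size s = k -> 0 <= G s) ->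
  (forall s, size s = k -> (forall x, x \in s -> ~ N x) -> F s <= G s) ->
  integral_seq k F <= integral_seq k G.
Proof.
move=> mN N0; elim: k F G => [|k ih] F G F0 G0 FG /=; first exact: FG.
have X := @ge0_le_integral_ae _ _ R leb N
  (fun x => integral_seq k (fun s : seq R => F (x :: s)))
  (fun x => integral_seq k (fun s : seq R => G (x :: s))) mN N0.
apply: X.
- by move=> x; apply: integral_seq_ge0 => s sk; apply: F0; rewrite /= sk.
- by move=> x; apply: integral_seq_ge0 => s sk; apply: G0; rewrite /= sk.
move=> x Nx; apply: ih => s sk; first by apply: F0; rewrite /= sk.
  by apply: G0; rewrite /= sk.
move=> sN; apply: FG => [|y]; first by rewrite /= sk.
by rewrite inE => /predU1P[->//|/sN].
Qed.

Lemma le_integral_seq k F G :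
  (forall s, size s = k -> 0 <= F s) -> (forall s, size s = k -> 0 <= G s) ->
  (forall s, size s = k -> F s <= G s) -> integral_seq k F <= integral_seq k G.
Proof.
move=> F0 G0 FG; apply: (@le_integral_seq_ae k set0) => // s sk _.
exact: FG.
Qed.

Lemma eq_integral_seq k F G :
  (forall s, size s = k -> F s = G s) -> integral_seq k F = integral_seq k G.
Proof.
elim: k F G => [|k ih] F G FG /=; first exact: FG.
by apply: eq_integral => x _; apply: ih => s sk; apply: FG; rewrite /= sk.
Qed.

Fixpoint prodf (fs : seq (R -> \bar R)) (s : seq R) : \bar R :=
  match fs, s with
  | f :: fs', x :: s' => f x * prodf fs' s'
  | _, _ => 1
  end.

Lemma prodf_ge0 fs s : (forall f, List.In f fs -> forall x, 0 <= f x) ->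
  0 <= prodf fs s.
Proof.
elim: fs s => [|f fs ih] [|x s] //= h.
by apply: mule_ge0; [apply: h; left|apply: ih => g gi; apply: h; right].
Qed.

Lemma integral_seq_prodf (fs : seq (R -> \bar R)) (y : \bar R) : 0 <= y ->
  (forall f : R -> \bar R, List.In f fs -> measurable_fun [set: R] f /\ forall x, 0 <= f x) ->
  integral_seq (size fs) (fun s => y * prodf fs s) =
  y * \big[mule/1]_(f <- fs) \int[leb]_x f x.
Proof.
elim: fs y => [|f fs ih] y y0 h /=; first by rewrite big_nil.
have [mf f0] : measurable_fun [set: R] f /\ forall x, 0 <= f x by apply: h; left.
have hs : forall f : R -> \bar R, List.In f fs -> measurable_fun [set: R] f /\ forall x, 0 <= f x.
  by move=> g gi; apply: h; right.
transitivity (\int[leb]_x (f x * (y * \big[mule/1]_(f <- fs) \int[leb]_x f x))).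
  apply: eq_integral => x _.
  rewrite (@eq_integral_seq _ _ (fun s => (y * f x) * prodf fs s)); last first.
    by move=> s _; rewrite muleA.
  by rewrite ih ?mule_ge0// [RHS]muleCA muleA.
have B0 : 0 <= \big[mule/1]_(f <- fs) \int[leb]_x f x.
  clear -hs; elim: fs hs => [|g fs ih] hs; first by rewrite big_nil.
  rewrite big_cons mule_ge0//.
    by apply: integral_ge0 => x _; apply: (hs g _).2; left.
  by apply: ih => g' g'i; apply: hs; right.
rewrite ge0_integralZr// ?mule_ge0//.
by rewrite big_cons muleCA.
Qed.

End IntegralSeq.

(** * Iterated sums over lists of natural numbers *)

Section SeqSum.
Context {R : realType}.
Implicit Types (k : nat) (F G : seq nat -> \bar R).

Lemma nneseries_le (u : nat -> \bar R) (B : \bar R) N :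
  (forall i, 0 <= u i) -> (forall n, \sum_(N <= i < n) u i <= B) ->
  \sum_(N <= i <oo) u i <= B.
Proof.
move=> u0 uB; apply: lime_le; first exact: is_cvg_nneseries.
by apply: nearW => n; exact: uB.
Qed.

(** The counterpart of [integral_seq] for the counting measure. *)
Fixpoint seq_sum k F : \bar R :=
  if k is k'.+1 then \sum_(i <oo) seq_sum k' (fun s => F (i :: s)) else F [::].

Lemma seq_sum_ge0 k F : (forall s, size s = k -> 0 <= F s) -> 0 <= seq_sum k F.
Proof.
elim: k F => [|k ih] F F0 /=; first exact: F0.
by apply: nneseries_ge0 => i _ _; apply: ih => s sk; apply: F0; rewrite /= sk.
Qed.

Lemma le_seq_sum k F G : (forall s, size s = k -> 0 <= F s) ->
  (forall s, size s = k -> F s <= G s) -> seq_sum k F <= seq_sum k G.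
Proof.
elim: k F G => [|k ih] F G F0 FG /=; first exact: FG.
apply: lee_nneseries => [i _ _|i _].
  by apply: seq_sum_ge0 => s sk; apply: F0; rewrite /= sk.
by apply: ih => s sk; [apply: F0|apply: FG]; rewrite /= sk.
Qed.

Lemma eq_seq_sum k F G : (forall s, size s = k -> F s = G s) ->
  seq_sum k F = seq_sum k G.
Proof.
elim: k F G => [|k ih] F G FG /=; first exact: FG.
by apply: eq_eseriesr => i _; apply: ih => s sk; apply: FG; rewrite /= sk.
Qed.

Lemma nneseries_term (u : nat -> \bar R) N j : (forall i, 0 <= u i) ->
  (N <= j)%N -> u j <= \sum_(N <= i <oo) u i.
Proof.
move=> u0 Nj.
apply: le_trans (nneseries_lim_ge (m := N) (P := xpredT) j.+1 _) => //.
by rewrite big_nat_recr//= leeDr// sume_ge0.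
Qed.

Lemma seq_sum_term c F : (forall s, size s = size c -> 0 <= F s) ->
  F c <= seq_sum (size c) F.
Proof.
elim: c F => [|i c ih] F F0 //=.
have F0i j s : size s = size c -> 0 <= F (j :: s).
  by move=> sk; apply: F0; rewrite /= sk.
apply: le_trans (ih (fun s => F (i :: s)) (F0i i)) _.
apply: (@nneseries_term (fun i => seq_sum (size c) (fun s => F (i :: s))) 0%N i) => // j.
exact/seq_sum_ge0/F0i.
Qed.

Lemma seq_sumZl k (y : R) F : (forall s, size s = k -> 0 <= F s) ->
  seq_sum k (fun s => y%:E * F s) = y%:E * seq_sum k F.
Proof.
elim: k F => [|k ih] F F0 //=.
have F0i j s : size s = k -> 0 <= F (j :: s).
  by move=> sk; apply: F0; rewrite /= sk.
rewrite -nneseriesZl; last by move=> i _; apply/seq_sum_ge0/F0i.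
by apply: eq_eseriesr => i _; apply: (ih (fun s => F (i :: s))); exact: F0i.
Qed.

Lemma seq_sum_integral {d} {T : measurableType d}
    (mu : {measure set T -> \bar R}) k (F : T -> seq nat -> \bar R) :
  (forall c, size c = k -> forall x, 0 <= F x c) ->
  (forall c, size c = k -> measurable_fun [set: T] (F^~ c)) ->
  measurable_fun [set: T] (fun x => seq_sum k (F x)) /\
  \int[mu]_x seq_sum k (F x) = seq_sum k (fun c => \int[mu]_x F x c).
Proof.
elim: k F => [|k ih] F F0 mF /=; first by split=> //; exact: mF.
have h i : measurable_fun [set: T] (fun x => seq_sum k (fun s => F x (i :: s))) /\
    \int[mu]_x seq_sum k (fun s => F x (i :: s)) =
    seq_sum k (fun c => \int[mu]_x F x (i :: c)).
  apply: (ih (fun x s => F x (i :: s))) => c ck; [apply: F0|apply: mF];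
  by rewrite /= ck.
have h0 i x : 0 <= seq_sum k (fun s => F x (i :: s)).
  by apply: seq_sum_ge0 => s sk; apply: F0; rewrite /= sk.
split.
  apply: (@ge0_emeasurable_sum _ _ _ _ _ xpredT) => [i x _ _|i _]; first exact: h0.
  by case: (h i).
rewrite integral_nneseries//; last by move=> i; case: (h i).
by apply: eq_eseriesr => i _; case: (h i).
Qed.

(** If a term is at least 1 then so is its truncation, which alone bounds the
    left-hand side; otherwise no term is changed by truncation. *)
Lemma mine1_nneseries (u : nat -> \bar R) N : (forall i, 0 <= u i) ->
  mine 1 (\sum_(N <= i <oo) u i) <= \sum_(N <= i <oo) mine 1 (u i).
Proof.
move=> u0.
have m0 i : 0 <= mine 1 (u i) by rewrite le_min lee01 u0.
have [[j [Nj uj]]|nu] := pselect (exists j, (N <= j)%N /\ 1 <= u j).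
  apply: (@le_trans _ _ 1); first by rewrite ge_min lexx.
  apply: le_trans (@nneseries_term (fun i => mine 1 (u i)) N j m0 Nj).
  by rewrite le_min lexx.
apply: (@le_trans _ _ (\sum_(N <= i <oo) u i)).
  by rewrite ge_min lexx orbT.
rewrite eseries_cond [leRHS]eseries_cond.
apply: lee_nneseries => // i /= Ni.
rewrite le_min lexx andbT leNgt; apply/negP => ui.
apply: nu; exists i; split=> //; exact: ltW.
Qed.

Lemma mine1_seq_sum k F : (forall s, size s = k -> 0 <= F s) ->
  mine 1 (seq_sum k F) <= seq_sum k (fun s => mine 1 (F s)).
Proof.
elim: k F => [|k ih] F F0 //=.
have F0i j s : size s = k -> 0 <= F (j :: s).
  by move=> sk; apply: F0; rewrite /= sk.
have g0 i : 0 <= seq_sum k (fun s => F (i :: s)) by apply/seq_sum_ge0/F0i.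
apply: le_trans (mine1_nneseries 0 g0) _.
apply: lee_nneseries => [i _ _|i _]; first by rewrite le_min lee01 g0.
exact/ih/F0i.
Qed.

(** Tonelli for a series of product functions of several real variables. *)
Lemma integral_seq_seq_sum b k (y : seq nat -> \bar R)
    (fs : seq nat -> seq (R -> \bar R)) :
  (forall c, size c = k -> 0 <= y c) ->
  (forall c, size c = k -> size (fs c) = b) ->
  (forall c, size c = k -> forall f : R -> \bar R, List.In f (fs c) ->
     measurable_fun [set: R] f /\ forall x, 0 <= f x) ->
  integral_seq b (fun s => seq_sum k (fun c => y c * prodf (fs c) s)) =
  seq_sum k (fun c => y c *
    \big[mule/1]_(f <- fs c) \int[@lebesgue_measure R]_x f x).
Proof.
elim: b y fs => [|b ih] y fs y0 sfs hfs /=.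
  apply: eq_seq_sum => c ck; have := sfs _ ck.
  by case: (fs c) => //= _; rewrite big_nil.
pose f c := head (cst 0) (fs c).
pose gs c := behead (fs c).
have fE c : size c = k -> fs c = f c :: gs c.
  by move=> ck; rewrite /f /gs; have := sfs _ ck; case: (fs c).
have hf c : size c = k -> measurable_fun [set: R] (f c) /\ forall x, 0 <= f c x.
  by move=> ck; apply: (hfs _ ck); rewrite (fE _ ck); left.
have hgs c : size c = k -> forall g : R -> \bar R, List.In g (gs c) ->
     measurable_fun [set: R] g /\ forall x, 0 <= g x.
  by move=> ck g gi; apply: (hfs _ ck); rewrite (fE _ ck); right.
pose B c := \big[mule/1]_(g <- gs c) \int[@lebesgue_measure R]_x g x.
have B0 c : size c = k -> 0 <= B c.
  move=> ck; have := hgs _ ck; rewrite /B; elim: (gs c) => [|g s ihs] h.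
    by rewrite big_nil.
  rewrite big_cons mule_ge0//.
    by apply: integral_ge0 => x _; apply: (h g _).2; left.
  by apply: ihs => g' g'i; apply: h; right.
transitivity (\int[@lebesgue_measure R]_x
    seq_sum k (fun c => (y c * f c x) * B c)).
  apply: eq_integral => x _.
  transitivity (integral_seq b (fun s =>
      seq_sum k (fun c => (y c * f c x) * prodf (gs c) s))).
    apply: eq_integral_seq => s _; apply: eq_seq_sum => c ck.
    by rewrite (fE _ ck) /= muleA.
  rewrite (ih (fun c => y c * f c x) gs)//.
  - by move=> c ck; rewrite mule_ge0 ?y0// (hf _ ck).2.
  - by move=> c ck; have := sfs _ ck; rewrite (fE _ ck) => -[].
have := @seq_sum_integral _ _ (@lebesgue_measure R) k
  (fun x c => (y c * f c x) * B c).
case.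
- by move=> c ck x; rewrite !mule_ge0 ?y0 ?B0// (hf _ ck).2.
- move=> c ck.
  apply: emeasurable_funM; last exact: measurable_cst.
  by apply: emeasurable_funM; [exact: measurable_cst|exact: (hf _ ck).1].
move=> _ ->; apply: eq_seq_sum => c ck.
have [mf f0] := hf _ ck.
rewrite ge0_integralZr ?B0//; last 2 first.
- by apply: emeasurable_funM; [exact: measurable_cst|].
- by move=> x _; rewrite mule_ge0 ?y0.
rewrite ge0_integralZl ?y0//.
by rewrite (fE _ ck) big_cons muleA.
Qed.

End SeqSum.

(** * Integrals of bounded functions *)

Section Integral01.
Context {R : realType}.
Local Notation leb := (@lebesgue_measure R).
Implicit Types (f g h l : R -> R) (u v w x M : R).

Definition bounded_measurable f :=
  measurable_fun [set: R] f /\ exists M, forall x, (`|f x| <= M)%R.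

(** The half-open interval makes these integrals additive by disjoint union. *)
Definition intI f u v : R := (\int[leb]_(x in `[u, v[) f x)%R.

Lemma bounded_integrable f u v : bounded_measurable f ->
  leb.-integrable `[u, v[ (EFin \o f).
Proof.
move=> [mf [M fM]]; apply: measurable_bounded_integrable => //.
- by have /= := lebesgue_measure_itv (`[u, v[ : interval R) => ->; case: ifP; rewrite ?ltry.
- exact: measurable_funTS.
- exists M; split; first exact: num_real.
  by move=> y My x _; exact: le_trans (fM x) (ltW My).
Qed.

Lemma bounded_integrablec f u v : bounded_measurable f ->
  leb.-integrable `[u, v] (EFin \o f).
Proof.
move=> [mf [M fM]]; apply: measurable_bounded_integrable => //.
- by have /= := lebesgue_measure_itv (`[u, v] : interval R) => ->; case: ifP; rewrite ?ltry.
- exact: measurable_funTS.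
- exists M; split; first exact: num_real.
  by move=> y My x _; exact: le_trans (fM x) (ltW My).
Qed.

Lemma intI_closed f : bounded_measurable f ->
  (\int[leb]_(x in `[0%R, 1%R]) f x)%R = intI f 0 1.
Proof. by move=> bf; rewrite -Rintegral_itv_bndo_bndc//; exact: bounded_integrable. Qed.

Lemma intI_add f v u w : bounded_measurable f -> (u <= v)%R -> (v <= w)%R ->
  intI f u w = (intI f u v + intI f v w)%R.
Proof.
move=> bf uv vw; rewrite /intI.
have E : `[u, w[%classic = `[u, v[ `|` `[v, w[ :> set R.
  by rewrite -itv_bndbnd_setU// bnd_simp.
rewrite E Rintegral_setU//.
  by rewrite -E; exact: bounded_integrable.
apply/disj_setPS => y [/=]; rewrite 2!in_itv/= => /andP[_ yx] /andP[].
by rewrite leNgt yx.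
Qed.

Lemma intI_cst u v (c : R) : (u <= v)%R -> intI (fun=> c) u v = (c * (v - u))%R.
Proof.
move=> uv; rewrite /intI Rintegral_cst//= lebesgue_measure_itv/=.
rewrite lte_fin; move: uv; rewrite le_eqVlt => /predU1P[->|->//].
by rewrite ltxx subrr.
Qed.

Lemma le_intI f g u v : bounded_measurable f -> bounded_measurable g ->
  (forall x, (u <= x < v)%R -> (f x <= g x)%R) -> (intI f u v <= intI g u v)%R.
Proof.
move=> bf bg fg; apply: le_Rintegral => //; try exact: bounded_integrable.
Qed.

Lemma eq_intI f g u v :
  (forall x, (u <= x < v)%R -> f x = g x) -> intI f u v = intI g u v.
Proof.
by move=> fg; apply: eq_Rintegral => x; rewrite inE/= in_itv/=; exact: fg.
Qed.

Lemma intID f g u v : bounded_measurable f -> bounded_measurable g ->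
  intI (fun x => f x + g x)%R u v = (intI f u v + intI g u v)%R.
Proof. by move=> bf bg; apply: RintegralD => //; exact: bounded_integrable. Qed.

Lemma intIB f g u v : bounded_measurable f -> bounded_measurable g ->
  intI (fun x => f x - g x)%R u v = (intI f u v - intI g u v)%R.
Proof. by move=> bf bg; apply: RintegralB => //; exact: bounded_integrable. Qed.

Lemma intIZ f (c : R) u v : bounded_measurable f ->
  intI (fun x => c * f x)%R u v = (c * intI f u v)%R.
Proof. by move=> bf; apply: RintegralZl => //; exact: bounded_integrable. Qed.

Lemma bounded_measurable_cst (c : R) : bounded_measurable (fun=> c).
Proof. by split; [exact: measurable_cst|exists `|c|%R]. Qed.

Lemma bounded_measurableD f g : bounded_measurable f -> bounded_measurable g ->
  bounded_measurable (fun x => f x + g x)%R.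
Proof.
move=> [mf [M fM]] [mg [N gN]]; split; first exact: measurable_funD.
exists (M + N)%R => x; exact: le_trans (ler_normD _ _) (lerD (fM x) (gN x)).
Qed.

Lemma bounded_measurableB f g : bounded_measurable f -> bounded_measurable g ->
  bounded_measurable (fun x => f x - g x)%R.
Proof.
move=> [mf [M fM]] [mg [N gN]]; split; first exact: measurable_funB.
exists (M + N)%R => x; exact: le_trans (ler_normB _ _) (lerD (fM x) (gN x)).
Qed.

Lemma bounded_measurableM f g : bounded_measurable f -> bounded_measurable g ->
  bounded_measurable (fun x => f x * g x)%R.
Proof.
move=> [mf [M fM]] [mg [N gN]]; split; first exact: measurable_funM.
by exists (M * N)%R => x; rewrite normrM ler_pM.
Qed.

Lemma bounded_measurable_max f g : bounded_measurable f -> bounded_measurable g ->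
  bounded_measurable (fun x => Num.max (f x) (g x))%R.
Proof.
move=> [mf [M fM]] [mg [N gN]]; split; first exact: measurable_maxr.
exists (M + N)%R => x.
have M0 : (0 <= M)%R by exact: le_trans (fM 0%R).
have N0 : (0 <= N)%R by exact: le_trans (gN 0%R).
by case: (leP (f x) (g x)) => _; [rewrite (le_trans (gN x))// lerDr|rewrite (le_trans (fM x))// lerDl].
Qed.

Lemma bounded_measurable_indic (A : set R) : measurable A ->
  bounded_measurable (\1_A : R -> R).
Proof.
move=> mA; split; first exact: measurable_indic.
by exists 1%R => x; rewrite indicE normr_nat lern1 leq_b1.
Qed.

End Integral01.

(** * Points below a curve *)

Section Void.
Context {R : realType}.
Local Notation leb := (@lebesgue_measure R).
Context (f0 h0 : R -> R).
Hypothesis mf0 : measurable_fun (`[0%R, 1%R] : set R) f0.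
Hypothesis bh0 : bounded_measurable h0.
Hypothesis f0h0 : {ae leb, forall x, x \in `[0%R, 1%R] -> f0 x = h0 x}.

Lemma measurable_belowset (l : R -> R) : measurable_fun [set: R] l ->
  measurable [set z : R * R | z.1 \in `[0%R, 1%R] /\ (z.2 < l z.1)%R].
Proof.
move=> ml.
rewrite (_ : mkset _ = (fst @^-1` `[0%R, 1%R]) `&`
   ((fun z : R * R => (z.2 - l z.1)%R) @^-1` `]-oo, 0%R[)); last first.
  apply/seteqP; split=> [[x y] /= [-> h]|[x y] /=].
    by split=> //; rewrite in_itv /= subr_lt0.
  by rewrite !in_itv/= subr_lt0 => -[].
apply: measurableI.
  by rewrite -[X in measurable X]setTI; apply: measurable_fst.
rewrite -[X in measurable X]setTI.
have : measurable_fun [set: R * R] (fun z : R * R => (z.2 - l z.1)%R).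
  apply: measurable_funB; first exact: measurable_snd.
  by apply: measurableT_comp => //; exact: measurable_fst.
by apply.
Qed.

(** The vertical section at [x] of the region between [f0] and [l] has length
    [max 0 (l x - f0 x)]; integrating over [x] one can replace [f0] by [h0]. *)
Lemma intensity_belowset n (l : R -> R) : bounded_measurable l ->
  intensity n f0 [set z : R * R | z.1 \in `[0%R, 1%R] /\ (z.2 < l z.1)%R] =
  (n%:R * intI (fun x => Num.max 0 (l x - h0 x))%R 0 1)%:E.
Proof.
move=> bl; have [ml _] := bl.
set B := mkset _.
pose F0 := (f0 \_ `[0%R, 1%R])%R.
have mF0 : measurable_fun [set: R] F0.
  by apply/(measurable_restrictT f0 (measurable_itv _)).
pose C := B `&` [set z : R * R | (F0 z.1 <= z.2)%R].
have mB : measurable B by exact: measurable_belowset.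
have mC : measurable C.
  apply: measurableI => //.
  have : measurable_fun [set: R * R] (fun z : R * R => (z.2 - F0 z.1)%R).
    apply: measurable_funB; first exact: measurable_snd.
    by apply: measurableT_comp => //; exact: measurable_fst.
  move=> /(_ measurableT `[0%R, +oo[%classic (measurable_itv _)).
  rewrite setTI; congr (measurable _); apply/seteqP.
  by split=> -[x y] /=; rewrite in_itv/= andbT subr_ge0.
have F0E x : x \in `[0%R, 1%R] -> F0 x = f0 x.
  by move=> x01; rewrite /F0 patchE mem_set.
rewrite /intensity integral_mkcond.
transitivity (\int[leb \x leb]_z (n%:R%:E * (\1_C z)%:E)).
  apply: eq_integral => -[x y] _; rewrite patchE.
  have [/set_mem xyB|xyB] := boolP ((x, y) \in B); last first.
    rewrite indicE (_ : (_ \in C) = false) ?mule0//.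
    by apply/negbTE/negP => /set_mem[/mem_set]; rewrite (negPf xyB).
  rewrite -EFinM; congr (_ * _)%:E%R; rewrite !indicE; congr (_%:R).
  case: (xyB) => /= x01 yl; congr nat_of_bool; apply/idP/idP.
    move=> /set_mem /= [_ fy]; apply/mem_set; split=> //=.
    by rewrite F0E.
  by move=> /set_mem [_ /=]; rewrite F0E// => fy; apply/mem_set.
rewrite ge0_integralZl_EFin//; last first.
  by apply/measurable_EFinP; exact: measurable_indic.
rewrite integral_indic// setIT EFinM; congr *%E.
have := @bounded_integrablec _ (fun x => Num.max 0 (l x - h0 x))%R 0 1.
have bmax : bounded_measurable (fun x => Num.max 0 (l x - h0 x))%R.
  by apply: bounded_measurable_max; [exact: bounded_measurable_cst|exact: bounded_measurableB].
move=> /(_ bmax) ibm.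
rewrite -intI_closed// /Rintegral fineK; last exact: integrable_fin_num.
rewrite /product_measure1 /=.
transitivity (\int[leb]_(x in `[0%R, 1%R]) (Num.max 0 (l x - F0 x))%:E).
  rewrite [RHS]integral_mkcond; apply: eq_integral => x _.
  rewrite patchE; case: ifPn => [/set_mem/= x01|x01].
    rewrite (_ : xsection C x = `[F0 x, l x[%classic).
      rewrite lebesgue_measure_itv/= lte_fin; case: ltP => h.
        by rewrite max_r// subr_ge0 ltW.
      by rewrite max_l// subr_le0.
    apply/seteqP; split=> y; rewrite /xsection/= inE.
      by move=> [/= [_ ?] ?]; rewrite in_itv/=; apply/andP.
    by rewrite in_itv/= => /andP[? ?]; split.
  rewrite /= (_ : xsection C x = set0) ?measure0//.
  apply/seteqP; split=> y //; rewrite /xsection/= inE => -[[/= x01' _] _].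
  by move: x01; rewrite mem_set.
apply: ae_eq_integral => //.
- apply/measurable_EFinP/measurable_funTS/measurable_maxr => //.
  exact: measurable_funB.
- by apply/measurable_EFinP/measurable_funTS; case: bmax.
have [N [mN N0 sN]] := f0h0; exists N; split=> // x hx; apply: sN => /= h.
by apply: hx => /= x01; rewrite F0E ?h.
Qed.

Context d (Omega : measurableType d) (P : probability Omega R)
  (n : nat) (Z : nat -> Omega -> R * R).
Hypothesis obs : observation P n f0 Z.

Lemma measurable_above (l : R -> R) : measurable_fun [set: R] l ->
  measurable [set w | forall i, (l (Z i w).1 <= (Z i w).2)%R].
Proof.
move=> ml; have [[mZ _ _] Z01] := obs.
pose B := [set z : R * R | z.1 \in `[0%R, 1%R] /\ (z.2 < l z.1)%R].
rewrite (_ : mkset _ = \bigcap_i (Z i @^-1` (~` B))); last first.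
  apply/seteqP; split=> w /= h.
    by move=> i _ /= [_]; rewrite ltNge h.
  move=> i; rewrite leNgt; apply/negP => li.
  by apply: (h i Logic.I) => /=; split.
apply: bigcapT_measurable => i; rewrite -[X in measurable X]setTI.
by apply: mZ => //; apply: measurableC; exact: measurable_belowset.
Qed.

(** No point lies below [l] exactly when the Poisson count of that region is 0.
    The rate may be 0, which the definition of the law treats apart. *)
Lemma prob_above (l : R -> R) : bounded_measurable l ->
  P [set w | forall i, (l (Z i w).1 <= (Z i w).2)%R] =
  (expR (- (n%:R * intI (fun x => Num.max 0 (l x - h0 x))%R 0 1)))%:E.
Proof.
move=> bl; have [ml _] := bl; have [[mZ cnt _] Z01] := obs.
pose B := [set z : R * R | z.1 \in `[0%R, 1%R] /\ (z.2 < l z.1)%R].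
have mB : measurable B by exact: measurable_belowset.
have LB := intensity_belowset n bl; rewrite -/B in LB.
have := cnt B mB; rewrite LB ltry => /(_ isT 0%N).
set lam := (n%:R * _)%R.
have lam0 : (0 <= lam)%R.
  by rewrite mulr_ge0// Rintegral_ge0// => x _; rewrite le_max lexx.
rewrite (_ : [set w | npoints Z B w = _] =
   [set w | forall i, (l (Z i w).1 <= (Z i w).2)%R]); last first.
  apply/seteqP; split=> w /= h.
    move=> i; rewrite leNgt; apply/negP => li.
    have : ((\1_B (Z i w))%:E <= (0%:E : \bar R)).
      rewrite -h; apply: (@nneseries_term _ (fun i => (\1_B (Z i w))%:E) 0%N i) => //.
    by rewrite indicE mem_set ?lee_fin ?ler10//; split=> //; exact: Z01.
  apply: eseries0 => i _ _; rewrite indicE memNset//=.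
  by move=> [_]; rewrite ltNge h.
move=> ->; rewrite /poisson_prob /=; case: ifPn => [lam_gt0|].
  rewrite esum_set1 ?lee_fin ?poisson_pmf_ge0//.
  by rewrite /poisson_pmf lam_gt0 expr0 fact0 invr1 !mul1r.
rewrite -leNgt => lam_le0.
have -> : lam = 0%R by apply/eqP; rewrite eq_le lam_le0 lam0.
by rewrite diracE mem_set// oppr0 expR0.
Qed.

End Void.

Local Close Scope ereal_scope.

(** * Step functions *)

Section StepFunctions.
Context {R : realType}.
Implicit Types (p q x : R) (t a : seq R).

(** [step_fun] with an arbitrary left end point [p], for inductions that
    remove the leftmost piece. *)
Definition step_from p t a x : R :=
  \sum_(j < size a) a`_j * \1_(`[(p :: t)`_j, (rcons t 1)`_j[) x.

Fixpoint area p t a : R :=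
  match t, a with
  | [::], a0 :: _ => a0 * (1 - p)
  | t1 :: t', a0 :: a' => a0 * (t1 - p) + area t1 t' a'
  | _, [::] => 0
  end.

Lemma step_from_cons p (t1 : R) t (a0 : R) a x :
  step_from p (t1 :: t) (a0 :: a) x = a0 * \1_(`[p, t1[) x + step_from t1 t a x.
Proof. by rewrite /step_from /= big_ord_recl. Qed.

Lemma step_from_last p (a0 : R) x : step_from p [::] [:: a0] x = a0 * \1_(`[p, 1[) x.
Proof. by rewrite /step_from /= big_ord_recl big_ord0 addr0. Qed.

Lemma indic_itvco p q x : \1_(`[p, q[%classic : set R) x = (p <= x < q)%R%:R :> R.
Proof.
rewrite indicE; congr ((nat_of_bool _)%:R); apply/idP/idP.
  by move=> /set_mem /=; rewrite in_itv.
by move=> h; apply/mem_set; rewrite /= in_itv.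
Qed.

Lemma bounded_step_from p t a : size a = (size t).+1 ->
  bounded_measurable (step_from p t a).
Proof.
have h (c u v : R) : bounded_measurable (fun x => c * \1_(`[u, v[%classic : set R) x).
  apply: bounded_measurableM; first exact: bounded_measurable_cst.
  by apply: bounded_measurable_indic; exact: measurable_itv.
elim: t p a => [|t1 t ih] p [|a0 a] // [sa].
  case: a sa => // _.
  by under [X in bounded_measurable X]funext do rewrite step_from_last.
under [X in bounded_measurable X]funext do rewrite step_from_cons.
by apply: bounded_measurableD => //; exact: ih.
Qed.

Lemma path_le1 p t : path <%R p (rcons t 1) -> p < 1.
Proof.
elim: t p => [|t1 t ih] p /=; first by rewrite andbT.
by move=> /andP[pt /ih]; exact: lt_trans.
Qed.

Lemma step_from_left p t a x : size a = (size t).+1 ->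
  path <%R p (rcons t 1) -> x < p -> step_from p t a x = 0.
Proof.
elim: t p a => [|t1 t ih] p [|a0 a] // [sa].
  case: a sa => // _ _ xp.
  by rewrite step_from_last indic_itvco leNgt xp mulr0.
move=> /= /andP[pt pth] xp.
rewrite step_from_cons indic_itvco leNgt xp mulr0 add0r.
by apply: ih => //; exact: lt_trans pt.
Qed.

Lemma step_from_right p t a x : size a = (size t).+1 ->
  path <%R p (rcons t 1) -> 1 <= x -> step_from p t a x = 0.
Proof.
elim: t p a => [|t1 t ih] p [|a0 a] // [sa].
  case: a sa => // _ _ xp.
  by rewrite step_from_last indic_itvco [x < 1]ltNge xp andbF mulr0.
move=> /= /andP[pt pth] xp.
rewrite step_from_cons indic_itvco ih// addr0 [x < t1]ltNge.
by rewrite (le_trans (ltW (path_le1 pth)) xp) andbF mulr0.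
Qed.

Lemma step_from_head p (t1 : R) t (a0 : R) a x : size a = (size t).+1 ->
  path <%R p (t1 :: rcons t 1) -> p <= x < t1 ->
  step_from p (t1 :: t) (a0 :: a) x = a0.
Proof.
move=> sa /= /andP[pt pth] /andP[px xt].
by rewrite step_from_cons indic_itvco px xt mulr1 step_from_left// addr0.
Qed.

Lemma step_from_tail p (t1 : R) t (a0 : R) a x : t1 <= x ->
  step_from p (t1 :: t) (a0 :: a) x = step_from t1 t a x.
Proof.
by move=> tx; rewrite step_from_cons indic_itvco [x < t1]ltNge tx andbF mulr0 add0r.
Qed.

Lemma intI_step_from p t a : size a = (size t).+1 ->
  path <%R p (rcons t 1) -> intI (step_from p t a) p 1 = area p t a.
Proof.
elim: t p a => [|t1 t ih] p [|a0 a] // [sa].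
  case: a sa => // _ /= /andP[p1 _].
  rewrite (@eq_intI _ _ (fun=> a0)); first by rewrite intI_cst// ltW.
  by move=> x h; rewrite step_from_last indic_itvco h mulr1.
move=> pth; have /= /andP[pt pth'] := pth.
have t1_le1 := ltW (path_le1 pth').
rewrite (@intI_add _ _ t1)//; last 2 first.
- by apply: bounded_step_from => /=; rewrite sa.
- exact: ltW.
rewrite (@eq_intI _ _ (fun=> a0)); last by move=> x h; rewrite step_from_head.
rewrite intI_cst; last exact: ltW.
rewrite (@eq_intI _ _ (step_from t1 t a)) ?ih//.
by move=> x /andP[tx _]; rewrite step_from_tail.
Qed.

Lemma step_from_eval p t a x : size a = (size t).+1 ->
  path <%R p (rcons t 1) -> p <= x < 1 ->
  exists2 j, (j < size a)%N &
    (p :: t)`_j <= x < (rcons t 1)`_j /\ step_from p t a x = a`_j.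
Proof.
elim: t p a => [|t1 t ih] p [|a0 a] // [sa].
  case: a sa => // _ _ px; exists 0%N => //=; split=> //.
  by rewrite step_from_last indic_itvco px mulr1.
move=> pth /andP[px x1]; have [xt|tx] := ltP x t1.
  by exists 0%N => //=; rewrite px xt; split=> //; rewrite step_from_head// px.
have /= /andP[pt pth'] := pth.
have [|j ja [jx je]] := ih t1 a sa pth' _; first by rewrite tx.
by exists j.+1 => //=; split=> //; rewrite step_from_tail.
Qed.

Lemma step_from_map (phi : R -> R) p t a x : size a = (size t).+1 ->
  path <%R p (rcons t 1) -> p <= x < 1 ->
  step_from p t (map phi a) x = phi (step_from p t a x).
Proof.
elim: t p a => [|t1 t ih] p [|a0 a] // [sa].
  case: a sa => // _ _ px.
  by rewrite !step_from_last indic_itvco px !mulr1.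
move=> pth /andP[px x1]; have /= /andP[pt pth'] := pth.
have [xt|tx] := ltP x t1.
  by rewrite /= !step_from_head ?px ?size_map.
by rewrite /= !step_from_tail// ih// tx.
Qed.

End StepFunctions.

(** * Codes of step functions *)

Section Codes.
Context {R : realType}.
Local Notation leb := (@lebesgue_measure R).
Variables (n mm : nat) (M : R) (h0 : R -> R).
Hypotheses (n0 : (0 < n)%N) (mm0 : (0 < mm)%N) (M0 : 0 <= M).
Hypotheses (mh0 : measurable_fun [set: R] h0) (h0M : forall x, `|h0 x| <= M).

Local Notation J := (intI h0).

Lemma bounded_h0 : bounded_measurable h0.
Proof. by split=> //; exists M. Qed.

Lemma J_bound u v : u <= v -> `|J u v| <= M * (v - u).
Proof.
move=> uv; rewrite ler_norml -mulNr -!(@intI_cst _ u v)//.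
have bc c := @bounded_measurable_cst R c.
by apply/andP; split; apply: le_intI => //; try exact: bounded_h0;
  move=> x _; have := h0M x; rewrite ler_norml => /andP[].
Qed.

(** The mesh of the grid of scale [i].  [mm] is the number of pieces, so that
    the cells of one code have total length at most [1 / (16 * n)]. *)
Definition rho (i : nat) : R := (16 * n%:R * mm%:R * 16 ^+ i)^-1.

Lemma rho_gt0 i : 0 < rho i.
Proof. by rewrite invr_gt0 !mulr_gt0 ?ltr0n ?exprn_gt0. Qed.

Lemma le_rho i j : (i <= j)%N -> rho j <= rho i.
Proof.
move=> ij; rewrite lef_pV2 ?posrE ?mulr_gt0 ?ltr0n ?exprn_gt0//.
by rewrite ler_pM2l ?mulr_gt0 ?ltr0n// ler_eXn2l// ltr1n.
Qed.

Lemma rhoS i : rho i = 16 * rho i.+1.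
Proof. by rewrite /rho exprS !invfM; field; rewrite ?expf_neq0 ?pnatr_eq0 -?lt0n ?n0 ?mm0. Qed.

(** A piece of scale [i] is between 16 and 256 times as long as the mesh
    [rho i], except that scale 0 takes in all longer pieces. *)
Lemma scale_exists (l : R) : 0 < l ->
  exists i, 16 * rho i <= l /\ (i == 0%N) || (l <= 256 * rho i).
Proof.
move=> l0.
have ex : exists i, 16 * rho i <= l.
  exists (Num.truncn l^-1).+1; set i := (Num.truncn l^-1).+1.
  have il : 1 <= i%:R * l by rewrite -ler_pdivrMr// div1r ltW// truncnS_gt.
  rewrite (_ : 16 * rho i = (n%:R * mm%:R * 16 ^+ i)^-1); last first.
    by rewrite /rho; field; rewrite ?expf_neq0 ?pnatr_eq0 -?lt0n ?n0 ?mm0.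
  rewrite -[X in X <= _]div1r ler_pdivrMr ?mulr_gt0 ?ltr0n ?exprn_gt0//.
  rewrite mulrC; apply: le_trans il _; rewrite ler_wpM2r ?(ltW l0)//.
  apply: (@le_trans _ _ (16 ^+ i)).
    by rewrite -natrX ler_nat ltnW// ltn_expl.
  by rewrite ler_peMl ?exprn_ge0// -natrM ler1n muln_gt0 n0.
exists (ex_minn ex); case: ex_minnP => i hi mi; split=> //.
case: i hi mi => [|i] hi mi //=.
rewrite leNgt; apply/negP => h.
suff : (i.+1 <= i)%N by rewrite ltnn.
by apply: mi; rewrite rhoS mulrA -natrM ltW.
Qed.

(** ** Codes *)

(** A code describes a step function from left to right.  A piece that is
    not the last takes three entries [k; i'; q]: its height index, the scale of
    the next piece, and the number of whole cells of the common mesh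
    [rho (maxn i i')] of the two scales to the left of the break point.  The last
    piece takes its height index only.  In all the recursions below [u] is the
    right end of the cell of the preceding break point, and [i] is the scale of
    the current piece. *)
Fixpoint valid (u : R) (i : nat) (c : seq nat) : bool :=
  match c with
  | [:: k] => (u < 1) && ((i == 0%N) || (1 - u <= 256 * rho i))
  | k :: i' :: q :: c' =>
      let r := rho (maxn i i') in
      [&& (0 < q)%N, (i == 0%N) || (q%:R * r <= 256 * rho i)
        & valid (u + q%:R * r + r) i' c']
  | _ => false
  end.

Fixpoint cells (u : R) (i : nat) (c : seq nat) : seq (R -> \bar R) :=
  match c with
  | k :: i' :: q :: c' =>
      let r := rho (maxn i i') in
      (EFin \o \1_`[(u + q%:R * r), (u + q%:R * r + r)[%classic)
        :: cells (u + q%:R * r + r) i' c'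
  | _ => [::]
  end.

Fixpoint vol (i : nat) (c : seq nat) : R :=
  match c with
  | k :: i' :: q :: c' => rho (maxn i i') * vol i' c'
  | _ => 1
  end.

(** The common lower bound of the step functions with a given code; on the
    cells of the break points only the bound [-M] is known. *)
Fixpoint level (u : R) (i : nat) (c : seq nat) (x : R) : R :=
  match c with
  | [:: k] => if x < u then - M else
              if x < 1 then - M + k%:R / (n%:R * (1 - u)) else - M
  | k :: i' :: q :: c' =>
      let r := rho (maxn i i') in
      if x < u then - M else
      if x < u + q%:R * r then - M + k%:R / (n%:R * (q%:R * r)) else
      level (u + q%:R * r + r) i' c' x
  | _ => - M
  end.

(** Lower bounds for [n] times the integral of [max 0 (b - h0)] over an interval
    of length [lam], where [b = - M + k / (n * lam)] and [j] is the integral of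
    [h0]: the second one drops the positive part, the third one also uses
    [h0 <= M]. *)
Definition gain (k : nat) (lam j : R) : R :=
  Num.max 0 (Num.max (k%:R - M * n%:R * lam - n%:R * j)
                     (k%:R - 2 * M * n%:R * lam)).

Fixpoint total_gain (u : R) (i : nat) (c : seq nat) : R :=
  match c with
  | [:: k] => gain k (1 - u) (J u 1)
  | k :: i' :: q :: c' =>
      let r := rho (maxn i i') in
      gain k (q%:R * r) (J u (u + q%:R * r)) +
      total_gain (u + q%:R * r + r) i' c'
  | _ => 0
  end.

Lemma valid_lt1 b u i c : size c = (3 * b).+1 -> valid u i c -> u < 1.
Proof.
elim: b u i c => [|b ih] u i [|k c]//; first by case: c => //= _ /andP[].
rewrite mulnS; case: c => [|i' [|q c]]//= [] sc /and3P[_ _ /(ih _ _ _ sc)].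
apply: le_lt_trans; rewrite -addrA lerDl.
by rewrite addr_ge0 ?mulr_ge0 ?ler0n ?(ltW (rho_gt0 _)).
Qed.

Lemma size_cells b u i c : size c = (3 * b).+1 -> size (cells u i c) = b.
Proof.
elim: b u i c => [|b ih] u i [|k c]//; first by case: c.
by rewrite mulnS; case: c => [|i' [|q c]]//= [] sc; rewrite ih.
Qed.

Lemma cells_prop u i c (f : R -> \bar R) : List.In f (cells u i c) ->
  measurable_fun [set: R] f /\ forall x, (0 <= f x)%E.
Proof.
have [m] := ubnP (size c); elim: m u i c => // m ih u i [|k [|i' [|q c]]] //= sc.
case=> [<-|/ih]; last by apply; rewrite ltnS in sc; exact: leq_trans (leqnSn _) (leq_trans (leqnSn _) sc).
split=> [|x]; last by rewrite lee_fin.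
by apply/measurable_EFinP; exact: measurable_indic.
Qed.

Lemma cells_vol b u i c : size c = (3 * b).+1 ->
  (\big[mule/1]_(f <- cells u i c) \int[leb]_x f x)%E = (vol i c)%:E.
Proof.
elim: b u i c => [|b ih] u i [|k c]//; first by case: c => //=; rewrite big_nil.
rewrite mulnS; case: c => [|i' [|q c]]//= [] sc; rewrite big_cons ih//.
have key (A : set R) : measurable A -> (\int[leb]_x (EFin \o \1_A) x = leb A)%E.
  by move=> mA; rewrite -[in RHS](setIT A) -integral_indic.
rewrite key; last exact: measurable_itv.
rewrite lebesgue_measure_itv/= lte_fin ltrDl rho_gt0.
by rewrite -EFinB -EFinM addrAC subrr add0r.
Qed.

Lemma gain_ge0 k lam j : 0 <= gain k lam j.
Proof. by rewrite le_max lexx. Qed.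

Let piece_arith (N K a lam jl j G r : R) : 0 <= M -> r <= 7^-1 ->
  K - M * N * lam - N * j <= G -> N * (a + M) * (r * lam) <= (K + 1) * r ->
  (K - 2 * M * N * lam) * r <= G / 7 -> M * (N * (r * lam)) <= M / 8 ->
  N * (j - M * (r * lam)) <= N * jl -> N * lam * (a + M) < K + 1 ->
  N * (a * (lam + r * lam) - jl) <= 8 / 7 * G + (M + 2).
Proof. by clear; move=> *; lra. Qed.

(** Here [lam] is the length of the part of a piece outside the cells, [g] that
    of the part inside, and [jl] and [j] are the integrals of [h0] over the whole
    piece and over the first part.  The part inside contributes at most
    [n * g * (a + M)], a fraction [g / lam <= 1/7] of the height index [k] up to
    bounded terms: this is where the factor [8/7] comes from. *)
Lemma piece_gain (a lam g jl j : R) (k : nat) : 0 < lam -> 0 <= g ->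
  g <= lam / 7 -> n%:R * g <= 8^-1 -> - M <= a ->
  k%:R <= n%:R * lam * (a + M) < k%:R + 1 -> j - M * g <= jl ->
  n%:R * (a * (lam + g) - jl) <= 8 / 7 * gain k lam j + (M + 2).
Proof.
move=> lam0 g0 g7 ng aM /andP[ka ak] jlj.
set G := gain k lam j.
have G0 : 0 <= G := gain_ge0 _ _ _.
have G1 : k%:R - M * n%:R * lam - n%:R * j <= G by rewrite !le_max lexx ?orbT.
have G2 : k%:R - 2 * M * n%:R * lam <= G by rewrite !le_max lexx ?orbT.
have nR : 0 < n%:R :> R by rewrite ltr0n.
pose r := g / lam.
have gE : g = r * lam by rewrite /r divfK// gt_eqF.
have r0 : 0 <= r by rewrite divr_ge0// ltW.
have r7 : r <= 7^-1 by rewrite ler_pdivrMr// mulrC.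
have njl : n%:R * (j - M * g) <= n%:R * jl by rewrite ler_pM2l.
have h1 : n%:R * (a + M) * g <= (k%:R + 1) * r.
  rewrite gE mulrCA mulrC ler_wpM2r//.
  by apply/ltW; rewrite mulrAC in ak.
have h2 : (k%:R - 2 * M * n%:R * lam) * r <= G / 7.
  by apply: le_trans (ler_wpM2r r0 G2) _; rewrite ler_wpM2l.
have h3 : M * (n%:R * g) <= M / 8 by rewrite ler_wpM2l.
rewrite gE in h1 h3 njl *.
exact: (piece_arith M0 r7 G1 h1 h2 h3 njl ak).
Qed.

(** Every step function above [-M] has a code.  The scales are chosen by the
    lengths of the pieces, each break point determines its cell, and the height
    index is the integer part of [n * length * (height + M)], so that rounding
    loses at most 1 per piece. *)
Lemma area_bound b (p u : R) i (t a : seq R) : size t = b -> size a = b.+1 ->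
  path <%R p (rcons t 1) -> (forall x, x \in a -> - M <= x) ->
  16 * rho i <= head 1 t - p -> (i == 0%N) || (head 1 t - p <= 256 * rho i) ->
  p <= u <= p + rho i ->
  exists c, [/\ size c = (3 * b).+1, valid u i c,
    prodf (cells u i c) t = 1%E,
    forall x, p <= x < 1 -> level u i c x <= step_from p t a x &
    n%:R * (area p t a - J p 1) <=
      8 / 7 * total_gain u i c + (M + 2) * (size a)%:R].
Proof.
have nR : 0 < n%:R :> R by rewrite ltr0n.
have nrho j : n%:R * rho j <= 16^-1.
  apply: le_trans (ler_wpM2l (ltW nR) (le_rho (leq0n j))) _.
  rewrite /rho expr0 mulr1 ler_pdivrMr ?mulr_gt0 ?ltr0n//.
  by rewrite !mulrA mulVf// mul1r ler_peMr ?ler0n// ler1n.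
have aux (lam a0 : R) : 0 < lam -> - M <= a0 ->
    exists k : nat, [/\ k%:R <= n%:R * lam * (a0 + M) < k%:R + 1,
      - M + k%:R / (n%:R * lam) <= a0 & - M <= a0].
  move=> lam0 a0M; exists (Num.truncn (n%:R * lam * (a0 + M))).
  have h : 0 <= n%:R * lam * (a0 + M) by apply: mulr_ge0; [rewrite mulr_ge0 ?ltW|lra].
  have /andP[h1 h2] := truncn_itv h.
  split=> //; first by rewrite h1 -natr1 in h2 *.
  have nl0 : 0 < n%:R * lam by rewrite mulr_gt0.
  rewrite addrC -lerBrDr opprK ler_pdivrMr//.
  by rewrite [leRHS]mulrC.
elim: b p u i t a => [|b ih] p u i t a.
  move=> /size0nil -> {t}; case: a => [|a0 [|]]// _ /= /andP[p1 _] aM l1 l2 /andP[pu ur].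
  have rho0 := rho_gt0 i.
  have lam0 : 0 < 1 - u by lra.
  have [|k [hk1 hk2 aM0]] := aux (1 - u) a0 lam0; first by apply: aM; rewrite inE.
  exists [:: k]; split=> //=.
  - apply/andP; split; first by lra.
    by case/orP: l2 => [->//|l2]; apply/orP; right; lra.
  - move=> x /andP[px x1]; rewrite step_from_last indic_itvco px x1 mulr1.
    by case: ifP => // _.
  - rewrite /gain -/(gain _ _ _) mulr1.
    have -> : a0 * (1 - p) = a0 * ((1 - u) + (u - p)) by ring.
    apply: piece_gain => //; try lra.
      by have := nrho i; have : n%:R * (u - p) <= n%:R * rho i; [rewrite ler_pM2l//; lra|lra].
    rewrite (@intI_add _ _ u p 1)//; [|exact: bounded_h0|lra].
    by have := J_bound pu; rewrite ler_norml; lra.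
case: t => [|t1 t]//; case: a => [|a0 a]// [st] [sa] pth aM /= l1 l2 /andP[pu ur].
have /= /andP[pt pth'] := pth.
have t1_lt1 := path_le1 pth'.
have l'0 : 0 < head 1 t - t1.
  rewrite subr_gt0; case: (t) pth' => [|t2 t'] /= /andP[] //.
have [i' [li1 li2]] := scale_exists l'0.
set r := rho (maxn i i').
have r0 : 0 < r := rho_gt0 _.
have ri : r <= rho i by apply: le_rho; exact: leq_maxl.
have ri' : r <= rho i' by apply: le_rho; exact: leq_maxr.
have rhoi0 := rho_gt0 i.
have ut : u <= t1 by lra.
pose q := Num.truncn ((t1 - u) / r).
have h : 0 <= (t1 - u) / r by rewrite divr_ge0 ?(ltW r0) ?subr_ge0.
have /andP[q1 q2] := truncn_itv h; rewrite -/q in q1 q2.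
rewrite ler_pdivlMr// in q1; rewrite ltr_pdivrMr// -natr1 mulrDl mul1r in q2.
have lam7 : 7 / 8 * (t1 - p) <= q%:R * r by lra.
have lam0 : 0 < q%:R * r by lra.
have [|k [hk1 hk2 aM0]] := aux (q%:R * r) a0 lam0; first by apply: aM; rewrite inE eqxx.
have sat : size a = (size t).+1 by rewrite sa st.
have [||c [sc vc pc lc ac]] := ih t1 (u + q%:R * r + r) i' t a st sa pth' _ li1 li2.
- by move=> x xa; apply: aM; rewrite inE xa orbT.
- by apply/andP; split; lra.
exists [:: k, i', q & c]; split=> /=.
- by rewrite sc mulnS.
- rewrite -/r vc andbT; apply/andP; split.
    by rewrite lt0n; apply/eqP => q0; move: lam0; rewrite q0 mul0r ltxx.
  by case/orP: l2 => [->//|l2]; apply/orP; right; lra.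
- rewrite -/r pc mule1 indic_itvco.
  by have -> : u + q%:R * r <= t1 < u + q%:R * r + r by apply/andP; split; lra.
- move=> x /andP[px x1]; rewrite -/r.
  have fM : - M <= step_from p (t1 :: t) (a0 :: a) x.
    have sat' : size (a0 :: a) = (size (t1 :: t)).+1 by rewrite /= sat.
    have px1 : p <= x < 1 by rewrite px.
    have [j ja [_ ->]] := step_from_eval sat' pth px1.
    by apply: aM; rewrite mem_nth.
  case: ifP => // xu; case: ifP => xv.
    by rewrite step_from_head//; lra.
  have [xt|tx] := ltP x t1; last by rewrite step_from_tail// lc// tx.
  apply: le_trans fM.
  have : x < u + q%:R * r + r by lra.
  by case: (c) sc => [|k0 [|i0 [|q0 c0]]] //= _ ->.
- have -> : J p 1 = J p t1 + J t1 1.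
    by apply: intI_add; [exact: bounded_h0|lra|lra].
  rewrite -/r -[(size a).+1%:R]natr1.
  set G1 := gain _ _ _; set G2 := total_gain _ _ _ in ac *.
  suff : n%:R * (a0 * (t1 - p) - J p t1) <= 8 / 7 * G1 + (M + 2) by lra.
  have -> : a0 * (t1 - p) = a0 * (q%:R * r + ((u - p) + (t1 - u - q%:R * r))) by ring.
  apply: piece_gain => //; try lra.
    have := nrho i; have : n%:R * (u - p + (t1 - u - q%:R * r)) <= n%:R * (2 * rho i).
      by rewrite ler_pM2l//; lra.
    by lra.
  have e1 : J p t1 = J p u + J u t1 by apply: intI_add => //; exact: bounded_h0.
  have e2 : J u t1 = J u (u + q%:R * r) + J (u + q%:R * r) t1.
    by apply: intI_add; [exact: bounded_h0|lra|lra].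
  rewrite e1 e2; have := J_bound pu; have /J_bound : u + q%:R * r <= t1 by lra.
  by rewrite !ler_norml; lra.
Qed.

Lemma bounded_if (u : R) (f g : R -> R) : bounded_measurable f ->
  bounded_measurable g -> bounded_measurable (fun x => if x < u then f x else g x).
Proof.
move=> bf bg.
rewrite (_ : (fun x => _) = fun x => f x * \1_(`]-oo, u[%classic : set R) x +
    g x * \1_(`[u, +oo[%classic : set R) x).
  by apply: bounded_measurableD; apply: bounded_measurableM => //;
    apply: bounded_measurable_indic; exact: measurable_itv.
apply/funext => x; rewrite !indicE; have [xu|ux] := ltP x u.
  rewrite mem_set/= ?in_itv//= memNset/= ?in_itv/= ?andbT ?mulr1 ?mulr0 ?addr0//.
  by apply/negP; rewrite -ltNge.
rewrite memNset/= ?in_itv/=; last by apply/negP; rewrite -leNgt.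
by rewrite mem_set/= ?in_itv/= ?ux// mulr1 mulr0 add0r.
Qed.

Lemma bounded_level u i c : bounded_measurable (level u i c).
Proof.
have bc x := @bounded_measurable_cst R x.
have [m] := ubnP (size c); elim: m u i c => // m ih u i [|k [|i' [|q c]]] //= sc.
  by do 2 apply: bounded_if => //.
apply: bounded_if => //; apply: bounded_if => //; apply: ih.
by rewrite ltnS in sc; exact: leq_trans (leqnSn _) (leq_trans (leqnSn _) sc).
Qed.

Lemma bounded_excess f : bounded_measurable f ->
  bounded_measurable (fun x => Num.max 0 (f x - h0 x)).
Proof.
move=> bf; apply: bounded_measurable_max; first exact: bounded_measurable_cst.
by apply: bounded_measurableB => //; exact: bounded_h0.
Qed.

Lemma excess_ge0 f u v : 0 <= intI (fun x => Num.max 0 (f x - h0 x)) u v.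
Proof. by apply: Rintegral_ge0 => x _; rewrite le_max lexx. Qed.

Lemma gain_excess k u v : u < v ->
  gain k (v - u) (J u v) <=
  n%:R * intI (fun x => Num.max 0 (- M + k%:R / (n%:R * (v - u)) - h0 x)) u v.
Proof.
move=> uv; set b := - M + _.
have nR : 0 < n%:R :> R by rewrite ltr0n.
have uv' := ltW uv.
have bc x := @bounded_measurable_cst R x.
have bb : bounded_measurable (fun x => b - h0 x).
  by apply: bounded_measurableB => //; exact: bounded_h0.
have bE : n%:R * (b * (v - u)) = k%:R - M * n%:R * (v - u).
  have vu : v - u != 0 by rewrite subr_eq0 gt_eqF.
  have n1 : n%:R != 0 :> R by rewrite gt_eqF.
  by rewrite /b; field; rewrite vu n1.
rewrite !ge_max; apply/and3P; split.
- by rewrite mulr_ge0//; exact: (excess_ge0 (fun=> b)).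
- rewrite -bE -mulrBr ler_pM2l// -(intI_cst _ uv') -intIB//; last exact: bounded_h0.
  apply: le_intI => //; first exact: (@bounded_excess (fun=> b)).
  by move=> x _; rewrite le_max lexx orbT.
- have -> : k%:R - 2 * M * n%:R * (v - u) = n%:R * ((b - M) * (v - u)).
    have -> : n%:R * ((b - M) * (v - u)) =
        n%:R * (b * (v - u)) - M * n%:R * (v - u) by ring.
    by rewrite bE; ring.
  rewrite ler_pM2l// -(intI_cst _ uv').
  apply: le_intI => //; first exact: (@bounded_excess (fun=> b)).
  move=> x _; rewrite le_max; apply/orP; right.
  by have := h0M x; rewrite ler_norml; lra.
Qed.

(** The cells of the break points are dropped from the integral, where the
    integrand is nonnegative. *)
Lemma total_gain_excess b u i c : size c = (3 * b).+1 -> valid u i c ->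
  total_gain u i c <=
  n%:R * intI (fun x => Num.max 0 (level u i c x - h0 x)) u 1.
Proof.
elim: b u i c => [|b ih] u i [|k c]//.
  case: c => //= _ /andP[u1 _]; apply: le_trans (gain_excess _ u1) _.
  rewrite [leRHS](_ : _ = n%:R * intI (fun x =>
    Num.max 0 (- M + k%:R / (n%:R * (1 - u)) - h0 x)) u 1)//.
  congr (_ * _); apply: eq_intI => x /andP[ux x1].
  by rewrite [x < u]ltNge ux x1.
rewrite mulnS; case: c => [|i' [|q c]]//= [] sc /and3P[q0 _ vc].
set r := rho (maxn i i'); set v := u + q%:R * r.
have r0 : 0 < r := rho_gt0 _.
have qr0 : 0 < q%:R * r by rewrite mulr_gt0// ltr0n.
have v1 := valid_lt1 sc vc; rewrite -/r -/v in v1 vc.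
have uv : u < v by rewrite ltrDl.
have bl := bounded_level u i (k :: i' :: q :: c); rewrite /= -/r -/v in bl.
have v_1 : v <= 1 by lra.
have vr : v <= v + r by lra.
rewrite (intI_add (bounded_excess bl) (ltW uv) v_1).
rewrite (intI_add (bounded_excess bl) vr (ltW v1)).
rewrite mulrDr lerD//.
  rewrite (_ : q%:R * r = v - u); last by rewrite /v; ring.
  apply: le_trans (gain_excess _ uv) _.
  rewrite [leRHS](_ : _ = n%:R * intI (fun x =>
    Num.max 0 (- M + k%:R / (n%:R * (v - u)) - h0 x)) u v)//.
  congr (_ * _); apply: eq_intI => x /andP[ux xv].
  by rewrite [x < u]ltNge ux xv.
apply: le_trans (ih _ _ _ sc vc) _.
rewrite ler_pM2l ?ltr0n// [X in _ <= _ + X](_ : _ = intI (fun x =>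
    Num.max 0 (level (v + r) i' c x - h0 x)) (v + r) 1).
  by rewrite lerDr; exact: excess_ge0.
apply: eq_intI => x /andP[vx x1].
have vx' : v <= x := le_trans vr vx.
have ux : u <= x := le_trans (ltW uv) vx'.
by rewrite [x < u]ltNge ux/= [x < v]ltNge vx'.
Qed.

(** ** Weights of codes *)

(** A piece has length at most 1, so [max 0 (k - 2 * M * n)] is at most its
    gain: this is what remains of the share [expR (- G / 14)] kept for the sum
    over the heights. *)
Definition height_weight (k : nat) : R :=
  expR (- (Num.max 0 (k%:R - 2 * M * n%:R) / 14)).

(** The power of [8^-1] is the power [3/4] of the factor [16^-1 ^+ maxn i i'] in
    the length of the cell.  The exponential makes the sum over [q] converge for
    pieces of scale 0, whose length has no better bound than 1. *)
Definition break_weight (i i' q : nat) : R :=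
  let r := rho (maxn i i') in
  if (i == 0%N) || (q%:R * r <= 256 * rho i)
  then 8^-1 ^+ maxn i i' * expR (- (mm%:R * (q%:R * r))) else 0.

Fixpoint weight (u : R) (i : nat) (c : seq nat) : R :=
  match c with
  | [:: k] => if (u < 1) && ((i == 0%N) || (1 - u <= 256 * rho i))
              then height_weight k else 0
  | k :: i' :: q :: c' =>
      let r := rho (maxn i i') in
      height_weight k * (break_weight i i' q * weight (u + q%:R * r + r) i' c')
  | _ => 0
  end.

(** The exponent of 16 in the volume of the cells. *)
Fixpoint depth (i : nat) (c : seq nat) : nat :=
  match c with
  | k :: i' :: q :: c' => maxn i i' + depth i' c'
  | _ => 0
  end.

Lemma height_weight_ge0 k : 0 <= height_weight k.
Proof. exact: expR_ge0. Qed.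

Lemma break_weight_ge0 i i' q : 0 <= break_weight i i' q.
Proof. by rewrite /break_weight; case: ifP => // _; rewrite mulr_ge0 ?expR_ge0// exprn_ge0. Qed.

Lemma weight_ge0 u i c : 0 <= weight u i c.
Proof.
have [m] := ubnP (size c); elim: m u i c => // m ih u i [|k [|i' [|q c]]] //= sc.
  by case: ifP => // _; exact: height_weight_ge0.
rewrite !mulr_ge0 ?height_weight_ge0 ?break_weight_ge0// ih//.
by rewrite ltnS in sc; exact: leq_trans (leqnSn _) (leq_trans (leqnSn _) sc).
Qed.

Lemma vol_ge0 i c : 0 <= vol i c.
Proof.
have [m] := ubnP (size c); elim: m i c => // m ih i [|k [|i' [|q c]]] //= sc.
rewrite mulr_ge0 ?(ltW (rho_gt0 _))// ih//.
by rewrite ltnS in sc; exact: leq_trans (leqnSn _) (leq_trans (leqnSn _) sc).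
Qed.

(** The power of [mm] absorbs the factorial in the density of the break
    points. *)
Lemma vol_depth b i c : size c = (3 * b).+1 ->
  mm%:R ^+ b * vol i c <= 16^-1 ^+ depth i c.
Proof.
elim: b i c => [|b ih] i [|k c]//; first by case: c => //= _; rewrite mulr1.
rewrite mulnS; case: c => [|i' [|q c]]//= [] sc.
rewrite exprS exprD mulrACA; apply: ler_pM.
- by rewrite mulr_ge0 ?ler0n ?(ltW (rho_gt0 _)).
- by rewrite mulr_ge0 ?exprn_ge0// vol_ge0.
- rewrite [leLHS](_ : _ = (16 * n%:R * 16 ^+ maxn i i')^-1).
    rewrite exprVn lef_pV2 ?posrE ?mulr_gt0 ?ltr0n ?exprn_gt0//.
    by rewrite ler_peMl ?exprn_ge0// -natrM ler1n muln_gt0 n0.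
  by rewrite /rho; field; rewrite expf_neq0 ?pnatr_eq0 -?lt0n ?n0 ?mm0.
- exact: ih.
Qed.

Lemma gain_height k lam j : 0 <= lam <= 1 ->
  expR (- (gain k lam j / 14)) <= height_weight k.
Proof.
move=> /andP[lam0 lam1]; rewrite ler_expR lerN2 ler_wpM2r//.
rewrite ge_max gain_ge0/=; apply: (@le_trans _ _ (k%:R - 2 * M * n%:R * lam)).
  by rewrite lerD2l lerN2 ler_piMr// !mulr_ge0.
by rewrite !le_max lexx !orbT.
Qed.

(** The lengths add up to at most [1 - u], so the exponentials in the break
    weights cost a factor [expR (mm * (1 - u))] at most: the constraint on the
    total length becomes a product of weights of the individual pieces. *)
Lemma weight_bound b u i c : size c = (3 * b).+1 -> valid u i c -> 0 <= u ->
  expR (- (total_gain u i c / 14)) * 8^-1 ^+ depth i c <=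
  expR (mm%:R * (1 - u)) * weight u i c.
Proof.
elim: b u i c => [|b ih] u i [|k c]//.
  case: c => //= _ vc u0; rewrite vc mulr1; have /andP[u1 _] := vc.
  rewrite -[leLHS]mul1r ler_pM ?expR_ge0//.
    by rewrite -[leLHS]expR0 ler_expR mulr_ge0 ?ler0n//; lra.
  by apply: gain_height; lra.
rewrite mulnS; case: c => [|i' [|q c]]//= [] sc /and3P[q0 h vc] u0.
rewrite /break_weight h.
set r := rho (maxn i i'); set v := u + q%:R * r.
have r0 : 0 < r := rho_gt0 _.
have qr0 : 0 < q%:R * r by rewrite mulr_gt0// ltr0n.
have v1 := valid_lt1 sc vc; rewrite -/r -/v in v1 vc.
have v0 : 0 <= v + r by rewrite /v; lra.
have IH := ih _ _ _ sc vc v0.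
rewrite mulrDl opprD expRD exprD.
set A := expR _; set B := expR _ in IH *; set D := 8^-1 ^+ _; set E := 8^-1 ^+ _ in IH *.
set K := height_weight k; set W := weight _ _ _ in IH *.
set F := expR (- _).
have AK : A <= K by apply: gain_height; rewrite /v in v1; lra.
have FF : expR (mm%:R * (1 - (v + r))) <= expR (mm%:R * (1 - u)) * F.
  rewrite -expRD ler_expR /v -mulrN -mulrDr ler_wpM2l ?ler0n//; lra.
have A0 : 0 <= A := expR_ge0 _.
have W0 : 0 <= W := weight_ge0 _ _ _.
have D0 : 0 <= D by rewrite exprn_ge0.
have -> : A * B * (D * E) = (A * D) * (B * E) by ring.
have -> : expR (mm%:R * (1 - u)) * (K * (D * F * W)) =
   (K * D) * ((expR (mm%:R * (1 - u)) * F) * W) by ring.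
apply: ler_pM; rewrite ?mulr_ge0 ?expR_ge0 ?exprn_ge0//.
  by rewrite ler_wpM2r.
by apply: le_trans IH _; rewrite ler_wpM2r.
Qed.

(** ** Summing the weights *)

Lemma nneseries_real_le (y : nat -> \bar R) (x : nat -> R) (B : R) :
  (forall i, 0 <= y i)%E -> (forall i, y i <= (x i)%:E)%E ->
  (forall N, \sum_(0 <= i < N) x i <= B) -> (\sum_(i <oo) y i <= B%:E)%E.
Proof.
move=> y0 yx xB; apply: nneseries_le => // N.
apply: (@le_trans _ _ (\sum_(0 <= i < N) (x i)%:E)%E); first exact: lee_sum.
by rewrite sumEFin lee_fin.
Qed.

Lemma geometric_sum_le (r : R) N : 0 <= r -> r < 1 ->
  \sum_(0 <= i < N) r ^+ i <= (1 - r)^-1.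
Proof.
move=> r0 r1; have r1' : 0 < 1 - r by lra.
rewrite -[leRHS]mul1r ler_pdivlMr// mulrC.
suff -> : (1 - r) * \sum_(0 <= i < N) r ^+ i = 1 - r ^+ N.
  by rewrite gerBl exprn_ge0.
elim: N => [|N ih]; first by rewrite big_geq// mulr0 expr0 subrr.
by rewrite big_nat_recr//= mulrDr ih exprS; ring.
Qed.

Lemma half_sum_le (C : R) N : 0 <= C ->
  \sum_(0 <= i < N) C * 2^-1 ^+ i <= 2 * C.
Proof.
move=> C0; rewrite -mulr_sumr mulrC ler_wpM2r//.
apply: le_trans (geometric_sum_le _ _ _) _; rewrite ?invr_ge0//; first by lra.
by rewrite [X in X^-1](_ : _ = 2^-1) ?invrK//; lra.
Qed.

Lemma sum_indicator_le (P : pred nat) D N :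
  (forall q q', P q -> P q' -> (q' <= q + D)%N) ->
  \sum_(0 <= q < N) (P q)%:R <= D.+1%:R :> R.
Proof.
move=> PD; rewrite -natr_sum ler_nat.
have -> : (\sum_(0 <= q < N) P q = size [seq q <- index_iota 0 N | P q])%N.
  by rewrite size_filter -sum1_count [RHS]big_mkcond; apply: eq_bigr => q _; case: (P q).
have [[q0 Pq0]|nP] := pselect (exists q, P q); last first.
  by rewrite (@eq_filter _ _ pred0) ?filter_pred0// => q; apply/negbTE/negP => Pq; apply: nP; exists q.
have ex : exists q, P q by exists q0.
case: (ex_minnP ex) => q1 Pq1 mq1.
rewrite -(size_iota q1 D.+1); apply: uniq_leq_size.
  by rewrite filter_uniq// iota_uniq.
move=> q; rewrite mem_filter mem_iota => /andP[Pq _].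
by rewrite mq1//= addnS ltnS PD.
Qed.

Lemma rhoE i j : (i <= j)%N -> rho i = 16 ^+ (j - i) * rho j.
Proof.
move=> ij; rewrite /rho -(subnK ij) exprD addnK.
by field; rewrite ?expf_neq0 ?pnatr_eq0 -?lt0n ?n0 ?mm0.
Qed.

(** A piece of scale [i > 0] is at most [256 * rho i] long, which limits [q];
    for a piece of scale 0 the exponential weight gives a geometric series. *)
Lemma break_weight_sum i i' N :
  \sum_(0 <= q < N) break_weight i i' q <= 257 * n%:R * 2 ^+ i' * 8^-1 ^+ i.
Proof.
have nR : 1 <= n%:R :> R by rewrite ler1n.
have [->|i0] := eqVneq i 0%N.
  rewrite expr0 mulr1.
  pose s := mm%:R * rho i'; pose r := expR (- s).
  have s0 : 0 < s by rewrite mulr_gt0 ?rho_gt0 ?ltr0n.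
  have r1 : r < 1 by rewrite /r -[ltRHS]expR0 ltr_expR oppr_lt0.
  have sE : s^-1 = 16 * n%:R * 16 ^+ i'.
    by rewrite /s /rho; field; rewrite ?expf_neq0 ?pnatr_eq0 -?lt0n ?n0 ?mm0.
  have rs : (1 - r)^-1 <= 1 + s^-1.
    have s1 : 1 + s <= expR s := expR_ge1Dx s.
    have e0 : 0 < 1 + s by lra.
    have rs : r <= (1 + s)^-1 by rewrite /r expRN lef_pV2 ?posrE ?expR_gt0.
    have : s / (1 + s) <= 1 - r.
      rewrite (_ : s / (1 + s) = 1 - (1 + s)^-1); first by lra.
      by field; rewrite gt_eqF.
    have ss0 : 0 < s / (1 + s) by rewrite divr_gt0.
    move=> sr; apply: (@le_trans _ _ (s / (1 + s))^-1).
      by rewrite lef_pV2 ?posrE ?subr_gt0.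
    by rewrite (_ : (s / (1 + s))^-1 = 1 + s^-1)//; field; rewrite !gt_eqF.
  rewrite (eq_bigr (fun q => 8^-1 ^+ i' * r ^+ q)); last first.
    move=> q _; rewrite /break_weight /= max0n; congr (_ * _).
    by rewrite /r -expRM_natl mulrN /s mulrCA.
  rewrite -mulr_sumr; apply: (@le_trans _ _ (8^-1 ^+ i' * (1 + s^-1))).
    rewrite ler_wpM2l ?exprn_ge0//.
    by apply: le_trans rs; apply: geometric_sum_le => //; exact: expR_ge0.
  rewrite sE (_ : (16 : R) = 8 * 2); last by ring.
  rewrite [in X in 1 + X]exprMn mulrDr mulr1 exprVn.
  have e8 : (8 : R) ^+ i' != 0 by rewrite expf_neq0.
  have -> : (8 ^+ i')^-1 * (8 * 2 * n%:R * (8 ^+ i' * 2 ^+ i')) =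
    16 * n%:R * 2 ^+ i' :> R by field.
  have h1 : 1 <= (2 : R) ^+ i' by rewrite exprn_ege1// ler1n.
  have h2 : (8 ^+ i')^-1 <= 1 :> R by rewrite invf_le1 ?exprn_gt0// exprn_ege1// ler1n.
  have h3 : 1 <= n%:R * 2 ^+ i' :> R by rewrite -[leLHS]mul1r ler_pM.
  by lra.
set x := maxn i i'.
pose D := (256 * 16 ^ (x - i))%N.
pose P q := q%:R * rho x <= 256 * rho i.
have PD q q' : P q -> P q' -> (q' <= q + D)%N.
  move=> _; rewrite /P (rhoE (leq_maxl i i')) -/x mulrA ler_pM2r ?rho_gt0//.
  by rewrite -natrX -natrM ler_nat => h; exact: leq_trans h (leq_addl _ _).
apply: (@le_trans _ _ (\sum_(0 <= q < N) 8^-1 ^+ x * (P q)%:R)).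
  apply: ler_sum => q _; rewrite /break_weight (negbTE i0) /= -/x -/(P q).
  case: (P q); rewrite ?mulr0// mulr1 ler_piMr ?exprn_ge0//.
  by rewrite -[leRHS]expR0 ler_expR oppr_le0 !mulr_ge0 ?ler0n// ltW ?rho_gt0.
rewrite -mulr_sumr; apply: (@le_trans _ _ (8^-1 ^+ x * D.+1%:R)).
  by rewrite ler_wpM2l ?exprn_ge0// sum_indicator_le.
apply: (@le_trans _ _ (8^-1 ^+ x * (257 * 16 ^+ (x - i)))).
  rewrite ler_wpM2l ?exprn_ge0// -natrX -natrM ler_nat.
  by rewrite [X in (_ <= X)%N](_ : _ = 16 ^ (x - i) + D)%N -?[X in (X <= _)%N]add1n ?leq_add2r ?expn_gt0// /D -mulSn.
rewrite mulrCA -!mulrA ler_pM2l ?ltr0n//.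
have [y [xE yi']] : exists y, x = (i + y)%N /\ (y <= i')%N.
  exists (x - i)%N; split; first by rewrite subnKC// leq_maxl.
  by rewrite leq_subLR geq_max leq_addr leq_addl.
have e2 : 8^-1 ^+ y * 16 ^+ y = 2 ^+ y :> R.
  by rewrite -exprMn; congr (_ ^+ _); lra.
rewrite xE addKn exprD -mulrA e2 mulrA [leRHS]mulrC.
apply: ler_wpM2l; first by rewrite exprn_ge0.
apply: (@le_trans _ _ (2 ^+ i')); first by rewrite ler_weXn2l// ler1n.
by rewrite ler_peMl// exprn_ge0.
Qed.

Definition last_ok (u : R) (i : nat) : bool :=
  (u < 1) && ((i == 0%N) || (1 - u <= 256 * rho i)).

(** The condition that the last piece ends at 1 and fits its scale leaves at
    most 257 positions for the break point before it, hence the decay in [i']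
    that [break_weight_sum] alone does not give. *)
Lemma last_break_sum u i i' N :
  \sum_(0 <= q < N) break_weight i i' q *
     (last_ok (u + q%:R * rho (maxn i i') + rho (maxn i i')) i')%:R <=
  257 * n%:R * 4^-1 ^+ i * 2^-1 ^+ i'.
Proof.
have nR : 1 <= n%:R :> R by rewrite ler1n.
have e48 : 8^-1 ^+ i <= 4^-1 ^+ i :> R.
  by rewrite lerXn2r ?nnegrE ?invr_ge0// lef_pV2 ?posrE//; lra.
have [->|i'0] := eqVneq i' 0%N.
  rewrite expr0 mulr1; have := break_weight_sum i 0 N; rewrite expr0 mulr1 => h.
  apply: le_trans (le_trans h _).
    apply: ler_sum => q _; rewrite ler_piMr ?break_weight_ge0//.
    by case: last_ok.
  by rewrite ler_wpM2l ?mulr_ge0.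
set x := maxn i i'.
pose P q := ((i == 0%N) || (q%:R * rho x <= 256 * rho i)) &&
  last_ok (u + q%:R * rho x + rho x) i'.
have r0 := rho_gt0 x.
have PD q q' : P q -> P q' -> (q' <= q + 256)%N.
  rewrite /P /last_ok (negbTE i'0)/=.
  have [ii'|i'i] := leqP i i'.
    have -> : x = i' by apply/maxn_idPr.
    have r0' := rho_gt0 i'.
    move=> /andP[_ /andP[_ h]] /andP[_ /andP[h' _]].
    rewrite -(ler_nat R) natrD -(ler_pM2r r0') mulrDl; lra.
  have -> : x = i by apply/maxn_idPl/ltnW.
  have r0' := rho_gt0 i.
  move=> _ /andP[+ _]; rewrite gtn_eqF; last by rewrite (leq_ltn_trans _ i'i).
  by rewrite /= ler_pM2r// ler_nat => h; exact: leq_trans h (leq_addl _ _).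
apply: (@le_trans _ _ (\sum_(0 <= q < N) 8^-1 ^+ x * (P q)%:R)).
  apply: ler_sum => q _; rewrite /break_weight -/x /P.
  case: ifP => _ /=; last by rewrite mul0r mulr0.
  case: last_ok; rewrite ?mulr0// !mulr1 ler_piMr ?exprn_ge0//.
  by rewrite -[leRHS]expR0 ler_expR oppr_le0 !mulr_ge0 ?ler0n// ltW ?rho_gt0.
rewrite -mulr_sumr; apply: (@le_trans _ _ (8^-1 ^+ x * 257)).
  by rewrite ler_wpM2l ?exprn_ge0// sum_indicator_le.
have : 8^-1 ^+ x <= 4^-1 ^+ i * 2^-1 ^+ i' :> R.
  have -> : (8^-1 : R) = 4^-1 * 2^-1 by lra.
  rewrite exprMn; apply: ler_pM; rewrite ?exprn_ge0 ?invr_ge0//.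
    by rewrite ler_wiXn2l ?invr_ge0 ?leq_maxl//; lra.
  by rewrite ler_wiXn2l ?invr_ge0 ?leq_maxr//; lra.
set y := 8^-1 ^+ x; set z := 4^-1 ^+ i * _ => yz.
have z0 : 0 <= z by rewrite mulr_ge0 ?exprn_ge0.
rewrite -[leRHS]mulrA -/z.
have : z <= n%:R * z by rewrite ler_peMl.
by lra.
Qed.

Variable K : R.
Hypothesis hK : forall N, \sum_(0 <= k < N) height_weight k <= K.

Lemma K_ge0 : 0 <= K.
Proof. by have := hK 0; rewrite big_geq. Qed.

Definition weight_sum b u i : \bar R :=
  seq_sum (3 * b).+1 (fun c => (weight u i c)%:E).

Lemma weight_sum_ge0 b u i : (0 <= weight_sum b u i)%E.
Proof. by apply: seq_sum_ge0 => c _; rewrite lee_fin weight_ge0. Qed.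

Lemma weight_sum0 u i : (weight_sum 0 u i <= (K * (last_ok u i)%:R)%:E)%E.
Proof.
rewrite /weight_sum muln0 /=.
apply: (@nneseries_real_le _ (fun k => height_weight k * (last_ok u i)%:R)).
- by move=> k; rewrite lee_fin (weight_ge0 u i [:: k]).
- by move=> k; rewrite -/(last_ok u i); case: last_ok; rewrite ?mulr1 ?mulr0.
- by move=> N; rewrite -mulr_suml ler_wpM2r.
Qed.

(** [w i' q] bounds the sum over the rest of the code, [x i'] the sum over the
    positions of the break point, and [X] the sum over the scales. *)
Lemma weight_sumS b u i (w : nat -> nat -> R) (x : nat -> R) (X : R) :
  (forall i' q, 0 <= w i' q) -> 0 <= X ->
  (forall i' q, (weight_sum b (u + q%:R * rho (maxn i i') + rho (maxn i i')) i'
     <= (w i' q)%:E)%E) ->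
  (forall i' N, \sum_(0 <= q < N) break_weight i i' q * w i' q <= x i') ->
  (forall N, \sum_(0 <= i' < N) x i' <= X) ->
  (weight_sum b.+1 u i <= (K * X)%:E)%E.
Proof.
move=> w0 X0 Vw wx xX.
pose W i' q := weight_sum b (u + q%:R * rho (maxn i i') + rho (maxn i i')) i'.
have W0 i' q : (0 <= W i' q)%E by exact: weight_sum_ge0.
have -> : weight_sum b.+1 u i = (\sum_(k <oo) ((height_weight k)%:E *
   \sum_(i' <oo) \sum_(q <oo) ((break_weight i i' q)%:E * W i' q)))%E.
  transitivity (\sum_(k <oo) \sum_(i' <oo) \sum_(q <oo) seq_sum (3 * b).+1
      (fun c => (weight u i [:: k, i', q & c])%:E))%E.
    by rewrite /weight_sum (_ : (3 * b.+1).+1 = (3 * b).+4)//; lia.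
  apply: eq_eseriesr => k _.
  rewrite -nneseriesZl; last first.
    move=> i' _; apply: nneseries_ge0 => q _ _.
    by rewrite mule_ge0// lee_fin break_weight_ge0.
  apply: eq_eseriesr => i' _; rewrite -nneseriesZl; last first.
    by move=> q _; rewrite mule_ge0// lee_fin break_weight_ge0.
  apply: eq_eseriesr => q _.
  rewrite muleA -EFinM -(@seq_sumZl _ (3 * b).+1); last first.
    by move=> c _; rewrite lee_fin weight_ge0.
  apply: eq_seq_sum => c _; rewrite -EFinM.
  by rewrite -[weight u i _]/(height_weight k * (break_weight i i' q *
    weight (u + q%:R * rho (maxn i i') + rho (maxn i i')) i' c)) mulrA.
have S0 i' : (0 <= \sum_(q <oo) ((break_weight i i' q)%:E * W i' q))%E.
  by apply: nneseries_ge0 => q _ _; rewrite mule_ge0// lee_fin break_weight_ge0.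
have Sx i' : (\sum_(q <oo) ((break_weight i i' q)%:E * W i' q) <= (x i')%:E)%E.
  apply: (@nneseries_real_le _ (fun q => break_weight i i' q * w i' q)) => //.
    by move=> q; rewrite mule_ge0// lee_fin break_weight_ge0.
  by move=> q; rewrite EFinM lee_wpmul2l ?lee_fin ?break_weight_ge0//; exact: Vw.
have SX : (\sum_(i' <oo) \sum_(q <oo) ((break_weight i i' q)%:E * W i' q) <= X%:E)%E.
  exact: (@nneseries_real_le _ x).
apply: (@nneseries_real_le _ (fun k => height_weight k * X)).
- move=> k; rewrite mule_ge0 ?lee_fin ?height_weight_ge0//.
  exact: nneseries_ge0.
- by move=> k; rewrite EFinM lee_wpmul2l// lee_fin height_weight_ge0.
- by move=> N; rewrite -mulr_suml ler_wpM2r.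
Qed.

(** [B] stands for [257 * n]. *)
Section BreakBound.
Variable B : R.
Hypothesis B0 : 0 <= B.
Hypothesis hB : forall i i' N,
  \sum_(0 <= q < N) break_weight i i' q <= B * 2 ^+ i' * 8^-1 ^+ i.
Hypothesis hlB : forall u i i' N,
  \sum_(0 <= q < N) break_weight i i' q *
     (last_ok (u + q%:R * rho (maxn i i') + rho (maxn i i')) i')%:R <=
  B * 4^-1 ^+ i * 2^-1 ^+ i'.

(** The factor [2 ^+ i'] of the sum over the positions of a break point is
    absorbed by the decay [4^-1 ^+ i'] of the sum over the rest of the code,
    leaving a geometric series over [i']; the last break point starts the
    induction. *)
Lemma weight_sum_le b u i :
  (weight_sum b.+1 u i <= (K * (2 * B * K) ^+ b.+1 * 4^-1 ^+ i)%:E)%E.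
Proof.
have K0 := K_ge0.
have p4 j : 0 <= 4^-1 ^+ j :> R by rewrite exprn_ge0.
have p2 j : 0 <= 2^-1 ^+ j :> R by rewrite exprn_ge0.
have e48 j : 8^-1 ^+ j <= 4^-1 ^+ j :> R.
  by rewrite lerXn2r ?nnegrE ?invr_ge0// lef_pV2 ?posrE//; lra.
elim: b u i => [|b ih] u i.
  have := @weight_sumS 0 u i
    (fun i' q => K * (last_ok (u + q%:R * rho (maxn i i') + rho (maxn i i')) i')%:R)
    (fun i' => (K * (B * 4^-1 ^+ i)) * 2^-1 ^+ i')
    (2 * (K * (B * 4^-1 ^+ i))).
  rewrite expr1 (_ : K * (2 * _) = K * (2 * B * K) * 4^-1 ^+ i); last by ring.
  have KB : 0 <= K * (B * 4^-1 ^+ i) by rewrite !mulr_ge0.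
  apply.
  - by move=> i' q; rewrite mulr_ge0.
  - by rewrite mulr_ge0.
  - by move=> i' q; exact: weight_sum0.
  - move=> i' N; rewrite (eq_bigr (fun q => K * (break_weight i i' q *
      (last_ok (u + q%:R * rho (maxn i i') + rho (maxn i i')) i')%:R))); last first.
      by move=> q _; rewrite mulrCA.
    by rewrite -mulr_sumr -mulrA ler_wpM2l// hlB.
  - by move=> N; exact: half_sum_le.
pose A := K * (2 * B * K) ^+ b.+1.
have A0 : 0 <= A by rewrite mulr_ge0// exprn_ge0// !mulr_ge0.
have := @weight_sumS b.+1 u i (fun i' q => A * 4^-1 ^+ i')
    (fun i' => (B * A * 4^-1 ^+ i) * 2^-1 ^+ i')
    (2 * (B * A * 4^-1 ^+ i)).
rewrite (_ : K * (2 * _) = K * (2 * B * K) ^+ b.+2 * 4^-1 ^+ i); last first.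
  by rewrite /A [in RHS]exprS; ring.
have BA j : 0 <= B * A * 4^-1 ^+ j by apply: mulr_ge0 => //; exact: mulr_ge0.
apply.
- by move=> i' q; rewrite mulr_ge0.
- by rewrite mulr_ge0.
- by move=> i' q; exact: ih.
- move=> i' N; rewrite -mulr_suml.
  apply: le_trans (ler_wpM2r _ (hB i i' N)) _; first by rewrite mulr_ge0.
  have e : 2 ^+ i' * 4^-1 ^+ i' = 2^-1 ^+ i' :> R.
    by rewrite -exprMn; congr (_ ^+ _); lra.
  have -> : B * 2 ^+ i' * 8^-1 ^+ i * (A * 4^-1 ^+ i') =
     B * A * 2^-1 ^+ i' * 8^-1 ^+ i by rewrite -e; ring.
  have -> : B * A * 4^-1 ^+ i * 2^-1 ^+ i' =
     B * A * 2^-1 ^+ i' * 4^-1 ^+ i by ring.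
  by rewrite ler_wpM2l//; apply: mulr_ge0 => //; exact: mulr_ge0.
- by move=> N; exact: half_sum_le.
Qed.

Lemma total_weight_sum_le b :
  (seq_sum (3 * b).+2 (fun c => (weight 0 (head 0%N c) (behead c))%:E) <=
   (2 * (K * (2 * B * K) ^+ b))%:E)%E.
Proof.
have K0 := K_ge0.
have p2 j : 0 <= 2^-1 ^+ j :> R by rewrite exprn_ge0.
change (\sum_(i <oo) weight_sum b 0 i <= (2 * (K * (2 * B * K) ^+ b))%:E)%E.
case: b => [|b].
  rewrite expr0 mulr1.
  apply: (@nneseries_real_le _ (fun i => K * (i <= 1)%N%:R)).
  - by move=> i; exact: weight_sum_ge0.
  - move=> i; apply: le_trans (weight_sum0 0 i) _.
    rewrite lee_fin ler_wpM2l// ler_nat /last_ok.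
    have [i1|i1] := leqP i 1; first by case: (_ && _).
    rewrite gtn_eqF ?(ltnW i1)//= (_ : (_ <= _) = false) ?andbF//; apply/negbTE; rewrite -ltNge subr0.
    apply: (@le_lt_trans _ _ (256 * rho 2)).
      by rewrite ler_pM2l// le_rho.
    rewrite /rho -ltr_pdivlMl// mulr1 ltf_pV2 ?posrE ?mulr_gt0 ?ltr0n//.
    have : 1 <= n%:R * mm%:R :> R by rewrite -natrM ler1n muln_gt0 n0.
    rewrite -mulrA; lra.
  - move=> N; rewrite -mulr_sumr [leRHS]mulrC ler_wpM2l//.
    by apply: sum_indicator_le => q q' _; lia.
have C0 : 0 <= K * (2 * B * K) ^+ b.+1 by rewrite mulr_ge0// exprn_ge0// !mulr_ge0.
apply: (@nneseries_real_le _ (fun i => K * (2 * B * K) ^+ b.+1 * 2^-1 ^+ i)).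
- by move=> i; exact: weight_sum_ge0.
- move=> i; apply: le_trans (weight_sum_le b 0 i) _.
  rewrite lee_fin ler_wpM2l//.
  by rewrite lerXn2r ?nnegrE ?invr_ge0// lef_pV2 ?posrE//; lra.
- by move=> N; exact: half_sum_le.
Qed.

End BreakBound.

Lemma total_weight_sum b :
  (seq_sum (3 * b).+2 (fun c => (weight 0 (head 0%N c) (behead c))%:E) <=
   (2 * (K * (2 * (257 * n%:R) * K) ^+ b))%:E)%E.
Proof.
apply: total_weight_sum_le.
- by rewrite mulr_ge0.
- exact: break_weight_sum.
- exact: last_break_sum.
Qed.

End Codes.

(** * The numerator of the posterior *)

Section Numerator.
Context {R : realType}.
Local Notation leb := (@lebesgue_measure R).

Lemma dens_a_integral (ga : R -> R) k (y : \bar R) :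
  probability_density ga -> (0 <= y)%E ->
  integral_seq k (fun a => (dens_a ga a)%:E * y)%E = y.
Proof.
move=> [mga ga0 iga] y0.
have mgaE : measurable_fun [set: R] (EFin \o ga) by exact/measurable_EFinP.
elim: k y y0 => [|k ih] y y0 /=; first by rewrite /dens_a big_nil mul1e.
transitivity (\int[leb]_x ((ga x)%:E * y))%E.
  apply: eq_integral => x _.
  rewrite -[in RHS](ih ((ga x)%:E * y)%E) ?mule_ge0 ?lee_fin//.
  apply: eq_integral_seq => s _.
  by rewrite /dens_a big_cons EFinM -muleA muleCA.
by rewrite ge0_integralZr// ?iga ?mul1e// => x _; rewrite lee_fin ga0.
Qed.

Lemma dens_a_ge0 (ga : R -> R) a : (forall x, 0 <= ga x) -> 0 <= dens_a ga a.
Proof. by move=> g0; rewrite /dens_a; apply: prodr_ge0. Qed.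

Lemma dens_t_ge0 (t : seq R) : 0 <= dens_t t.
Proof. by rewrite /dens_t mulr_ge0. Qed.

(** Break points at 0 or 1 have positive density, but form a null set. *)
Lemma path_dens_t (t : seq R) : dens_t t != 0 ->
  (forall x, x \in t -> ~ [set 0; 1] x) -> path <%R 0 (rcons t 1).
Proof.
rewrite /dens_t => h t01.
have {h}/andP[/allP tI st] : all (fun x => x \in `[0, 1]) t && sorted <%R t.
  by move: h; case: (_ && _) => //; rewrite mulr0 eqxx.
have t_lt x : x \in t -> 0 < x < 1.
  move=> xt; have := tI _ xt; rewrite in_itv/= !le_eqVlt => /andP[/predU1P[x0|->]].
    by have := t01 _ xt; rewrite -x0 => /(_ (or_introl erefl)).
  by move=> /predU1P[x1|//]; have := t01 _ xt; rewrite x1 => /(_ (or_intror erefl)).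
case: t st t_lt {tI t01} => [|x t] /= st t_lt; first by rewrite ltr01.
have /andP[-> _] := t_lt x (mem_head _ _).
rewrite rcons_path st/=.
by have /andP[] := t_lt (last x t) (mem_last _ _).
Qed.

Lemma ae_exists_itv (N : set R) (u v : R) : u < v -> leb N = 0%E -> measurable N ->
  exists x, [/\ u <= x, x < v & ~ N x].
Proof.
move=> uv N0 mN; apply: contrapT => h.
have sub : `[u, v[ `<=` N.
  move=> x /=; rewrite in_itv/= => /andP[ux xv]; apply: contrapT => Nx.
  by apply: h; exists x.
have : (leb `[u, v[ <= leb N)%E.
  by apply: le_measure => //; rewrite inE//; exact: measurable_itv.
by rewrite N0 lebesgue_measure_itv/= lte_fin uv -EFinB lee_fin subr_le0 leNgt uv.
Qed.

(** A piece has positive length, so it contains a point outside [N]. *)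
Lemma heights_ge (N : set R) (M p : R) (t a : seq R) :
  leb N = 0%E -> measurable N -> size a = (size t).+1 ->
  path <%R p (rcons t 1) ->
  (forall x, p <= x < 1 -> ~ N x -> - M <= step_from p t a x) ->
  forall x, x \in a -> - M <= x.
Proof.
move=> N0 mN; elim: t p a => [|t1 t ih] p [|a0 a]// [sa].
  case: a sa => // _ /= /andP[p1 _] h y; rewrite inE => /eqP ->.
  have [x [px xv Nx]] := ae_exists_itv p1 N0 mN.
  have := h x; rewrite step_from_last indic_itvco px xv mulr1.
  by apply.
move=> pth h; have /= /andP[pt pth'] := pth.
have t1_lt1 := path_le1 pth'.
move=> y; rewrite inE => /predU1P[->|]; last first.
  apply: (ih t1) => // x /andP[tx x1] Nx.
  have := h x; rewrite step_from_tail//; apply => //.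
  by rewrite x1 (le_trans (ltW pt) tx).
have [x [px xv Nx]] := ae_exists_itv pt N0 mN.
have pxt : p <= x < t1 by rewrite px.
have := h x; rewrite step_from_head//; apply => //.
by rewrite px (lt_trans xv t1_lt1).
Qed.

Lemma likelihood_step n (pts : nat -> R * R) (t a : seq R) :
  size a = (size t).+1 -> path <%R 0 (rcons t 1) ->
  likelihood n pts (step_fun t a) = (expR (n%:R * area 0 t a) *
    `[< forall i, (step_fun t a (pts i).1 <= (pts i).2)%R >]%:R)%:E.
Proof.
move=> sa pth; rewrite /likelihood intI_closed; last exact: bounded_step_from.
by rewrite intI_step_from.
Qed.

Variables (n b : nat) (M T : R) (h0 ga : R -> R).
Local Notation mm := b.+1.
Hypotheses (n0 : (0 < n)%N) (M0 : 0 <= M).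
Hypotheses (mh0 : measurable_fun [set: R] h0) (h0M : forall x, `|h0 x| <= M).
Hypothesis dga : probability_density ga.
Variable B : set (R -> R).
Hypothesis hB : forall t a, size a = (size t).+1 -> path <%R 0 (rcons t 1) ->
  B (step_fun t a) -> le01 h0 (step_fun t a) /\
  T <= n%:R * (area 0 t a - intI h0 0 1).

Definition log_bound (c : seq nat) : R :=
  8 / 7 * total_gain n mm M h0 0 (head 0%N c) (behead c) + (M + 2) * mm%:R.

(** Bounds the factorial in [dens_t] times the likelihood, relative to
    [expR (n * intI h0 0 1)], of the functions in [B] with code [c] on the event
    that no point lies below the level of [c]. *)
Definition code_mass (c : seq nat) : R :=
  if valid n mm (0 : R) (head 0%N c) (behead c) && (T <= log_bound c)
  then b`!%:R * expR (log_bound c) else 0.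

Definition code_level (c : seq nat) : R -> R :=
  level n mm M 0 (head 0%N c) (behead c).

Definition code_vol (c : seq nat) : R := vol n mm (head 0%N c) (behead c).

Definition respects (pts : nat -> R * R) (l : R -> R) : R :=
  `[< forall i, (l (pts i).1 <= (pts i).2)%R >]%:R.

Lemma respects_ge0 pts l : 0 <= respects pts l. Proof. exact: ler0n. Qed.

Lemma code_mass_ge0 c : 0 <= code_mass c.
Proof. by rewrite /code_mass; case: ifP => // _; rewrite mulr_ge0 ?expR_ge0. Qed.

Lemma code_vol_ge0 c : 0 <= code_vol c.
Proof. exact: vol_ge0. Qed.

(** A step function vanishes at 1, and so does not bound a level above [-M] there. *)
Lemma level_at1 (u : R) i b' c : size c = (3 * b').+1 -> valid n mm u i c ->
  level n mm M u i c 1 = - M.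
Proof.
elim: b' u i c => [|b' ih] u i [|k c]//.
  by case: c => //= _ /andP[u1 _]; rewrite ltNge (ltW u1)/= ltxx.
rewrite mulnS; case: c => [|i' [|q c]]//= [] sc /and3P[_ _ vc].
have v1 := valid_lt1 n0 (ltn0Sn b) sc vc.
rewrite (ih _ _ _ sc vc); case: ifP => // _; case: ifP => //.
rewrite ltNge => /negP[]; apply: le_trans (ltW v1).
by rewrite lerDl ltW// rho_gt0.
Qed.

Variable pts : nat -> R * R.
Hypothesis pts01 : forall i, (pts i).1 \in `[0, 1].

(** The code of the step function itself is one of the terms of the sum. *)
Lemma likelihood_le_codes t a : size t = b -> size a = mm ->
  path <%R 0 (rcons t 1) ->
  ((b`!%:R)%:E * ((\1_B (step_fun t a))%:E * likelihood n pts (step_fun t a)) <=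
  (expR (n%:R * intI h0 0 1))%:E * seq_sum (3 * b).+2 (fun c =>
    (code_mass c * respects pts (code_level c))%:E *
    prodf (cells n mm 0 (head 0%N c) (behead c)) t))%E.
Proof.
move=> st sa pth.
have sat : size a = (size t).+1 by rewrite sa st.
have S0 s : (0 <= (code_mass s * respects pts (code_level s))%:E *
    prodf (cells n mm 0 (head 0%N s) (behead s)) t)%E.
  rewrite mule_ge0// ?lee_fin ?mulr_ge0 ?code_mass_ge0 ?respects_ge0//.
  apply: prodf_ge0 => f fi x.
  exact: (cells_prop fi).2.
have S0' : (0 <= (expR (n%:R * intI h0 0 1))%:E * seq_sum (3 * b).+2 (fun c =>
    (code_mass c * respects pts (code_level c))%:E *
    prodf (cells n mm 0 (head 0%N c) (behead c)) t))%E.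
  by rewrite mule_ge0 ?lee_fin ?expR_ge0//; exact: seq_sum_ge0.
rewrite likelihood_step// indicE.
have [/set_mem Bf|] := boolP (step_fun t a \in B); last by rewrite mul0e mule0.
have [le0f Tle] := hB sat pth Bf.
case: asboolP => [fY|_]; last by rewrite mulr0 !mule0.
rewrite mulr1 mul1e.
have aM : forall x, x \in a -> - M <= x.
  have [N [mN N0 sN]] := le0f.
  apply: (@heights_ge N M 0 t a) => // x x01 Nx.
  have : h0 x <= step_from 0 t a x.
    have : ~ ~ (x \in `[0, 1] -> h0 x <= step_fun t a x).
      by move=> hx; apply: Nx; apply: sN => /=.
    move/contrapT; apply; rewrite in_itv/=.
    by case/andP: x01 => -> /ltW.
  by have := h0M x; rewrite ler_norml => /andP[h1 _]; exact: le_trans h1.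
have l0 : 0 < head 1 t - 0.
  by rewrite subr0; case: (t) pth => [|t1 t'] /= /andP[].
have [i [li1 li2]] := @scale_exists _ n mm n0 isT _ l0.
have [|c [sc vc pc lc ac]] :=
  @area_bound _ n mm M h0 n0 isT M0 mh0 h0M b 0 0 i t a st sa pth aM li1 li2.
  by rewrite lexx add0r ltW// rho_gt0.
have sic : size (i :: c) = (3 * b).+2 by rewrite /= sc.
have := @seq_sum_term _ (i :: c) (fun c =>
    (code_mass c * respects pts (code_level c))%:E *
    prodf (cells n mm 0 (head 0%N c) (behead c)) t)%E (fun s _ => S0 s).
rewrite sic => h.
rewrite [prodf _ t]pc mule1 in h.
apply: le_trans (lee_wpmul2l _ h); last by rewrite lee_fin expR_ge0.
have Tc : n%:R * (area 0 t a - intI h0 0 1) <= log_bound (i :: c).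
  by rewrite sa in ac; exact: ac.
have cm : code_mass (i :: c) = b`!%:R * expR (log_bound (i :: c)).
  by rewrite /code_mass (le_trans Tle Tc) andbT [valid _ _ _ _ _]vc.
rewrite cm.
have -> : respects pts (code_level (i :: c)) = 1.
  rewrite /respects; case: asboolP => // -[] j; apply: le_trans (fY j).
  have := pts01 j; rewrite in_itv/= => /andP[x0 x1].
  move: x1; rewrite le_eqVlt => /predU1P[->|x1]; last by apply: lc; rewrite x0.
  rewrite [leRHS]step_from_right//.
  by rewrite [leLHS](level_at1 sc vc) oppr_le0.
rewrite mulr1 -!EFinM lee_fin mulrCA ler_wpM2l// -expRD ler_expR.
by rewrite -lerBlDl -mulrBr.
Qed.

(** The bound by codes is free of the heights, whose density integrates to 1,
    and depends on the break points only through indicators of cells. *)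
Lemma numerator_le :
  (integral_seq b (fun t => (dens_t t)%:E * integral_seq mm (fun a =>
     (dens_a ga a)%:E * ((\1_B (step_fun t a))%:E *
       likelihood n pts (step_fun t a)))) <=
  (expR (n%:R * intI h0 0 1))%:E * seq_sum (3 * b).+2 (fun c =>
    (code_mass c * code_vol c)%:E * (respects pts (code_level c))%:E))%E.
Proof.
pose S t := seq_sum (3 * b).+2 (fun c =>
    (code_mass c * respects pts (code_level c))%:E *
    prodf (cells n mm 0 (head 0%N c) (behead c)) t)%E.
have ga0 : forall x, 0 <= ga x by case: dga.
have S0 t : (0 <= S t)%E.
  apply: seq_sum_ge0 => s _.
  rewrite mule_ge0// ?lee_fin ?mulr_ge0 ?code_mass_ge0 ?respects_ge0//.
  by apply: prodf_ge0 => f fi x; exact: (cells_prop fi).2.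
have e0 : 0 <= expR (n%:R * intI h0 0 1) := expR_ge0 _.
have L0 f : (0 <= (\1_B f)%:E * likelihood n pts f)%E.
  by rewrite mule_ge0 ?lee_fin// mulr_ge0 ?expR_ge0.
have inner0 t : (0 <= integral_seq mm (fun a =>
     (dens_a ga a)%:E * ((\1_B (step_fun t a))%:E *
       likelihood n pts (step_fun t a))))%E.
  by apply: integral_seq_ge0 => a _; rewrite mule_ge0// lee_fin dens_a_ge0.
apply: (@le_trans _ _ (integral_seq b (fun t =>
    (expR (n%:R * intI h0 0 1))%:E * S t)%E)).
  apply: (@le_integral_seq_ae _ b [set 0; 1]) => //.
  - by apply: measurableU; exact: measurable_set1.
  - apply/eqP; rewrite eq_le measure_ge0 andbT.
    apply: le_trans (measureU2 _ _ _) _ => //.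
    apply: (@le_trans _ _ (0 + 0)%E); last by rewrite adde0.
    by apply: leeD; rewrite le_eqVlt; apply/orP; left; apply/eqP;
      exact: lebesgue_measure_set1.
  - by move=> t _; rewrite mule_ge0// lee_fin dens_t_ge0.
  - by move=> t _; rewrite mule_ge0// lee_fin.
  move=> t st t01.
  have [->|dt0] := eqVneq (dens_t t) 0; first by rewrite mul0e mule_ge0// lee_fin.
  have pth := path_dens_t dt0 t01.
  have dt : dens_t t <= b`!%:R.
    rewrite /dens_t st ler_piMr//.
    by case: (_ && _).
  apply: (@le_trans _ _ ((b`!%:R)%:E * integral_seq mm (fun a =>
     (dens_a ga a)%:E * ((\1_B (step_fun t a))%:E *
       likelihood n pts (step_fun t a))))%E).
    by rewrite lee_wpmul2r// lee_fin.
  have f0 : 0 < b`!%:R :> R by rewrite ltr0n fact_gt0.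
  have F0 : (0 <= (b`!%:R^-1)%:E * ((expR (n%:R * intI h0 0 1))%:E * S t))%E.
    by rewrite mule_ge0 ?lee_fin ?invr_ge0// mule_ge0// lee_fin.
  rewrite -lee_pdivlMl//.
  rewrite -[leRHS](@dens_a_integral ga mm _ dga F0).
  apply: le_integral_seq => a sa.
  - by rewrite mule_ge0// lee_fin dens_a_ge0.
  - by rewrite mule_ge0// lee_fin dens_a_ge0.
  rewrite lee_wpmul2l ?lee_fin ?dens_a_ge0//.
  by rewrite lee_pdivlMl//; exact: likelihood_le_codes.
rewrite (@eq_integral_seq _ _ _ (fun t => seq_sum (3 * b).+2 (fun c =>
   ((expR (n%:R * intI h0 0 1))%:E * (code_mass c * respects pts (code_level c))%:E) *
    prodf (cells n mm 0 (head 0%N c) (behead c)) t)%E)); last first.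
  move=> t _; rewrite /S -seq_sumZl.
    by apply: eq_seq_sum => c _; rewrite muleA.
  move=> s _.
  rewrite mule_ge0// ?lee_fin ?mulr_ge0 ?code_mass_ge0 ?respects_ge0//.
  by apply: prodf_ge0 => f fi x; exact: (cells_prop fi).2.
rewrite (integral_seq_seq_sum (b := b)); last 3 first.
- move=> c _; rewrite mule_ge0 ?lee_fin// mulr_ge0 ?code_mass_ge0 ?respects_ge0//.
- by move=> [|i c]//= [sc]; exact: size_cells.
- by move=> c _ f; exact: cells_prop.
rewrite -seq_sumZl; last first.
  by move=> c _; rewrite mule_ge0 ?lee_fin ?mulr_ge0 ?code_mass_ge0 ?code_vol_ge0 ?respects_ge0.
rewrite le_eqVlt; apply/orP; left; apply/eqP; apply: eq_seq_sum => -[|i c]//= [sc].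
rewrite (cells_vol n0 (ltn0Sn b) _ _ sc) -!EFinM; congr (_%:E).
by rewrite /code_vol /=; ring.
Qed.

Definition code_excess (c : seq nat) : R :=
  intI (fun x => Num.max 0 (code_level c x - h0 x)) 0 1.

Lemma fact_le_expn k : (k`! <= k.+1 ^ k)%N.
Proof.
elim: k => // k ih; rewrite factS expnS leq_mul//.
by case: k ih => // k ih; apply: leq_trans ih _; rewrite leq_exp2r.
Qed.

Lemma min1_pow4 (y s : R) : 0 <= s -> y <= s ^+ 4 -> Num.min 1 y <= s ^+ 3.
Proof.
move=> s0 ys; have [s1|s1] := leP s 1.
  rewrite ge_min; apply/orP; right; apply: le_trans ys _.
  by rewrite exprS ler_piMl// exprn_ge0.
by rewrite ge_min exprn_ege1// ltW.
Qed.

(** By [min1_pow4] the truncated mass is at most its power [3/4], which leaves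
    [expR (- G / 7)] of the void probability.  The code has mass 0 unless
    [T <= 8/7 * G + (M + 2) * pieces], so half of it is at most
    [expR (- T / 16)] up to a factor exponential in the number of pieces. *)
Lemma code_weight (k : R) c : size c = (3 * b).+2 ->
  Num.min 1 (expR k * (code_mass c * code_vol c)) *
    expR (- (n%:R * code_excess c)) <=
  expR (3 / 4 * k + (M + 3) * mm%:R - T / 16) *
    weight n mm M 0 (head 0%N c) (behead c).
Proof.
case: c => [|i c]// [sc].
have W0 : 0 <= expR (3 / 4 * k + (M + 3) * mm%:R - T / 16) *
    weight n mm M 0 (head 0%N (i :: c)) (behead (i :: c)).
  by rewrite mulr_ge0 ?expR_ge0//; exact: weight_ge0.
rewrite /code_mass; case: ifP => [/andP[vc Tc]|_]; last first.
  by rewrite mul0r mulr0 min_r ?mul0r.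
set G := total_gain n mm M h0 0 (head 0%N (i :: c)) (behead (i :: c)).
set L := log_bound (i :: c) in Tc *.
have LE : L = 8 / 7 * G + (M + 2) * mm%:R by [].
set d := depth i c.
have vd := @vol_depth R n mm n0 (ltn0Sn b) b i c sc; rewrite -/d in vd.
pose s := expR ((k + L) / 4) * 2^-1 ^+ d.
have s0 : 0 <= s by rewrite mulr_ge0 ?expR_ge0 ?exprn_ge0.
have h1 : Num.min 1 (expR k * (b`!%:R * expR L * code_vol (i :: c))) <= s ^+ 3.
  apply: min1_pow4 => //.
  have -> : s ^+ 4 = expR (k + L) * 16^-1 ^+ d.
    rewrite /s exprMn -exprM mulnC exprM -expRM_natl; congr (expR _ * _ ^+ _); lra.
  rewrite expRD (_ : _ * (_ * _) = expR k * expR L * (b`!%:R * code_vol (i :: c))); last by ring.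
  rewrite ler_wpM2l ?mulr_ge0 ?expR_ge0//; apply: le_trans vd.
  by rewrite ler_wpM2r ?code_vol_ge0// -natrX ler_nat fact_le_expn.
have s3 : s ^+ 3 = expR (3 / 4 * (k + L)) * 8^-1 ^+ d.
  rewrite /s exprMn -exprM mulnC exprM -expRM_natl; congr (expR _ * _ ^+ _); lra.
have h2 : expR (- (n%:R * code_excess (i :: c))) <= expR (- G).
  by rewrite ler_expR lerN2; exact: (total_gain_excess n0 (ltn0Sn b) mh0 h0M sc vc).
have h3 := @weight_bound _ n mm M h0 n0 (ltn0Sn b) M0 b 0 i c sc vc (lexx _).
rewrite subr0 mulr1 -/G -/d in h3.
apply: (@le_trans _ _ (s ^+ 3 * expR (- G))).
  apply: ler_pM => //; rewrite ?expR_ge0// le_min ler01 mulr_ge0 ?expR_ge0//.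
  by rewrite mulr_ge0 ?code_vol_ge0// mulr_ge0 ?expR_ge0.
rewrite s3 mulrAC -expRD.
apply: (@le_trans _ _ (expR (3 / 4 * k + (M + 2) * mm%:R - T / 16) *
    (expR (- (G / 14)) * 8^-1 ^+ d))).
  rewrite mulrA -expRD ler_wpM2r ?exprn_ge0// ler_expR.
  have : 0 <= (M + 2) * mm%:R by rewrite mulr_ge0// addr_ge0.
  by rewrite LE in Tc *; lra.
apply: le_trans (ler_wpM2l (expR_ge0 _) h3) _.
rewrite mulrA -expRD le_eqVlt; apply/orP; left; apply/eqP.
congr (expR _ * _); rewrite /=; lra.
Qed.

End Numerator.

(** * The denominator of the posterior *)

Section Denominator.
Context {R : realType}.
Local Notation leb := (@lebesgue_measure R).

Lemma in_map_fun (A B : Type) (F : A -> B) (K : seq A) f :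
  List.In f (map F K) -> exists k, f = F k.
Proof. by elim: K => //= k K ih [<-|/ih//]; exists k. Qed.

Lemma prodf_box (A : Type) (w : R -> R) (I : A -> set R) K t :
  size t = size K ->
  prodf (map (fun k x => (w x * \1_(I k) x)%:E) K) t =
  (if all2 (fun k x => x \in I k) K t then \prod_(x <- t) w x else 0)%:E.
Proof.
elim: K t => [|k K ih] [|x t]//=; first by rewrite big_nil.
move=> [st]; rewrite ih// big_cons indicE.
case: (x \in I k) => /=; last by rewrite mulr0 mul0e.
by case: ifP => _; rewrite -EFinM ?mulr1// mulr0.
Qed.

Lemma all2_nth (A B : Type) (p : A -> B -> bool) K t x0 y0 j :
  all2 p K t -> (j < size K)%N -> p (nth x0 K j) (nth y0 t j).
Proof.
elim: K t j => [|k K ih] [|x t] [|j] //= /andP[]// _ h; exact: ih.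
Qed.

Lemma step_fun_const (s a : seq R) x x' : 0 <= x -> x <= x' -> x' < 1 ->
  (forall y, y \in s -> ~~ (x < y <= x')) -> step_fun s a x = step_fun s a x'.
Proof.
move=> x0 xx' x'1 ns; apply: eq_bigr => j _; congr (_ * _).
rewrite !indic_itvco; congr ((nat_of_bool _)%:R); congr andb.
  apply/idP/idP => [h|h]; first exact: le_trans xx'.
  rewrite leNgt; apply/negP => xc.
  have [jl|jl] := ltnP j (size (0 :: s)); last by move: xc; rewrite nth_default// ltNge x0.
  have := mem_nth 0 jl; rewrite inE => /predU1P[c0|cs].
    by move: xc; rewrite c0 ltNge x0.
  by have := ns _ cs; rewrite xc h.
apply/idP/idP => [h|h]; last exact: le_lt_trans h.
rewrite ltNge; apply/negP => dx.
have [jl|jl] := ltnP j (size (rcons s 1)); last first.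
  by move: h; rewrite nth_default// ltNge x0.
have := mem_nth 0 jl; rewrite mem_rcons inE => /predU1P[d1|ds].
  by move: dx; rewrite d1 leNgt x'1.
by have := ns _ ds; rewrite h dx.
Qed.

Lemma intI_sum_indic (s : seq R) (e : R) : 0 <= e ->
  intI (fun x => \sum_(y <- s) \1_(`[y - e, y + e]%classic : set R) x) 0 1 <=
  2 * e * (size s)%:R.
Proof.
move=> e0.
have bi (y : R) : bounded_measurable (\1_(`[y - e, y + e]%classic : set R) : R -> R).
  by apply: bounded_measurable_indic; exact: measurable_itv.
suff : bounded_measurable (fun x : R => \sum_(y <- s) \1_(`[y - e, y + e]%classic : set R) x) /\
  intI (fun x => \sum_(y <- s) \1_(`[y - e, y + e]%classic : set R) x) 0 1 <=
  2 * e * (size s)%:R by case.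
elim: s => [|y s [bs ih]].
  under [X in bounded_measurable X]funext do rewrite big_nil.
  split; first exact: bounded_measurable_cst.
  rewrite (@eq_intI _ _ (fun=> 0)) ?intI_cst ?mul0r ?mulr0//.
  by move=> x _; rewrite big_nil.
under [X in bounded_measurable X]funext do rewrite big_cons.
split; first exact: bounded_measurableD.
rewrite (@eq_intI _ _ (fun x => \1_(`[y - e, y + e]%classic : set R) x +
   \sum_(y <- s) \1_(`[y - e, y + e]%classic : set R) x)); last first.
  by move=> x _; rewrite big_cons.
rewrite intID// /= -[(size s).+1%:R]natr1 mulrDr mulr1 addrC lerD//.
rewrite /intI /Rintegral integral_indic//.
have ye : y - e <= y + e by lra.
have -> : 2 * e = fine (leb `[y - e, y + e]).
  rewrite lebesgue_measure_itv/= lte_fin; case: ltP => /= h; first by ring.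
  by lra.
pose I := (`[y - e, y + e]%classic : set R).
have fin2 : (leb I < +oo)%E.
  by rewrite lebesgue_measure_itv/= lte_fin; case: ifP => _; rewrite ?ltry.
have le12 : (leb (I `&` `[0%R, 1%R[) <= leb I)%E.
  have mI : measurable I by exact: measurable_itv.
  have mI' : measurable (I `&` `[0%R, 1%R[) by exact: measurableI.
  by apply: le_measure; rewrite ?inE//; exact: subIsetl.
rewrite fine_le// ge0_fin_numE ?measure_ge0//.
exact: le_lt_trans fin2.
Qed.

Variables (n : nat) (M kap : R) (ga : R -> R) (s be : seq R).
Hypotheses (n0 : (0 < n)%N) (M0 : 0 <= M) (kap0 : 0 < kap).
Hypothesis dga : probability_density ga.
Hypothesis ga_kap : forall x, x != 0 -> `|x| <= M + 1 -> kap <= ga x.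
Hypotheses (sbe : size be = (size s).+1) (pths : path <%R 0 (rcons s 1)).
Hypothesis beM : forall x, x \in be -> - M <= x <= M.

Local Notation g := (step_fun s be).

Lemma g_bound x : - M <= g x <= M.
Proof.
have z : - M <= 0 <= M by rewrite M0 oppr_le0 M0.
have [x0|x0] := ltP x 0; first by rewrite [g x]step_from_left.
have [x1|x1] := ltP x 1; last by rewrite [g x]step_from_right.
have x01 : 0 <= x < 1 by rewrite x0.
have [j jl [_ E]] := step_from_eval sbe pths x01.
by rewrite [g x]E; apply: beM; exact: mem_nth.
Qed.

Lemma s01 y : y \in s -> 0 < y < 1.
Proof.
move=> ys; have := pths; rewrite lt_path_sortedE => /andP[/allP a1 st].
have ys' : y \in rcons s 1 by rewrite mem_rcons inE ys orbT.
rewrite (a1 _ ys')/=.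
move: st; rewrite -[rcons s 1]cats1 lt_sorted_pairwise pairwise_cat => /andP[/allrelP h _].
by apply: h => //; rewrite inE.
Qed.

Definition cell_of (y : R) : nat := Num.truncn (n%:R * y).

(** The neighbours of the cell of a break point of [g] are included so that
    the break points placed in them enclose it at distance at most [2 / n]. *)
Definition marked : seq nat := [seq k <- iota 0 n |
  has (fun y => (cell_of y <= k.+1)%N && (k <= (cell_of y).+1)%N) s].

(** Restricting the break points to the middle third of a cell keeps those of
    adjacent cells apart. *)
Definition win_lo (k : nat) : R := (k%:R + 3^-1) / n%:R.
Definition win_hi (k : nat) : R := (k%:R + 2 / 3) / n%:R.

(** The [j]-th piece of a function with one break point in each window lies
    between [los`_j] and [his`_j], its hull. *)
Definition los := 0 :: map win_lo marked.
Definition his := rcons (map win_hi marked) 1.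

(** The [j]-th height is sought just below this value. *)
Definition target (j : nat) : R :=
  if has (fun y => los`_j < y < his`_j) s then - M else g los`_j.

Let nR : 0 < n%:R :> R. Proof. by rewrite ltr0n. Qed.

Lemma cell_ofP y : y \in s ->
  [/\ (cell_of y)%:R <= n%:R * y, n%:R * y < (cell_of y)%:R + 1 & (cell_of y < n)%N].
Proof.
move=> /s01/andP[y0 y1].
have h : 0 <= n%:R * y by rewrite mulr_ge0// ltW.
have /andP[h1 h2] := truncn_itv h.
split=> //; first by rewrite natr1.
by rewrite -(ltr_nat R) (le_lt_trans h1)// gtr_pMr.
Qed.

Lemma markedP k y : y \in s -> (k < n)%N -> (cell_of y <= k.+1)%N ->
  (k <= (cell_of y).+1)%N -> k \in marked.
Proof.
move=> ys kn h1 h2; rewrite mem_filter mem_iota/= add0n kn andbT.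
by apply/hasP; exists y => //; rewrite h1.
Qed.

Lemma marked_lt k : k \in marked -> (k < n)%N.
Proof. by rewrite mem_filter mem_iota => /andP[_]. Qed.

Lemma sorted_marked : sorted ltn marked.
Proof. by apply: sorted_filter; [exact: ltn_trans|exact: iota_ltn_sorted]. Qed.

Lemma size_marked : (size marked <= 3 * size s)%N.
Proof.
pose F := flatten [seq [:: (cell_of y).-1; cell_of y; (cell_of y).+1] | y <- s].
have -> : (3 * size s = size F)%N.
  by rewrite /F; elim: (s) => //= y s' ih; rewrite mulnS ih.
apply: uniq_leq_size; first by rewrite filter_uniq// iota_uniq.
move=> k; rewrite mem_filter => /andP[/hasP[y ys /andP[h1 h2]] _].
apply/flattenP; exists [:: (cell_of y).-1; cell_of y; (cell_of y).+1].
  by apply/mapP; exists y.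
by rewrite !inE; move: h1 h2; clear; lia.
Qed.

Lemma marked_mono i j : (i <= j)%N -> (j < size marked)%N ->
  (nth 0%N marked i <= nth 0%N marked j)%N.
Proof.
move=> ij jm; apply: (sorted_leq_nth leq_trans leqnn) => //.
- by apply: sub_sorted sorted_marked => a b; exact: ltnW.
- by rewrite inE (leq_ltn_trans ij).
Qed.

Lemma los_nth j : (0 < j)%N -> (j <= size marked)%N ->
  los`_j = win_lo (nth 0%N marked j.-1).
Proof. by case: j => // j _ jm; rewrite /los /= (nth_map 0%N). Qed.

Lemma his_nth j : (j < size marked)%N -> his`_j = win_hi (nth 0%N marked j).
Proof. by move=> jm; rewrite /his nth_rcons size_map jm (nth_map 0%N). Qed.

Lemma his_last : his`_(size marked) = 1.
Proof. by rewrite /his nth_rcons size_map ltnn eqxx. Qed.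

Lemma win_hi_lt1 k : (k < n)%N -> win_hi k < 1.
Proof.
move=> kn; rewrite /win_hi ltr_pdivrMr// mul1r.
have : k%:R + 1 <= n%:R :> R by rewrite natr1 ler_nat.
lra.
Qed.

(** The cell of a break point of [g] and its two neighbours are marked, and
    the windows of the neighbours enclose the hull; at the ends of [0, 1], where
    a neighbour is missing, so does the interval. *)
Lemma hull_near j y : (j <= size marked)%N -> y \in s ->
  los`_j < y < his`_j -> y - 2 / n%:R <= los`_j /\ his`_j <= y + 2 / n%:R.
Proof.
move=> jm ys /andP[ly yh].
have [q1 q2 qn] := cell_ofP ys; set q := cell_of y in q1 q2 qn.
have E x z : (x + z / n%:R) = (n%:R * x + z) / n%:R :> R.
  by rewrite mulrDl mulrAC divff ?mul1r// gt_eqF.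
split.
  have [q0|qpos] := posnP q.
    apply: (@le_trans _ _ 0).
      by rewrite -mulNr E ler_pdivrMr// mul0r; move: q2; rewrite q0; lra.
    case: (j) jm => [|j'] jm; first by rewrite /los.
    by rewrite los_nth// /win_lo divr_ge0// ?addr_ge0// ltW.
  have qin : q.-1 \in marked by apply: (markedP ys); rewrite -/q; move: qpos qn; clear; lia.
  pose i := index q.-1 marked.
  have im : (i < size marked)%N by rewrite index_mem.
  have iE : nth 0%N marked i = q.-1 by rewrite nth_index.
  have ij : (i < j)%N.
    rewrite ltnNge; apply/negP => ji.
    have jm' : (j < size marked)%N by exact: leq_ltn_trans im.
    have := marked_mono ji im; rewrite iE => h.
    move: yh; rewrite his_nth// /win_hi ltr_pdivlMr// mulrC => yh.
    have : (nth 0%N marked j)%:R + 1 <= q%:R :> R by rewrite natr1 ler_nat; move: h qpos; clear; lia.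
    lra.
  have j0 : (0 < j)%N by exact: leq_ltn_trans ij.
  rewrite los_nth// /win_lo -mulNr E ler_pM2r ?invr_gt0//.
  have h : (i <= j.-1)%N by move: ij; clear; lia.
  have jm' : (j.-1 < size marked)%N by move: j0 jm; clear; lia.
  have := marked_mono h jm'; rewrite iE => h'.
  have : q%:R <= (nth 0%N marked j.-1)%:R + 1 :> R.
    by rewrite natr1 ler_nat; move: h'; clear; lia.
  lra.
have hi1 : his`_j <= 1.
  move: jm; rewrite leq_eqVlt => /predU1P[->|jm]; first by rewrite his_last.
  by rewrite his_nth// ltW// win_hi_lt1// marked_lt// mem_nth.
have [qn1|qn1] := leqP n q.+1.
  apply: le_trans hi1 _; rewrite E ler_pdivlMr// mul1r.
  have : n%:R <= q%:R + 1 :> R by rewrite natr1 ler_nat.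
  lra.
have qin : q.+1 \in marked by apply: (markedP ys); rewrite -/q; move: qn1; clear; lia.
pose i := index q.+1 marked.
have im : (i < size marked)%N by rewrite index_mem.
have iE : nth 0%N marked i = q.+1 by rewrite nth_index.
have ij : (j <= i)%N.
  rewrite leqNgt; apply/negP => ji.
  have h : (i <= j.-1)%N by move: ji; clear; lia.
  have j0 : (0 < j)%N by exact: leq_ltn_trans ji.
  have jm' : (j.-1 < size marked)%N by move: j0 jm; clear; lia.
  have := marked_mono h jm'; rewrite iE => h'.
  move: ly; rewrite los_nth//.
  rewrite /win_lo ltr_pdivrMr// mulrC => ly.
  have : q%:R + 1 <= (nth 0%N marked j.-1)%:R :> R by rewrite natr1 ler_nat.
  lra.
rewrite his_nth ?(leq_ltn_trans ij)// /win_hi E ler_pM2r ?invr_gt0//.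
have := marked_mono ij im; rewrite iE => h.
have : (nth 0%N marked j)%:R <= q%:R + 1 :> R by rewrite natr1 ler_nat.
lra.
Qed.

Definition win (k : nat) : set R := `[win_lo k, win_hi k].
Definition height_box (j : nat) : set R := `[target j - n%:R^-1, target j].

Local Notation r := (size marked).

Section InBox.
Variables t a : seq R.
Hypotheses (st : size t = r) (sa : size a = r.+1).
Hypothesis tbox : all2 (fun k x => x \in win k) marked t.
Hypothesis abox : all2 (fun j x => x \in height_box j) (iota 0 r.+1) a.

Lemma t_win j : (j < r)%N ->
  win_lo (nth 0%N marked j) <= t`_j <= win_hi (nth 0%N marked j).
Proof.
by move=> jr; have /set_mem := all2_nth 0%N 0 tbox jr; rewrite /win/= in_itv.
Qed.

Lemma a_box j : (j < r.+1)%N -> target j - n%:R^-1 <= a`_j <= target j.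
Proof.
move=> jr.
have := @all2_nth _ _ _ _ _ 0%N 0 j abox; rewrite size_iota => /(_ jr).
by rewrite nth_iota// add0n => /set_mem; rewrite /height_box/= in_itv.
Qed.

Lemma t_in01 x : x \in t -> 0 < x < 1.
Proof.
move=> /(nthP 0)[j jt <-]; rewrite st in jt.
have /andP[h1 h2] := t_win jt; apply/andP; split.
  by apply: lt_le_trans h1; rewrite /win_lo divr_gt0// ltr_wpDl.
by apply: le_lt_trans h2 _; rewrite win_hi_lt1// marked_lt// mem_nth.
Qed.

Lemma dens_t_box : dens_t t = r`!%:R.
Proof.
rewrite /dens_t st (_ : _ && _ = true) ?mulr1//; apply/andP; split.
  by apply/allP => x /t_in01/andP[x0 x1]; rewrite in_itv/= !ltW.
apply/(sortedP 0) => j; rewrite st => jr.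
have jr' : (j < r)%N by exact: ltnW.
have /andP[_ h1] := t_win jr'; have /andP[h2 _] := t_win jr.
apply: le_lt_trans h1 (lt_le_trans _ h2).
rewrite /win_hi /win_lo ltr_pM2r ?invr_gt0//.
have := sorted_ltn_nth ltn_trans 0%N sorted_marked.
move=> /(_ j j.+1); rewrite !inE => /(_ jr' jr (ltnSn _)) h.
have : (nth 0%N marked j)%:R + 1 <= (nth 0%N marked j.+1)%:R :> R.
  by rewrite natr1 ler_nat.
lra.
Qed.

Lemma path_t : path <%R 0 (rcons t 1).
Proof.
apply: path_dens_t; first by rewrite dens_t_box pnatr_eq0 -lt0n fact_gt0.
move=> x /t_in01/andP[x0 x1] [] /= e; first by rewrite e ltxx in x0.
by rewrite e ltxx in x1.
Qed.

(** A hull that meets no break point of [g] lies in one piece of [g]; the other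
    hulls are short and near a break point of [g], where both functions are
    between [-M - 1 / n] and [M]. *)
Lemma box_approx x : 0 <= x < 1 ->
  g x - n%:R^-1 - 2 * M * \sum_(y <- s)
    \1_(`[y - 2 / n%:R, y + 2 / n%:R]%classic : set R) x
  <= step_fun t a x <= g x.
Proof.
move=> x01; have /andP[x0 x1] := x01.
have sat : size a = (size t).+1 by rewrite st.
have [j] := step_from_eval sat path_t x01.
rewrite sa => jr [/andP[tjx xtj] E]; rewrite [step_fun t a x]E.
have lox : los`_j <= x.
  apply: le_trans tjx; case: j jr {E xtj} => [|j] jr; first exact: lexx.
  rewrite los_nth//.
  by have /andP[] := t_win (jr : (j < r)%N).
have hix : x < his`_j.
  apply: lt_le_trans xtj _; rewrite nth_rcons st.
  move: jr; rewrite ltnS leq_eqVlt => /predU1P[->|jr].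
    by rewrite his_last ltnn eqxx.
  by rewrite jr his_nth//; have /andP[] := t_win jr.
have lo0 : 0 <= los`_j.
  case: (j) jr => [|j'] jr; first exact: lexx.
  rewrite los_nth//.
  by rewrite /win_lo divr_ge0 ?addr_ge0.
have /andP[h1 h2] := a_box jr.
have /andP[g1 g2] := g_bound x.
pose S := \sum_(y <- s) \1_(`[y - 2 / n%:R, y + 2 / n%:R]%classic : set R) x : R.
have S0 : 0 <= S by apply: sumr_ge0 => y _; rewrite indicE.
rewrite -/S; have MS : 0 <= M * S by rewrite mulr_ge0.
have := h1; have := h2; rewrite /target; case: ifPn => [/hasP[y ys yh]|/hasPn nh] k1 k2.
  have S1 : 1 <= S.
    rewrite /S (big_rem y)//= indicE mem_set/=; last first.
      have [//|l1 l2] := hull_near _ ys yh.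
      by rewrite in_itv/=; apply/andP; split; [exact: le_trans lox|exact/ltW/(lt_le_trans hix)].
    by rewrite lerDl sumr_ge0// => z _; rewrite indicE.
  have MS1 : M <= M * S by rewrite ler_peMr.
  by apply/andP; split; lra.
have E' : g los`_j = g x.
  apply: step_fun_const => // y ys; apply/negP => /andP[ly yx].
  by have := nh y ys; rewrite ly (le_lt_trans yx hix).
by rewrite E' in k1 k2; apply/andP; split; lra.
Qed.

Lemma box_area : n%:R * intI g 0 1 - 1 - 8 * M * (size s)%:R <= n%:R * area 0 t a.
Proof.
have sat : size a = (size t).+1 by rewrite st.
rewrite -(intI_step_from sat path_t).
have bg : bounded_measurable g := bounded_step_from 0 sbe.
have bf : bounded_measurable (step_fun t a) := bounded_step_from 0 sat.
pose S x := \sum_(y <- s) \1_(`[y - 2 / n%:R, y + 2 / n%:R]%classic : set R) x : R.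
have bS : bounded_measurable S.
  rewrite /S; elim: (s) => [|y s' ih].
    by under [X in bounded_measurable X]funext do rewrite big_nil; exact: bounded_measurable_cst.
  under [X in bounded_measurable X]funext do rewrite big_cons.
  apply: bounded_measurableD => //.
  by apply: bounded_measurable_indic; exact: measurable_itv.
have bc c := @bounded_measurable_cst R c.
have b1 : bounded_measurable (fun x => g x - n%:R^-1) by exact: bounded_measurableB.
have b2 : bounded_measurable (fun x => 2 * M * S x) by exact: (bounded_measurableM (bc (2 * M))).
have h : intI (fun x => g x - n%:R^-1 - 2 * M * S x) 0 1 <= intI (step_fun t a) 0 1.
  apply: le_intI => //; first exact: (bounded_measurableB b1).
  by move=> x x01; have /andP[] := box_approx x01.
rewrite (intIB _ _ b1 b2) (intIB _ _ bg (bc _)) intI_cst// (intIZ _ _ _ bS) subr0 mulr1 in h.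
have e0 : 0 <= 2 / n%:R :> R by rewrite divr_ge0.
have hS := intI_sum_indic s e0.
have hn : n%:R * n%:R^-1 = 1 :> R by rewrite divff// gt_eqF.
have h' := ler_wpM2l (ltW nR) h.
apply: le_trans h'.
have hS' : n%:R * intI S 0 1 <= 4 * (size s)%:R.
  apply: le_trans (ler_wpM2l (ltW nR) hS) _.
  rewrite (_ : n%:R * _ = 4 * (size s)%:R * (n%:R * n%:R^-1)); last by ring.
  by rewrite hn mulr1.
have : M * (n%:R * intI S 0 1) <= M * (4 * (size s)%:R) by rewrite ler_wpM2l.
rewrite !mulrBr hn; lra.
Qed.

End InBox.

Variable pts : nat -> R * R.
Hypothesis pts01 : forall i, (pts i).1 \in `[0, 1].
Hypothesis gpts : forall i, g (pts i).1 <= (pts i).2.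

Lemma target_bound j : - M <= target j <= M.
Proof.
rewrite /target; case: ifP => _; last exact: g_bound.
by rewrite lexx (le_trans _ M0)// oppr_le0.
Qed.

(** The density is bounded below except perhaps at 0, where monotonicity on
    the positive half-line says nothing. *)
Lemma ga_box j : ((kap / n%:R)%:E <=
  \int[leb]_x (ga x * \1_(height_box j) x)%:E)%E.
Proof.
have [mga ga0 _] := dga.
have nV : 0 < n%:R^-1 :> R by rewrite invr_gt0.
have n1 : n%:R^-1 <= 1 :> R by rewrite invf_le1// ler1n.
have -> : (kap / n%:R)%:E = (\int[leb]_x (kap * \1_(height_box j) x)%:E)%E.
  under eq_integral do rewrite EFinM.
  rewrite ge0_integralZl_EFin ?ltW//; last first.
    by apply/measurable_EFinP/measurable_indic; exact: measurable_itv.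
  rewrite integral_indic//; last exact: measurable_itv.
  have hb : leb (height_box j) = (n%:R^-1)%:E.
    rewrite /height_box lebesgue_measure_itv/= lte_fin ltrBlDr ltrDl nV -EFinB.
    by congr (_%:E); ring.
  by rewrite setIT EFinM; congr (_ * _)%E; exact/esym/hb.
have m0 : measurable [set 0 : R] by exact: measurable_set1.
have l0 : leb [set 0 : R] = 0%E by exact: lebesgue_measure_set1.
apply: (@ge0_le_integral_ae _ _ _ leb [set 0] _ _ m0 l0).
- by move=> x; rewrite lee_fin mulr_ge0// ltW.
- by move=> x; rewrite lee_fin mulr_ge0.
move=> x /eqP x0; rewrite lee_fin indicE.
have [/set_mem/=|_] := boolP (x \in height_box j); last by rewrite !mulr0.
rewrite /height_box/= in_itv/= !mulr1 => /andP[h1 h2]; apply: ga_kap => //.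
have := target_bound j; rewrite ler_norml; lra.
Qed.

Lemma denominator_ge :
  ((expR (n%:R * intI g 0 1 - 1 - 8 * M * (size s)%:R) *
     (kap / n%:R) ^+ r.+1 * ((3 * n%:R)^-1) ^+ r)%:E <=
  integral_seq r (fun t => (dens_t t)%:E * integral_seq r.+1 (fun a =>
     (dens_a ga a)%:E * likelihood n pts (step_fun t a))))%E.
Proof.
have [mga ga0 _] := dga.
set E := expR _.
have E0 : 0 <= E := expR_ge0 _.
pose ft : seq (R -> \bar R) := map (fun k x => (1 * \1_(win k) x)%:E) marked.
pose fa : seq (R -> \bar R) := map (fun j x => (ga x * \1_(height_box j) x)%:E) (iota 0 r.+1).
have pft (f : R -> \bar R) : List.In f ft -> measurable_fun [set: R] f /\ forall x, (0 <= f x)%E.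
  move=> fi; have [k ->] := in_map_fun fi; split=> [|x]; last by rewrite lee_fin mul1r.
  apply/measurable_EFinP; apply: measurable_funM; first exact: measurable_cst.
  by apply: measurable_indic; exact: measurable_itv.
have pfa (f : R -> \bar R) : List.In f fa -> measurable_fun [set: R] f /\ forall x, (0 <= f x)%E.
  move=> fi; have [k ->] := in_map_fun fi; split=> [|x]; last by rewrite lee_fin mulr_ge0.
  apply/measurable_EFinP; apply: measurable_funM => //.
  by apply: measurable_indic; exact: measurable_itv.
have sfa : size fa = r.+1 by rewrite size_map size_iota.
have sft : size ft = r by rewrite size_map.
have L0 f : (0 <= likelihood n pts f)%E by rewrite lee_fin mulr_ge0 ?expR_ge0.
have inner0 t : (0 <= integral_seq r.+1 (fun a =>
     (dens_a ga a)%:E * likelihood n pts (step_fun t a)))%E.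
  by apply: integral_seq_ge0 => a _; rewrite mule_ge0// lee_fin dens_a_ge0.
pose C := E * (kap / n%:R) ^+ r.+1.
have C0 : 0 <= C by rewrite mulr_ge0// exprn_ge0// divr_ge0// ltW.
have inner t : size t = r -> all2 (fun k x => x \in win k) marked t ->
    (C%:E <= integral_seq r.+1 (fun a =>
     (dens_a ga a)%:E * likelihood n pts (step_fun t a)))%E.
  move=> st tb.
  apply: (@le_trans _ _ (integral_seq r.+1 (fun a => E%:E * prodf fa a)%E)).
    rewrite -[X in integral_seq X _]sfa integral_seq_prodf ?lee_fin//.
    rewrite /C EFinM lee_wpmul2l ?lee_fin// /fa big_map.
    rewrite -[X in (kap / n%:R) ^+ X](size_iota 0 r.+1).
    elim: (iota 0 r.+1) => [|j l ih]; first by rewrite big_nil expr0.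
    rewrite big_cons /= exprS EFinM; apply: lee_pmul => //.
    - by rewrite lee_fin divr_ge0// ltW.
    - by rewrite lee_fin exprn_ge0// divr_ge0// ltW.
    - exact: ga_box.
  apply: le_integral_seq => a sa.
  - by rewrite mule_ge0 ?lee_fin//; apply: prodf_ge0 => f fi x; exact: (pfa f fi).2.
  - by rewrite mule_ge0// lee_fin dens_a_ge0.
  rewrite prodf_box; last by rewrite size_iota.
  case: ifPn => ab; last by rewrite mule0 mule_ge0// lee_fin dens_a_ge0.
  have sat : size a = (size t).+1 by rewrite st.
  rewrite likelihood_step//; last exact: path_t.
  rewrite -/(dens_a ga a) muleC lee_wpmul2l ?lee_fin ?dens_a_ge0// (_ : `[< _ >] = true) ?mulr1 ?ler_expR//; first exact: box_area.
  apply/asboolP => i; apply: le_trans (gpts i).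
  have := pts01 i; rewrite in_itv/= => /andP[x0].
  rewrite le_eqVlt => /predU1P[->|x1].
    by rewrite [leLHS]step_from_right ?[leRHS]step_from_right//; exact: path_t.
  have x01 : 0 <= (pts i).1 < 1 by rewrite x0.
  by have /andP[] := box_approx st sa tb ab x01.
apply: (@le_trans _ _ (integral_seq r (fun t => C%:E * prodf ft t)%E)).
  rewrite -[X in integral_seq X _]sft integral_seq_prodf ?lee_fin//.
  rewrite EFinM lee_wpmul2l ?lee_fin// /ft big_map.
  elim: (marked) => [|k l ih]; first by rewrite big_nil expr0.
  rewrite big_cons /= exprS EFinM; apply: lee_pmul => //.
  rewrite le_eqVlt; apply/orP; left; apply/eqP.
  under eq_integral do rewrite mul1r.
  rewrite integral_indic//; last exact: measurable_itv.
  have wE : leb (win k) = ((3 * n%:R)^-1)%:E.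
    rewrite /win lebesgue_measure_itv/= lte_fin /win_hi /win_lo.
    rewrite ltr_pM2r ?invr_gt0// ltrD2l (_ : _ < _)//; last by lra.
    by rewrite -EFinB; congr (_%:E); field; rewrite gt_eqF.
  by rewrite setIT; exact/esym/wE.
apply: le_integral_seq => t st.
- by rewrite mule_ge0 ?lee_fin//; apply: prodf_ge0 => f fi x; exact: (pft f fi).2.
- by rewrite mule_ge0// lee_fin dens_t_ge0.
rewrite prodf_box//; case: ifPn => tb; last first.
  by rewrite mule0 mule_ge0// lee_fin dens_t_ge0.
rewrite big1// mule1.
rewrite -[leLHS]mul1e; apply: lee_pmul => //.
  by rewrite (dens_t_box st tb) lee_fin ler1n fact_gt0.
exact: inner.
Qed.

End Denominator.

(** * Elementary estimates for the prior *)

Section Preliminaries.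
Context {R : realType}.
Local Notation leb := (@lebesgue_measure R).

Lemma ratio_le_mine (x y X : \bar R) (D : R) : 0 < D ->
  (0 <= x)%E -> (x <= y)%E -> (D%:E <= y)%E -> (x <= X)%E ->
  (x / y <= mine 1 (D^-1%:E * X))%E.
Proof.
move=> D0 x0 xy Dy xX.
have y0 : (0 < y)%E by apply: lt_le_trans Dy; rewrite lte_fin.
have yD : (y^-1 <= D^-1%:E)%E.
  have -> : (D^-1%:E = (D%:E)^-1)%E by rewrite inver gt_eqF.
  by rewrite lee_pV2// inE ltW// lte_fin.
have yV0 : (0 <= y^-1)%E by rewrite inve_ge0 ltW.
rewrite le_min; apply/andP; split; last first.
  by rewrite muleC; apply: lee_pmul.
case: y xy y0 {Dy yD} yV0 => [y||]//= xy y0 yV0.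
  rewrite inver; rewrite lte_fin in y0; rewrite gt_eqF//.
  by rewrite lee_pdivrMr// mul1e.
by rewrite invey mule0.
Qed.

(** Were [ga] to vanish at [A], it would by symmetry and monotonicity vanish
    outside the interval [-A, A], against full support. *)
Lemma height_density_gt0 (ga : R -> R) (A : R) : 0 < A -> height_density ga ->
  exists2 kap, 0 < kap & forall x, x != 0 -> `|x| <= A -> kap <= ga x.
Proof.
move=> A0 [[_ ga0 _] gaN gadec gasupp].
have norm x : ga `|x| = ga x by case: (ger0P x) => // _; rewrite gaN.
exists (ga A); last first.
  by move=> x x0 xA; rewrite -(norm x); apply: gadec => //; rewrite normr_gt0.
rewrite lt_neqAle ga0 andbT; apply/negP => /eqP gA.
have sub : [set x | ga x != 0] `<=` `[- A, A].
  move=> x /= gx; rewrite in_itv/= -ler_norml leNgt; apply/negP => Ax.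
  have : ga `|x| <= ga A by apply: gadec => //; exact: ltW.
  rewrite norm -gA => gx0; have : ga x = 0 by apply/eqP; rewrite eq_le gx0 ga0.
  by move=> e; rewrite e eqxx in gx.
have : closure [set x | ga x != 0] (A + 1) by rewrite gasupp.
move/(closure_subset sub); rewrite -(closure_id _).1; last exact: itv_closed.
by rewrite /= in_itv/= => /andP[_]; lra.
Qed.

Lemma Linfty_bound (f0 : R -> R) :
  ('N[leb]_+oo[EFin \o (f0 \_ `[0%R, 1%R])%R] < +oo)%E ->
  exists2 M, 0 <= M & {ae leb, forall x, x \in `[0, 1] -> `|f0 x| <= M}.
Proof.
rewrite unlock /=; case: ifPn => [_|]; last first.
  have := @lebesgue_measure_itv R `]-oo, +oo[; rewrite set_itvNyy/= => -> /negP[].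
  by rewrite ltry.
move=> fin.
exists (Num.max 0 (fine (ess_sup leb (abse \o (EFin \o f0 \_ `[0, 1]))))).
  by rewrite le_max lexx.
have [N [mN N0 sN]] := ess_sup_ge leb (abse \o (EFin \o f0 \_ `[0, 1])).
exists N; split=> // x hx; apply: sN => /= h; apply: hx => x01.
move: h; rewrite patchE mem_set// => h.
rewrite le_max; apply/orP; right.
case: (ess_sup _ _) fin h => [r||]//=.
Qed.

(** The weight is 1 up to [2 * M * n] and then decays geometrically. *)
Lemma height_weight_sum (n : nat) (M : R) N : 0 <= M ->
  \sum_(0 <= k < N) height_weight n M k <= 2 * M * n%:R + 16.
Proof.
move=> M0; pose A := (Num.truncn (2 * M * n%:R)).+1.
have Mn0 : 0 <= 2 * M * n%:R by rewrite !mulr_ge0.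
have /andP[A1 A2] := truncn_itv Mn0.
pose r : R := expR (- 14^-1).
have r0 : 0 <= r := expR_ge0 _.
have r1 : (1 - r)^-1 <= 15.
  have h : 1 + 14^-1 <= expR (14^-1 : R) by exact: expR_ge1Dx.
  have : r <= (1 + 14^-1)^-1.
    by rewrite /r expRN lef_pV2 ?posrE ?expR_gt0.
  have -> : (1 + 14^-1)^-1 = 14 / 15 :> R by field.
  by move=> h2; rewrite -[leRHS]invrK lef_pV2 ?posrE ?invr_gt0//; lra.
have r1' : r < 1 by rewrite /r -[ltRHS]expR0 ltr_expR oppr_lt0.
have hk k : height_weight n M k <= r ^+ (k - A).
  rewrite /height_weight /r -expRM_natl ler_expR mulrN lerN2.
  rewrite ler_wpM2r//; have [kA|Ak] := leqP k A.
    by move: kA; rewrite -subn_eq0 => /eqP ->; rewrite le_max lexx.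
  by rewrite le_max; apply/orP; right; rewrite natrB ?(ltnW Ak)// lerD2l lerN2 ltW.
have hw0 k : 0 <= height_weight n M k := expR_ge0 _.
apply: (@le_trans _ _ (\sum_(0 <= k < A + N) height_weight n M k)).
  by rewrite [leRHS](big_cat_nat _ (leq_addl A N))//= lerDl sumr_ge0.
apply: (@le_trans _ _ (\sum_(0 <= k < A + N) r ^+ (k - A))); first exact: ler_sum.
rewrite (big_cat_nat _ (leq_addr N A))//=.
rewrite (eq_big_nat _ _ (F2 := fun=> 1)); last first.
  by move=> k /andP[_ kA]; rewrite (_ : (k - A = 0)%N) ?expr0//; apply/eqP; rewrite subn_eq0 ltnW.
have -> : \sum_(A <= k < A + N) r ^+ (k - A) = \sum_(0 <= k < N) r ^+ k.
  rewrite -{1}(add0n A) [(A + N)%N]addnC big_addn addnK.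
  by under eq_bigr do rewrite addnK.
rewrite sumr_const_nat subn0.
have hg := geometric_sum_le N r0 r1'.
have AA : A%:R <= 2 * M * n%:R + 1 by rewrite /A -natr1 lerD2r.
by lra.
Qed.

Lemma nneseries_geometric1 (r : R) : 0 <= r -> r <= 2^-1 ->
  (\sum_(1 <= k <oo) (r ^+ k)%:E <= 1)%E.
Proof.
move=> r0 r2; apply: nneseries_le => [i|N]; first by rewrite lee_fin exprn_ge0.
rewrite sumEFin lee_fin; case: N => [|N]; first by rewrite big_geq.
have r1 : r < 1 by lra.
have := geometric_sum_le N.+1 r0 r1; rewrite big_nat_recl// expr0 => h.
rewrite -[1%N]add0n big_addn subSS subn0 in h *.
under eq_bigr do rewrite addn1.
have : (1 - r)^-1 <= 2.
  by rewrite -[leRHS]invrK lef_pV2 ?posrE ?invr_gt0//; lra.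
by lra.
Qed.

(** The normalising constant of the prior lies between its first term and 1. *)
Lemma model_prior_bounds (n k : nat) : (1 < n)%N -> (0 < k)%N ->
  expR (- (8 * k%:R * log_en n)) <= (model_prior 8 n k : R) <=
  expR (- (8 * (k%:R - 1) * log_en n)).
Proof.
move=> n1 k0.
have nR : 1 < n%:R :> R by rewrite ltr1n.
have L1 : 1 <= log_en n :> R.
  rewrite /log_en lnM ?posrE ?expR_gt0//; last by lra.
  by rewrite expRK lerDl ln_ge0// ltW.
pose r : R := expR (- (8 * log_en n)).
have r0 : 0 <= r := expR_ge0 _.
have wE j : model_weight 8 n j = r ^+ j :> R.
  by rewrite /model_weight /r -expRM_natl; congr expR; ring.
have r2 : r <= 2^-1.
  rewrite /r expRN lef_pV2 ?posrE ?expR_gt0//.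
  by apply: le_trans (expR_ge1Dx _); lra.
pose S := (\sum_(1 <= j <oo) (model_weight 8 n j : R)%:E)%E.
have S1 : (S <= 1)%E.
  rewrite /S; under eq_eseriesr do rewrite wE.
  exact: nneseries_geometric1.
have Sr : (r%:E <= S)%E.
  have := @nneseries_term _ (fun j => (model_weight 8 n j : R)%:E) 1%N 1%N.
  by rewrite wE expr1; apply => // j; rewrite lee_fin expR_ge0.
have Sfin : S \is a fin_num.
  by rewrite fin_numElt (lt_le_trans _ Sr) ?ltNyr// (le_lt_trans S1) ?ltry.
rewrite /model_prior -/S.
have S1' : fine S <= 1 by rewrite -lee_fin fineK.
have Sr' : r <= fine S by rewrite -lee_fin fineK.
have r_gt0 : 0 < r := expR_gt0 _.
have S0 : 0 < fine S by exact: lt_le_trans Sr'.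
rewrite wE (_ : expR (- (8 * k%:R * log_en n)) = r ^+ k); last first.
  by rewrite /r -expRM_natl; congr expR; ring.
apply/andP; split.
  by rewrite ler_pdivlMr// ler_piMr// exprn_ge0.
rewrite ler_pdivrMr//.
have -> : expR (- (8 * (k%:R - 1) * log_en n)) = r ^+ k.-1.
  rewrite /r -expRM_natl; congr expR.
  by rewrite -[in LHS](prednK k0) -natr1; ring.
by rewrite -[in leLHS](prednK k0) exprSr ler_wpM2l// exprn_ge0.
Qed.

End Preliminaries.

(** * The loss *)

Section Loss.
Context {R : realType}.
Local Notation leb := (@lebesgue_measure R).

#[local] Instance leb_ae_filter : Filter (nbhs (almost_everywhere leb)) :=
  ae_filter_ringOfSetsType leb.

Lemma eq_intI_ae (f g : R -> R) :
  bounded_measurable f -> bounded_measurable g ->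
  {ae leb, forall x, x \in `[0, 1] -> f x = g x} -> intI f 0 1 = intI g 0 1.
Proof.
move=> [mf _] [mg _] fg; rewrite /intI /Rintegral; congr fine.
apply: ae_eq_integral => //.
- by apply/measurable_EFinP; exact: measurable_funTS.
- by apply/measurable_EFinP; exact: measurable_funTS.
apply: filterS fg => x fg /=; rewrite in_itv/= => /andP[x0 x1].
by rewrite fg// in_itv/= x0 ltW.
Qed.

Lemma le_intI_ae (f g : R -> R) :
  bounded_measurable f -> bounded_measurable g ->
  {ae leb, forall x, x \in `[0, 1] -> f x <= g x} -> intI f 0 1 <= intI g 0 1.
Proof.
move=> bf bg fg; have bm := bounded_measurable_max bf bg.
rewrite -(@eq_intI_ae (fun x => Num.max (f x) (g x)) g)//.
  by apply: le_intI => // x _; rewrite le_max lexx.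
by apply: filterS fg => x fg x01; apply/max_idPr; exact: fg.
Qed.

Lemma ae_neq1 : {ae leb, forall x : R, x != 1}.
Proof.
exists [set 1%R]; split=> //; first exact: lebesgue_measure_set1.
by move=> x /=; have [->//|x1 /(_ isT)] := eqVneq x 1.
Qed.

Lemma ae_itvco (Q P : R -> Prop) :
  {ae leb, forall x, x \in `[0, 1] -> Q x} ->
  (forall x, 0 <= x < 1 -> Q x -> P x) ->
  {ae leb, forall x, x \in `[0, 1] -> P x}.
Proof.
move=> aeQ QP; apply: filterS2 aeQ ae_neq1 => x Qx x1 x01.
apply: QP (Qx x01); move: x01; rewrite in_itv/= => /andP[-> x1'] /=.
by rewrite lt_neqAle x1.
Qed.

(** The essential bound is used to clamp [f0], which changes it on a null set
    only. *)
Lemma bounded_version (f0 : R -> R) :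
  measurable_fun (`[0, 1] : set R) f0 ->
  ('N[leb]_+oo[EFin \o (f0 \_ `[0%R, 1%R])%R] < +oo)%E ->
  exists (h0 : R -> R) (M : R), [/\ 0 <= M, measurable_fun [set: R] h0,
    forall x, `|h0 x| <= M & {ae leb, forall x, x \in `[0, 1] -> f0 x = h0 x}].
Proof.
move=> mf /Linfty_bound[M M0 fM].
exists (fun x => Num.max (- M) (Num.min M ((f0 \_ `[0, 1]) x))), M; split => //.
- apply: measurable_maxr => //; apply: measurable_minr => //.
  by apply/(measurable_restrictT f0 (measurable_itv _)).
- move=> x; rewrite ler_norml le_max lexx/= ge_max ge_min lexx/= andbT.
  by rewrite ge0_cp.
apply: filterS fM => x fM x01; rewrite patchE mem_set//.
have /fM := x01; rewrite ler_norml => /andP[a b].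
by rewrite (min_idPr b) (max_idPr a).
Qed.

Section Fixed.
Variables (f0 h0 : R -> R) (M : R).
Hypotheses (mf0 : measurable_fun (`[0, 1] : set R) f0).
Hypotheses (M0 : 0 <= M) (mh0 : measurable_fun [set: R] h0).
Hypothesis (h0M : forall x, `|h0 x| <= M).
Hypothesis (f0h0 : {ae leb, forall x, x \in `[0, 1] -> f0 x = h0 x}).

Let bh0 : bounded_measurable h0. Proof. by split=> //; exists M. Qed.

Lemma bounded_measurable_dist (g : R -> R) : bounded_measurable g ->
  bounded_measurable (fun x => `|h0 x - g x|).
Proof.
move=> bg; rewrite (_ : (fun x => _) = fun x => Num.max (h0 x - g x) (g x - h0 x)).
  by apply: bounded_measurable_max; apply: bounded_measurableB.
by apply/funext => x; rewrite -[X in Num.max _ X]opprB; rewrite maxrN.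
Qed.

Lemma integral_dist (g : R -> R) : bounded_measurable g ->
  (\int[leb]_(x in `[0%R, 1%R]) `|f0 x - g x|%R%:E)%E =
  (intI (fun x => `|h0 x - g x|) 0 1)%:E.
Proof.
move=> bg; have bd := bounded_measurable_dist bg; have [mg _] := bg.
rewrite -intI_closed// /Rintegral fineK; last first.
  by apply: integrable_fin_num => //; exact: bounded_integrablec.
apply: ae_eq_integral => //.
- apply/measurable_EFinP; apply: measurableT_comp => //.
  by apply: measurable_funB => //; exact: measurable_funTS.
- by apply/measurable_EFinP; apply: measurable_funTS; case: bd.
by apply: filterS f0h0 => x + x01 => ->.
Qed.

Lemma Lbar1_below (g : R -> R) : bounded_measurable g -> le01 g f0 ->
  Lbar1 f0 g = (intI (fun x => `|h0 x - g x|) 0 1)%:E.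
Proof. by move=> bg gf; rewrite /Lbar1 asboolT// integral_dist. Qed.

Lemma Lbar1_above (g : R -> R) : bounded_measurable g -> le01 f0 g ->
  Lbar1 g f0 = (intI g 0 1 - intI h0 0 1)%:E /\ le01 h0 g.
Proof.
move=> bg fg.
have hg : le01 h0 g.
  by apply: filterS2 f0h0 fg => x + + x01 => /(_ x01) <- /(_ x01).
split=> //; rewrite /Lbar1 asboolT//.
under eq_integral do rewrite distrC.
rewrite integral_dist// -intIB//; congr EFin; apply: eq_intI_ae.
- exact: bounded_measurable_dist.
- exact: bounded_measurableB.
by apply: filterS hg => x hg x01; rewrite distrC ger0_norm// subr_ge0 hg.
Qed.

(** The minimizer may leave [-M, M]; clamping its heights keeps it below [f0]
    and does not increase its distance to [f0], since [f0] itself stays there. *)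
Lemma clamped_minimizer (n m : nat) : minimizers_exist f0 -> (0 < n)%N ->
  (0 < m)%N ->
  exists s be e2, [/\ size s = m.-1, size be = (size s).+1,
    path <%R 0 (rcons s 1), forall x, x \in be -> - M <= x <= M &
    [/\ le01 (step_fun s be) h0, eps_int2 f0 n m = e2%:E,
      intI h0 0 1 - intI (step_fun s be) 0 1 <= e2 &
      m%:R * log_en n <= n%:R * e2]].
Proof.
move=> /(_ m) + n0 m0 => /(_ m0)[g [s [a [sm am pths ->]]] gmin].
have sa : size a = (size s).+1 by rewrite sm am prednK.
have bg : bounded_measurable (step_fun s a) := @bounded_step_from R 0 s a sa.
pose g1 := step_fun s (nseq m (- M)).
have sn : size (nseq m (- M)) = (size s).+1 by rewrite size_nseq sm prednK.
have bg1 : bounded_measurable g1 := @bounded_step_from R 0 s _ sn.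
have g1f : le01 g1 f0.
  apply: (ae_itvco f0h0) => x x01 ->.
  have [j jm [_]] := @step_from_eval R 0 s _ x sn pths x01.
  rewrite nth_nseq -[in (j < m)%N](size_nseq m (- M)) jm => e.
  by rewrite [leLHS]e; have := h0M x; rewrite ler_norml => /andP[].
have gf : le01 (step_fun s a) f0.
  have : (Lbar1 f0 (step_fun s a) < +oo)%E.
    apply: le_lt_trans (gmin g1 _) _.
      by exists s, (nseq m (- M)); split=> //; rewrite size_nseq.
    by rewrite Lbar1_below// ltry.
  by rewrite /Lbar1; case: asboolP.
pose clamp (y : R) : R := Num.max (- M) (Num.min M y).
pose be := map clamp a.
have sbe : size be = (size s).+1 by rewrite size_map.
have clE x : 0 <= x < 1 -> step_fun s be x = clamp (step_fun s a x).
  by move=> x01; exact: (@step_from_map R clamp 0 s a x sa pths x01).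
have bbe : bounded_measurable (step_fun s be) := @bounded_step_from R 0 s be sbe.
pose delta := intI (fun x => `|h0 x - step_fun s a x|) 0 1.
exists s, be, (Num.max delta (m%:R * log_en n / n%:R)); split => //.
  move=> y /mapP[x _ ->].
  rewrite /clamp le_max lexx/= ge_max ge_min lexx/= andbT.
  by rewrite ge0_cp.
have gh : {ae leb, forall x, x \in `[0, 1] -> step_fun s a x <= h0 x}.
  by apply: filterS2 f0h0 gf => x + + x01 => /(_ x01) <- /(_ x01).
split.
- apply: (ae_itvco gh) => x x01 gx.
  rewrite clE// /clamp; have := h0M x; rewrite ler_norml => /andP[h1 h2].
  by rewrite ge_max h1 ge_min gx orbT.
- rewrite /eps_int2 EFin_max; congr maxe.
  rewrite -[RHS]Lbar1_below//; apply/le_anti/andP; split.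
    by apply: ereal_inf_lbound; exists (step_fun s a) => //; exists s, a; split.
  by apply: le_ereal_inf_tmp => _ [h mh <-]; exact: gmin.
- rewrite le_max; apply/orP; left; rewrite -intIB//.
  apply: le_intI_ae.
  + exact: bounded_measurableB.
  + exact: bounded_measurable_dist.
  apply: (ae_itvco gh) => x x01 gx.
  rewrite clE// ger0_norm ?subr_ge0// lerD2l lerN2 /clamp.
  have := h0M x; rewrite ler_norml => /andP[h1 h2].
  rewrite le_max; apply/orP; right; rewrite le_min lexx andbT.
  exact: le_trans gx h2.
have nR : 0 < n%:R :> R by rewrite ltr0n.
by rewrite -ler_pdivrMl// mulrC le_max lexx orbT.
Qed.

Context d (Omega : measurableType d) (P : probability Omega R).
Variables (n : nat) (Z : nat -> Omega -> R * R).
Hypothesis obs : observation P n f0 Z.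

Lemma above_ae (l : R -> R) : bounded_measurable l -> le01 l h0 ->
  exists N, [/\ measurable N, P N = 0%E &
    forall w, ~ N w -> forall i, l (Z i w).1 <= (Z i w).2].
Proof.
move=> bl lh.
pose E := [set w | forall i, l (Z i w).1 <= (Z i w).2].
have mE : measurable E by apply: measurable_above => //; [exact: obs|case: bl].
exists (~` E); split; [exact: measurableC| |by move=> w /contrapT].
rewrite probability_setC// (prob_above mf0 bh0 f0h0 obs bl).
rewrite (@eq_intI_ae _ (fun=> 0)).
- by rewrite intI_cst// mul0r mulr0 oppr0 expR0 subee.
- apply: bounded_measurable_max; first exact: bounded_measurable_cst.
  exact: bounded_measurableB.
- exact: bounded_measurable_cst.
by apply: filterS lh => x lh x01; apply/max_idPl; rewrite subr_le0 lh.
Qed.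

End Fixed.
End Loss.

(** * The expected posterior mass *)

Section PriorFacts.
Context {R : realType}.

Lemma likelihood_ge0 n pts (f : R -> R) : (0 <= likelihood n pts f)%E.
Proof. by rewrite lee_fin mulr_ge0// expR_ge0. Qed.

Lemma model_prior_ge0 c n k : 0 <= model_prior c n k :> R.
Proof.
rewrite /model_prior divr_ge0 ?expR_ge0// fine_ge0//.
by apply: nneseries_ge0 => *; rewrite lee_fin expR_ge0.
Qed.

Lemma model_integral_ge0 (ga : R -> R) k (h : (R -> R) -> \bar R) j :
  (forall x, 0 <= ga x) -> (forall f, (0 <= h f)%E) ->
  (0 <= integral_seq j (fun t => (dens_t t)%:E *
      integral_seq k (fun a => (dens_a ga a)%:E * h (step_fun t a))))%E.
Proof.
move=> ga0 h0; apply: integral_seq_ge0 => t _; apply: mule_ge0.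
  by rewrite lee_fin dens_t_ge0.
apply: integral_seq_ge0 => a _; apply: mule_ge0 => //.
by rewrite lee_fin dens_a_ge0.
Qed.

End PriorFacts.

Section Assembly.
Context {R : realType}.
Local Notation leb := (@lebesgue_measure R).
Variables (n : nat) (M kap : R) (h0 ga : R -> R).
Hypotheses (n514 : (514 <= n)%N) (Mn : 2 * M + 16 <= n%:R).
Hypotheses (kapn : 1 <= kap * n%:R) (LM : 8 * M + 3 <= log_en n).
Hypotheses (M0 : 0 <= M) (kap0 : 0 < kap).
Hypothesis mh0 : measurable_fun [set: R] h0.
Hypothesis h0M : forall x, `|h0 x| <= M.
Hypothesis dga : probability_density ga.
Hypothesis ga_kap : forall x, x != 0 -> `|x| <= M + 1 -> kap <= ga x.

Local Notation Lg := (log_en n : R).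

Let n0 : (0 < n)%N. Proof. exact: leq_trans n514. Qed.
Let nR : 0 < n%:R :> R. Proof. by rewrite ltr0n. Qed.
Let nR514 : 514 <= n%:R :> R. Proof. by rewrite ler_nat. Qed.
Let Lg0 : 0 <= Lg. Proof. by apply: le_trans LM; rewrite addr_ge0// mulr_ge0. Qed.

Lemma le_expR_log_en : n%:R <= expR Lg.
Proof.
rewrite /log_en lnK ?posrE ?mulr_gt0 ?expR_gt0//.
by rewrite ler_peMl// -expR0 ler_expR.
Qed.

Lemma expR_log_en_inv (x : R) : 0 < x -> x <= n%:R ^+ 2 ->
  expR (- (2 * Lg)) <= x^-1.
Proof.
move=> x0 xn; rewrite expRN lef_pV2 ?posrE ?expR_gt0//.
apply: le_trans xn _; rewrite -[2]/(2%:R) expRM_natl.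
by apply: lerXn2r; rewrite ?nnegrE ?expR_ge0// ?le_expR_log_en.
Qed.

(** Only the model with [(size (marked n s)).+1 <= 3 * m] pieces is kept.  In
    units of [m * log_en n <= n * e2] its prior weight costs 24, the boxes for
    heights and break points cost 6 each, the approximation of [g] costs 1,
    and replacing [g] by [h0] costs one more [n * e2]. *)
Lemma prior_integral_ge (m : nat) (s be : seq R) (e2 : R) pts :
  (0 < m)%N -> size s = m.-1 -> size be = (size s).+1 ->
  path <%R 0 (rcons s 1) -> (forall x, x \in be -> - M <= x <= M) ->
  intI h0 0 1 - intI (step_fun s be) 0 1 <= e2 -> m%:R * Lg <= n%:R * e2 ->
  (forall i, (pts i).1 \in `[0, 1]) ->
  (forall i, step_fun s be (pts i).1 <= (pts i).2) ->
  ((expR (n%:R * intI h0 0 1 - 40 * (n%:R * e2)))%:E <=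
   prior_integral 8 ga n (likelihood n pts))%E.
Proof.
move=> m0 sm sbe pths beM de me pts01 gpts.
have [_ ga0 _] := dga.
set r := size (marked n s).
have rm : (r <= 3 * m.-1)%N.
  rewrite -sm; exact: size_marked.
have D := denominator_ge n0 M0 kap0 dga ga_kap sbe pths beM pts01 gpts.
rewrite -/r in D.
have T := @nneseries_term R (fun k => (model_prior 8 n k)%:E *
    integral_seq k.-1 (fun t => (dens_t t)%:E *
      integral_seq k (fun a => (dens_a ga a)%:E * likelihood n pts (step_fun t a))))%E
   1%N r.+1.
apply: le_trans (T _ _) => //; last first.
  move=> k; apply: mule_ge0; first by rewrite lee_fin model_prior_ge0.
  by apply: model_integral_ge0 => // f; exact: likelihood_ge0.
apply: le_trans (lee_wpmul2l _ D); last by rewrite lee_fin model_prior_ge0.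
rewrite -EFinM lee_fin.
have /andP[mp _] : expR (- (8 * r.+1%:R * Lg)) <= (model_prior 8 n r.+1 : R) <=
    expR (- (8 * (r.+1%:R - 1) * Lg)).
  by apply: model_prior_bounds => //; exact: leq_trans n514.
have kn : expR (- (2 * Lg)) <= kap / n%:R.
  rewrite -invf_div; apply: expR_log_en_inv; first by rewrite divr_gt0.
  by rewrite ler_pdivrMr// expr2 -mulrA [n%:R * kap]mulrC ler_peMr// ltW.
have n3 : expR (- (2 * Lg)) <= (3 * n%:R)^-1.
  apply: expR_log_en_inv; first by rewrite mulr_gt0.
  by rewrite expr2 ler_pM2r//; have := nR514; lra.
apply: (@le_trans _ _ (expR (- (8 * r.+1%:R * Lg)) *
  (expR (n%:R * intI (step_fun s be) 0 1 - 1 - 8 * M * (size s)%:R) *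
   expR (- (2 * Lg)) ^+ r.+1 * expR (- (2 * Lg)) ^+ r))); last first.
  apply: ler_pM => //; rewrite ?mulr_ge0 ?exprn_ge0 ?expR_ge0//.
  apply: ler_pM => //; rewrite ?mulr_ge0 ?exprn_ge0 ?expR_ge0//.
    apply: ler_pM => //; rewrite ?mulr_ge0 ?exprn_ge0 ?expR_ge0//.
    by apply: lerXn2r; rewrite ?nnegrE ?expR_ge0// divr_ge0 ?ltW.
  by apply: lerXn2r; rewrite ?nnegrE ?expR_ge0// invr_ge0 mulr_ge0// ltW.
rewrite -!expRM_natl -!expRD ler_expR.
have rmR : r%:R <= 3 * (m%:R - 1) :> R.
  have -> : m%:R - 1 = m.-1%:R :> R by rewrite -[in LHS](prednK m0) -natr1 addrK.
  by rewrite -(natrM _ 3) ler_nat.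
have sR : (size s)%:R = m%:R - 1 :> R.
  by rewrite sm -[in RHS](prednK m0) -natr1 addrK.
have rL : r%:R * Lg <= 3 * (m%:R - 1) * Lg by rewrite ler_wpM2r.
have m1 : 1 <= m%:R :> R by rewrite ler1n.
have mL : m%:R * (8 * M + 3) <= m%:R * Lg by rewrite ler_wpM2l.
have nd := ler_wpM2l (ltW nR) de.
rewrite mulrBr in nd.
have M0' := M0; have LM' := LM.
have mM : 0 <= m%:R * M by rewrite mulr_ge0.
rewrite sR -[r.+1%:R]natr1.
rewrite (_ : 8 * (r%:R + 1) * Lg = 8 * (r%:R * Lg) + 8 * Lg); last by ring.
rewrite (_ : (r%:R + 1) * - (2 * Lg) = - 2 * (r%:R * Lg) - 2 * Lg); last by ring.
rewrite (_ : r%:R * - (2 * Lg) = - 2 * (r%:R * Lg)); last by ring.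
rewrite (_ : 8 * M * (m%:R - 1) = 8 * (m%:R * M) - 8 * M); last by ring.
rewrite (_ : 3 * (m%:R - 1) * Lg = 3 * (m%:R * Lg) - 3 * Lg) in rL; last by ring.
rewrite (_ : m%:R * (8 * M + 3) = 8 * (m%:R * M) + 3 * m%:R) in mL; last by ring.
lra.
Qed.

Section PosteriorMass.
Variables (m : nat) (e2 : R).
Hypotheses (m0 : (0 < m)%N) (me : m%:R * Lg <= n%:R * e2).

Let E := n%:R * e2.
Let T := 640 * E.
Let J := intI h0 0 1.

(** The exponent left to the model with [b.+1] pieces by its prior weight and
    by the lower bound on the normalising integral. *)
Definition log_ratio (b : nat) : R := 40 * E - 8 * b%:R * Lg.

Definition code_term (b : nat) (pts : nat -> R * R) (c : seq nat) : R :=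
  Num.min 1 (expR (log_ratio b) * (code_mass n b M T h0 c * code_vol n b c)) *
  respects pts (code_level n b M c).

Lemma code_term_ge0 b pts c : 0 <= code_term b pts c.
Proof.
rewrite mulr_ge0 ?respects_ge0// le_min ler01 mulr_ge0 ?expR_ge0//.
by rewrite mulr_ge0 ?code_mass_ge0 ?code_vol_ge0.
Qed.

(** Dividing by a constant lower bound of the denominator makes the bound a sum
    over codes, and truncation at 1 passes inside this sum. *)
Lemma posterior_le (B : set (R -> R)) pts :
  (forall (t a : seq R), size a = (size t).+1 -> path <%R 0 (rcons t 1) ->
    B (step_fun t a) -> le01 h0 (step_fun t a) /\
    T <= n%:R * (area 0 t a - J)) ->
  (forall i, (pts i).1 \in `[0, 1]) ->
  ((expR (n%:R * J - 40 * E))%:E <= prior_integral 8 ga n (likelihood n pts))%E ->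
  (posterior 8 ga n pts B <=
   \sum_(0 <= b <oo) seq_sum (3 * b).+2 (fun c => (code_term b pts c)%:E))%E.
Proof.
move=> hB pts01 den.
have [_ ga0 _] := dga.
have BL0 f : (0 <= (\1_B f)%:E * likelihood n pts f)%E.
  by rewrite mule_ge0 ?likelihood_ge0// lee_fin.
have BI k j := @model_integral_ge0 R ga k _ j ga0 BL0.
pose S b := seq_sum (3 * b).+2 (fun c =>
  (code_mass n b M T h0 c * code_vol n b c)%:E *
  (respects pts (code_level n b M c))%:E)%E.
have C0 b c : (0 <= (code_mass n b M T h0 c * code_vol n b c)%:E *
  (respects pts (code_level n b M c))%:E)%E.
  rewrite mule_ge0 ?lee_fin ?respects_ge0//.
  by rewrite mulr_ge0 ?code_mass_ge0 ?code_vol_ge0.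
have S0 b : (0 <= S b)%E by apply: seq_sum_ge0.
pose X := (\sum_(0 <= b <oo)
  ((expR (- (8 * b%:R * Lg)))%:E * ((expR (n%:R * J))%:E * S b)))%E.
have X0 b : (0 <= (expR (- (8 * b%:R * Lg)))%:E * ((expR (n%:R * J))%:E * S b))%E.
  by rewrite !mule_ge0// lee_fin expR_ge0.
have numX : (prior_integral 8 ga n
    (fun f => (\1_B f)%:E * likelihood n pts f) <= X)%E.
  rewrite /prior_integral /X -nneseries_addn; last first.
    move=> k; apply: mule_ge0; first by rewrite lee_fin model_prior_ge0.
    exact: BI.
  apply: lee_nneseries => [k _ _|b _].
    apply: mule_ge0; first by rewrite lee_fin model_prior_ge0.
    exact: BI.
  rewrite addn1; apply: lee_pmul.
  - by rewrite lee_fin model_prior_ge0.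
  - exact: BI.
  - rewrite lee_fin.
    have /andP[_] : expR (- (8 * b.+1%:R * Lg)) <= (model_prior 8 n b.+1 : R) <= expR (- (8 * (b.+1%:R - 1) * Lg)).
      by apply: model_prior_bounds => //; exact: leq_trans n514.
    by rewrite -[b.+1%:R]natr1 addrK.
  exact: numerator_le.
apply: le_trans (ratio_le_mine (expR_gt0 _) _ _ den numX) _.
- apply: nneseries_ge0 => k _ _; apply: mule_ge0; first by rewrite lee_fin model_prior_ge0.
  exact: BI.
- apply: lee_nneseries => [k _ _|b _].
    apply: mule_ge0; first by rewrite lee_fin model_prior_ge0.
    exact: BI.
  apply: lee_wpmul2l; first by rewrite lee_fin model_prior_ge0.
  apply: le_integral_seq => t _.
  + apply: mule_ge0; first by rewrite lee_fin dens_t_ge0.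
    apply: integral_seq_ge0 => a _; apply: mule_ge0 => //.
    by rewrite lee_fin dens_a_ge0.
  + apply: mule_ge0; first by rewrite lee_fin dens_t_ge0.
    apply: integral_seq_ge0 => a _; apply: mule_ge0; last exact: likelihood_ge0.
    by rewrite lee_fin dens_a_ge0.
  apply: lee_wpmul2l; first by rewrite lee_fin dens_t_ge0.
  apply: le_integral_seq => a _.
  + by apply: mule_ge0 => //; rewrite lee_fin dens_a_ge0.
  + by apply: mule_ge0; [rewrite lee_fin dens_a_ge0|exact: likelihood_ge0].
  apply: lee_wpmul2l; first by rewrite lee_fin dens_a_ge0.
  rewrite -[leRHS]mul1e; apply: lee_wpmul2r; first exact: likelihood_ge0.
  by rewrite lee_fin indicE lern1 leq_b1.
rewrite -nneseriesZl//.
apply: le_trans (mine1_nneseries 0 _) _ => [b|].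
  by rewrite mule_ge0// lee_fin invr_ge0 expR_ge0.
apply: lee_nneseries => [b _ _|b _].
  by rewrite le_min lee01 mule_ge0// lee_fin invr_ge0 expR_ge0.
have -> : ((expR (n%:R * J - 40 * E))^-1%:E *
    ((expR (- (8 * b%:R * Lg)))%:E * ((expR (n%:R * J))%:E * S b)) =
    (expR (log_ratio b))%:E * S b)%E.
  rewrite 2!muleA -expRN; congr (_ * _)%E.
  rewrite (_ : log_ratio b = - (n%:R * J - 40 * E) - 8 * b%:R * Lg + n%:R * J);
    last by rewrite /log_ratio; ring.
  by rewrite 2!expRD !EFinM.
rewrite -seq_sumZl//.
apply: le_trans (mine1_seq_sum _) _ => [c _|].
  by rewrite mule_ge0// lee_fin expR_ge0.
apply: le_seq_sum => [c _|c _].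
  by rewrite le_min lee01 mule_ge0// lee_fin expR_ge0.
rewrite /code_term /respects; case: asboolP => _.
  by rewrite mule1 mulr1 EFin_min EFinM.
by rewrite !mule0 mulr0 ge_min lexx orbT.
Qed.

Lemma height_sum_le N : \sum_(0 <= k < N) height_weight n M k <= n%:R ^+ 2 :> R.
Proof.
apply: le_trans (height_weight_sum n N M0) _.
apply: (@le_trans _ _ ((2 * M + 16) * n%:R)).
  by rewrite [_ * n%:R in leRHS]mulrDl lerD2l ler_peMr//; have := nR514; lra.
by rewrite expr2 ler_wpM2r// ltW.
Qed.

(** The entropy of the codes: a power of [n] for each piece. *)
Lemma code_entropy b :
  2 * (n%:R ^+ 2 * (2 * (257 * n%:R) * n%:R ^+ 2) ^+ b) <=
  expR (4 * b.+1%:R * Lg) :> R.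
Proof.
apply: (@le_trans _ _ (n%:R ^+ (4 * b.+1))); last first.
  rewrite (_ : 4 * b.+1%:R = (4 * b.+1)%:R :> R); last by rewrite natrM.
  rewrite expRM_natl.
  by apply: lerXn2r; rewrite ?nnegrE ?expR_ge0// ?le_expR_log_en.
rewrite mulnS exprD exprM mulrA.
have n20 : 0 < n%:R ^+ 2 :> R by rewrite exprn_gt0.
have q0 : 0 <= 2 * (257 * n%:R) * n%:R ^+ 2 :> R.
  by rewrite -natrX -!natrM ler0n.
have nn := nR514.
apply: ler_pM.
- by rewrite mulr_ge0// ltW.
- exact: exprn_ge0.
- by rewrite (exprD _ 2 2) ler_pM2r// expr2; nra.
apply: lerXn2r; rewrite ?nnegrE.
- exact: q0.
- by apply/exprn_ge0/ltW.
by rewrite (exprD _ 2 2) ler_pM2r// mulrA expr2 ler_pM2r//; lra.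
Qed.

(** In the exponent, [3/4 * 40] from the denominator is less than the
    [640 / 16 = 40] gained from the distance, and the prior weight gives
    [3/4 * 8 = 6] times [b * log_en n], against the [4 * b.+1 * log_en n] of the
    entropy and one more [b.+1 * log_en n] for each of the constants and the
    series over [b]. *)
Lemma exponent_sum b :
  expR (3 / 4 * log_ratio b + (M + 3) * b.+1%:R - T / 16) *
  (2 * (n%:R ^+ 2 * (2 * (257 * n%:R) * n%:R ^+ 2) ^+ b)) <=
  expR (- (m%:R * Lg)) * expR (- Lg) ^+ b.+1.
Proof.
apply: le_trans (ler_wpM2l (expR_ge0 _) (code_entropy b)) _.
rewrite -expRM_natl -2!expRD ler_expR /log_ratio /T -/E.
have mm : Lg <= m%:R * Lg by rewrite ler_peMl// ler1n.
have h : (M + 3) * b.+1%:R <= Lg * b.+1%:R.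
  by rewrite ler_wpM2r//; have := LM; have := M0; lra.
have meE : m%:R * Lg <= E := me.
have Lg0' := Lg0.
move: h; rewrite -[b.+1%:R]natr1.
rewrite (_ : Lg * (b%:R + 1) = b%:R * Lg + Lg); last by ring.
rewrite (_ : 8 * b%:R * Lg = 8 * (b%:R * Lg)); last by ring.
rewrite (_ : 4 * (b%:R + 1) * Lg = 4 * (b%:R * Lg) + 4 * Lg); last by ring.
rewrite (_ : (b%:R + 1) * - Lg = - (b%:R * Lg) - Lg); last by ring.
by lra.
Qed.

Context d (Omega : measurableType d) (P : probability Omega R).
Variables (f0 : R -> R) (Z : nat -> Omega -> R * R).
Hypothesis mf0 : measurable_fun (`[0, 1] : set R) f0.
Hypothesis f0h0 : {ae leb, forall x, x \in `[0, 1] -> f0 x = h0 x}.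
Hypothesis obs : observation P n f0 Z.

Let bh0 : bounded_measurable h0. Proof. by split=> //; exists M. Qed.

Lemma integral_code_term b c : size c = (3 * b).+2 ->
  measurable_fun [set: Omega] (fun w => (code_term b (fun i => Z i w) c)%:E) /\
  (\int[P]_w (code_term b (fun i => Z i w) c)%:E <=
   (expR (3 / 4 * log_ratio b + (M + 3) * b.+1%:R - T / 16) *
    weight n b.+1 M 0 (head 0%N c) (behead c))%:E)%E.
Proof.
move=> sc.
set l := code_level n b M c.
have bl : bounded_measurable l by exact: bounded_level.
pose A := [set w | forall i, l (Z i w).1 <= (Z i w).2].
have mA : measurable A by apply: measurable_above => //; [exact: obs|case: bl].
pose y := Num.min 1 (expR (log_ratio b) * (code_mass n b M T h0 c * code_vol n b c)).
have y0 : 0 <= y.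
  rewrite le_min ler01 mulr_ge0 ?expR_ge0//.
  by rewrite mulr_ge0 ?code_mass_ge0 ?code_vol_ge0.
have cE : (fun w => (code_term b (fun i => Z i w) c)%:E) =
          (fun w => y%:E * (\1_A w)%:E)%E.
  apply/funext => w; rewrite -EFinM /code_term -/y -/l /respects indicE.
  by case: asboolP => h; [rewrite mem_set|rewrite memNset].
rewrite cE; split.
  by apply/measurable_EFinP; apply: measurable_funM => //; exact: measurable_indic.
rewrite ge0_integralZl//; last first.
  by apply/measurable_EFinP; exact: measurable_indic.
have -> : (\int[P]_x (\1_A x)%:E = (expR (- (n%:R * code_excess n b M h0 c)))%:E)%E.
  by rewrite integral_indic// setIT; exact: (prob_above mf0 bh0 f0h0 obs bl).
rewrite -EFinM lee_fin.
exact: code_weight.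
Qed.

(** The posterior mass is compared with the sum over codes outside the null
    set where some point lies below the approximating step function. *)
Lemma integral_posterior_le (s be : seq R) (B : set (R -> R)) :
  size s = m.-1 -> size be = (size s).+1 ->
  path <%R 0 (rcons s 1) -> (forall x, x \in be -> - M <= x <= M) ->
  le01 (step_fun s be) h0 ->
  intI h0 0 1 - intI (step_fun s be) 0 1 <= e2 ->
  (forall (t a : seq R), size a = (size t).+1 -> path <%R 0 (rcons t 1) ->
    B (step_fun t a) -> le01 h0 (step_fun t a) /\
    T <= n%:R * (area 0 t a - J)) ->
  (\int[P]_w posterior 8 ga n (fun i => Z i w) B <= (expR (- (m%:R * Lg)))%:E)%E.
Proof.
move=> sm sbe pths beM gh de hB.
have [_ ga0 _] := dga.
have Z01 w i : (Z i w).1 \in `[0, 1] by have [_ +] := obs; apply.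
have bg : bounded_measurable (step_fun s be) := @bounded_step_from R 0 s be sbe.
have [N [mN N0 hN]] := above_ae mf0 mh0 h0M f0h0 obs bg gh.
pose F b w := seq_sum (3 * b).+2 (fun c => (code_term b (fun i => Z i w) c)%:E).
have F0 b w : (0 <= F b w)%E.
  by apply: seq_sum_ge0 => c _; rewrite lee_fin code_term_ge0.
have SI b := @seq_sum_integral R _ _ P (3 * b).+2
  (fun w c => (code_term b (fun i => Z i w) c)%:E)
  (fun c _ w => code_term_ge0 b _ c) (fun c sc => (integral_code_term sc).1).
apply: (@le_trans _ _ (\int[P]_w \sum_(0 <= b <oo) F b w)%E).
  apply: (@ge0_le_integral_ae _ _ _ P N) => // [w|w|w Nw].
  - rewrite /posterior; apply: mule_ge0.
      apply: nneseries_ge0 => k _ _; apply: mule_ge0; first by rewrite lee_fin model_prior_ge0.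
      apply: (@model_integral_ge0 R ga k (fun f =>
        (\1_B f)%:E * likelihood n (Z^~ w) f)%E _ ga0) => f.
      by rewrite mule_ge0 ?likelihood_ge0// lee_fin.
    rewrite inve_ge0; apply: nneseries_ge0 => k _ _; apply: mule_ge0; first by rewrite lee_fin model_prior_ge0.
    by apply: model_integral_ge0 => // f; exact: likelihood_ge0.
  - by apply: nneseries_ge0.
  apply: posterior_le => //.
  exact: (@prior_integral_ge m s be e2 _ m0 sm sbe pths beM de me (Z01 w) (hN w Nw)).
rewrite integral_nneseries//; last by move=> b; exact: (SI b).1.
apply: (@le_trans _ _ (\sum_(0 <= b <oo)
   (expR (- (m%:R * Lg)))%:E * (expR (- Lg) ^+ b.+1)%:E)%E).
  apply: lee_nneseries => [b _ _|b _]; first by apply: integral_ge0.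
  rewrite (SI b).2.
  apply: (@le_trans _ _ (seq_sum (3 * b).+2 (fun c =>
    (expR (3 / 4 * log_ratio b + (M + 3) * b.+1%:R - T / 16))%:E *
    (weight n b.+1 M 0 (head 0%N c) (behead c))%:E)%E)).
    apply: le_seq_sum => c sc; last by rewrite -EFinM; exact: (integral_code_term sc).2.
    by apply: integral_ge0 => w _; rewrite lee_fin code_term_ge0.
  rewrite seq_sumZl; last by move=> c _; rewrite lee_fin weight_ge0.
  apply: le_trans (lee_wpmul2l _ (@total_weight_sum R n b.+1 M n0 isT M0 _ height_sum_le b)) _.
    by rewrite lee_fin expR_ge0.
  by rewrite -!EFinM lee_fin exponent_sum.
rewrite nneseriesZl; last by move=> b _; rewrite lee_fin exprn_ge0// expR_ge0.
rewrite -[leRHS]mule1; apply: lee_wpmul2l; first by rewrite lee_fin expR_ge0.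
have := @nneseries_geometric1 R (expR (- Lg)) (expR_ge0 _).
rewrite -(@nneseries_addn _ (fun k => (expR (- Lg) ^+ k)%:E) 1); last first.
  by move=> k; rewrite lee_fin exprn_ge0// expR_ge0.
under eq_eseriesr do rewrite addn1.
apply; rewrite expRN lef_pV2 ?posrE ?expR_gt0//.
by apply: le_trans le_expR_log_en; have := nR514; lra.
Qed.

End PosteriorMass.
End Assembly.

Local Open Scope ereal_scope.

Theorem theorem3p30 (R : realType) :
  exists C' C1 C2 : R, [/\ (0 < C')%R, (0 < C1)%R, (0 < C2)%R &
  forall f0 ga : R -> R,
    measurable_fun (`[0%R, 1%R] : set R) f0 ->
    'N[@lebesgue_measure R]_+oo[EFin \o (f0 \_ `[0%R, 1%R])] < +oo ->
    minimizers_exist f0 ->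
    height_density ga ->
    tail_condition C' ga ->
    exists2 c : R, (0 < c)%R & exists n0 : nat,
    forall n m : nat, (n0 <= n)%N -> (0 < m)%N ->
    forall (d : measure_display) (Omega : measurableType d)
      (P : probability Omega R) (Z : nat -> Omega -> R * R),
      observation P n f0 Z ->
      \int[P]_w posterior c ga n (fun i => Z i w)
        [set f | le01 f0 f /\ C1%:E * eps_int2 f0 n m < Lbar1 f f0]
      <= (C2 * expR (- (m%:R * log_en n / C2)))%:E].
Proof.
exists 1%R, 640%R, 1%R; split; [exact: ltr01|by rewrite ltr0n|exact: ltr01|].
move=> f0 ga mf0 bf0 minf0 hga _.
have [h0 [M [M0 mh0 h0M f0h0]]] := bounded_version mf0 bf0.
have bh0 : bounded_measurable h0 by split=> //; exists M.
have M1 : (0 < M + 1)%R by rewrite ltr_wpDl.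
have [kap kap0 ga_kap] := height_density_gt0 M1 hga.
have [dga _ _ _] := hga.
exists 8%R => //.
(* Large enough for [8 * M + 3 <= log_en n], for [1 / n <= kap] and for the two
   linear bounds used in [height_sum_le] and [code_entropy]. *)
pose A := (expR (8 * M + 3) + kap^-1 + (2 * M + 16) + 514)%R.
exists (Num.truncn A).+1 => n m n0n m0 d Omega P Z obs.
have An : (A <= n%:R)%R.
  by apply: le_trans (ltW (truncnS_gt A)) _; rewrite ler_nat.
have kV : (0 < kap^-1)%R by rewrite invr_gt0.
have eA := expR_gt0 (8 * M + 3)%R.
have n514 : (514 <= n)%N by rewrite -(ler_nat R); rewrite /A in An; lra.
have n0 : (0 < n)%N by exact: leq_trans n514.
have nR : (0 < n%:R :> R)%R by rewrite ltr0n.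
have Mn : (2 * M + 16 <= n%:R)%R by rewrite /A in An; lra.
have kapn : (1 <= kap * n%:R)%R.
  by rewrite mulrC -ler_pdivrMr// div1r; rewrite /A in An; lra.
have LM : (8 * M + 3 <= log_en n)%R.
  rewrite /log_en -ler_expR lnK ?posrE ?mulr_gt0 ?expR_gt0//.
  apply: (@le_trans _ _ n%:R%R); first by rewrite /A in An; lra.
  by rewrite ler_peMl ?ltW// -expR0 ltr_expR.
have [s [be [e2 [sm sbe pths beM [gh epsE de me]]]]] :=
  clamped_minimizer mf0 M0 mh0 h0M f0h0 minf0 n0 m0.
rewrite divr1 mul1r.
apply: (integral_posterior_le n514 Mn kapn LM M0 kap0 mh0 h0M dga ga_kap
  m0 me mf0 f0h0 obs sm sbe pths beM gh de).
move=> t a sa pth [f0f]; rewrite epsE.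
have bf : bounded_measurable (step_fun t a) := @bounded_step_from R 0 t a sa.
have [-> hf] := Lbar1_above mf0 mh0 h0M f0h0 bf f0f.
rewrite -EFinM lte_fin (_ : intI (step_fun t a) 0 1 = area 0 t a);
  last exact: intI_step_from.
move=> h; split=> //; rewrite mulrCA ler_wpM2l//; first exact: ltW.
Qed.
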